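(* Let $m\ge1$ and $0<\lambda<1-\frac{2}{m+2}$. There is a polynomial-time algorithm that, given any laminar instance of \textsf{MaxT} with $m$ hosts satisfying $p_j\le\lambda|\chi_j|$ for all jobs $j$, outputs a feasibly scheduled subset of jobs (together with a feasible schedule) whose total profit is at least $\frac12-\lambda\left(\frac12+\frac1m\right)$ times the optimal profit.
   Context: \textsf{MaxT} (preemptive throughput maximization): time is slotted into integer slots $1,\dots,T$. There is a set $M$ of $m$ identical hosts, each having one unit of a single resource, and a set $J$ of jobs. Each job $j$ has a time window $\chi_j=[r_j,d_j]$ (integer slots, $|\chi_j|=d_j-r_j+1$), processing length $p_j\in\mathbb{Z}_{>0}$, resource requirement $s_j\in(0,1]$ and profit $w_j\ge0$. A subset $S\subseteq J$ is feasibly scheduled if there are sets $S_{i,t}\subseteq S$ (jobs run on host $i$ at slot $t$) such that: $j\in S_{i,t}$ only if $t\in\chi_j$; $\sum_{j\in S_{i,t}}s_j\le1$ for all $i,t$; no job runs on two different hosts in the same slot; and each $j\in S$ runs in at least $p_j$ distinct slots of $\chi_j$ (preemption and migration allowed). The goal is to maximize $\sum_{j\in S}w_j$ over feasibly scheduled $S$. The instance is laminar if $\{\chi_j:j\in J\}$ is a laminar family (any two intervals nested or disjoint). *)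

(* Defs.v *)
From mathcomp Require Import all_boot all_order all_algebra.
From mathcomp Require Import boolp reals.

Set Implicit Arguments.
Unset Strict Implicit.
Unset Printing Implicit Defensive.

Import Order.TTheory GRing.Theory Num.Theory.
Local Open Scope ring_scope.

(** * Preemptive throughput maximization

    Requirements and profits are rational, since instances are inputs of an
    algorithm.  The slots 1, ..., T are the nonzero elements of ['I_T.+1]; slot
    0 lies in no window of a valid instance. *)

Record instance := Instance {
  hosts : nat;
  horizon : nat;
  njobs : nat;
  release : 'I_njobs -> nat;
  due : 'I_njobs -> nat;
  len : 'I_njobs -> nat;
  req : 'I_njobs -> rat;
  weight : 'I_njobs -> rat }.

Notation job I := 'I_(njobs I).
Notation host I := 'I_(hosts I).
Notation slot I := 'I_(horizon I).+1.

Definition valid (I : instance) : Prop :=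
  forall j : job I,
    [/\ (1 <= release j <= due j)%N, (due j <= horizon I)%N, (0 < len j)%N,
        0 < req j <= 1 & 0 <= weight j].

Definition window (I : instance) (j : job I) : {set slot I} :=
  [set t : slot I | (release j <= t <= due j)%N].

Definition laminar (I : instance) : Prop :=
  forall j k : job I,
    [|| window j \subset window k, window k \subset window j
      | [disjoint window j & window k]].

Definition schedule (I : instance) := host I -> slot I -> {set job I}.

Definition feasible_schedule (I : instance) (S : {set job I})
    (sch : schedule I) : Prop :=
  [/\ forall i t, sch i t \subset S,
      forall i t j, j \in sch i t -> t \in window j,
      forall i t, \sum_(j in sch i t) req j <= 1,
      forall i i' t j, j \in sch i t -> j \in sch i' t -> i = i'
    & forall j, j \in S ->
        (len j <= #|[set t in window j | [exists i, j \in sch i t]]|)%N].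

Definition feasibly_scheduled (I : instance) (S : {set job I}) : Prop :=
  exists sch : schedule I, feasible_schedule S sch.

Definition profit (I : instance) (S : {set job I}) : rat :=
  \sum_(j in S) weight j.

(** The base value 0 is the profit of the empty set, which is always feasible. *)
Definition opt (I : instance) : rat :=
  \big[Num.max/0]_(S : {set job I} | `[< feasibly_scheduled S >]) profit S.

(** * Machine model

    WHILE programs over registers holding binary trees with integer leaves,
    under the logarithmic cost criterion: every evaluated subexpression costs
    the size of its value, integers being measured by their binary length.  As
    whole trees are charged for, no sharing can hide work or space, and the
    cost is polynomially related to Turing machine time. *)

Inductive data := Atom of int | Node of data & data.

Fixpoint dsize (v : data) : nat :=
  match v with
  | Atom z => (trunc_log 2 `|z|).+1
  | Node a b => (dsize a + dsize b).+1
  end.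

Inductive expr :=
  | Var of nat
  | Lit of int
  | Pair of expr & expr
  | Fst of expr
  | Snd of expr
  | IsPair of expr
  | Add of expr & expr
  | Sub of expr & expr
  | Mul of expr & expr
  | Leq of expr & expr.

Definition store := nat -> data.

(** Total operations: projections of a leaf give the leaf 0, and a pair counts
    as 0 in arithmetic. *)
Definition dfst (v : data) := if v is Node a _ then a else Atom 0.
Definition dsnd (v : data) := if v is Node _ b then b else Atom 0.
Definition dint (v : data) : int := if v is Atom z then z else 0.
Definition dbool (b : bool) : data := Atom b%:Z.
Definition dtrue (v : data) : bool := if v is Atom z then z != 0 else true.

Fixpoint eval (st : store) (e : expr) : data :=
  match e with
  | Var x => st x
  | Lit z => Atom z
  | Pair e1 e2 => Node (eval st e1) (eval st e2)
  | Fst e1 => dfst (eval st e1)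
  | Snd e1 => dsnd (eval st e1)
  | IsPair e1 => dbool (if eval st e1 is Node _ _ then true else false)
  | Add e1 e2 => Atom (dint (eval st e1) + dint (eval st e2))
  | Sub e1 e2 => Atom (dint (eval st e1) - dint (eval st e2))
  | Mul e1 e2 => Atom (dint (eval st e1) * dint (eval st e2))
  | Leq e1 e2 => dbool (dint (eval st e1) <= dint (eval st e2))
  end.

Fixpoint ecost (st : store) (e : expr) : nat :=
  (dsize (eval st e) +
   match e with
   | Var _ | Lit _ => 0
   | Fst e1 | Snd e1 | IsPair e1 => ecost st e1
   | Pair e1 e2 | Add e1 e2 | Sub e1 e2 | Mul e1 e2 | Leq e1 e2 =>
       ecost st e1 + ecost st e2
   end)%N.

Inductive cmd :=
  | Skip
  | Assign of nat & expr
  | Seq of cmd & cmd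
  | If of expr & cmd & cmd
  | While of expr & cmd.

Definition update (st : store) (x : nat) (v : data) : store :=
  fun y => if y == x then v else st y.

(** [exec c st st' n]: run from [st], [c] halts in [st'] at total cost [n]. *)
Inductive exec : cmd -> store -> store -> nat -> Prop :=
  | ExecSkip st : exec Skip st st 1
  | ExecAssign st x e :
      exec (Assign x e) st (update st x (eval st e)) (ecost st e).+1
  | ExecSeq c1 c2 st st1 st2 n1 n2 :
      exec c1 st st1 n1 -> exec c2 st1 st2 n2 ->
      exec (Seq c1 c2) st st2 (n1 + n2).+1
  | ExecIfTrue e c1 c2 st st1 n :
      dtrue (eval st e) -> exec c1 st st1 n ->
      exec (If e c1 c2) st st1 (ecost st e + n).+1
  | ExecIfFalse e c1 c2 st st1 n :
      ~~ dtrue (eval st e) -> exec c2 st st1 n ->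
      exec (If e c1 c2) st st1 (ecost st e + n).+1
  | ExecWhileFalse e c st :
      ~~ dtrue (eval st e) -> exec (While e c) st st (ecost st e).+1
  | ExecWhileTrue e c st st1 st2 n1 n2 :
      dtrue (eval st e) -> exec c st st1 n1 ->
      exec (While e c) st1 st2 n2 ->
      exec (While e c) st st2 (ecost st e + n1 + n2).+1.

(** Input and output are in register 0. *)
Definition computes (c : cmd) (x y : data) (n : nat) : Prop :=
  exists2 st : store, exec c (update (fun=> Atom 0) 0%N x) st n & st 0%N = y.

(** [c] solves, in time polynomial in the size of the encoded input, the
    problem of finding for each [a] in [P] an output satisfying [Q a]. *)
Definition polytime_solves (A : Type) (enc : A -> data) (P : A -> Prop)
    (Q : A -> data -> Prop) (c : cmd) : Prop :=
  exists C k : nat, forall a, P a ->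
    exists y n, [/\ computes c (enc a) y n,
                    (n <= C * dsize (enc a) ^ k + C)%N & Q a y].

(** * Encodings *)

Definition enc_nat (n : nat) : data := Atom n%:Z.

Definition enc_seq (s : seq data) : data := foldr Node (Atom 0) s.

Definition enc_rat (q : rat) : data := Node (Atom (numq q)) (Atom (denq q)).

Definition enc_job (I : instance) (j : job I) : data :=
  enc_seq [:: enc_nat (release j); enc_nat (due j); enc_nat (len j);
              enc_rat (req j); enc_rat (weight j)].

Definition enc_instance (I : instance) : data :=
  enc_seq [:: enc_nat (hosts I); enc_nat (horizon I);
              enc_seq [seq enc_job j | j <- enum (job I)]].

(** As T may be exponential in the size of the input, a schedule is output as a
    list of pieces: the piece [(j, i, a, b)] runs job [j] on host [i] in all the
    slots [a], ..., [b]. *)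
Definition piece (I : instance) := (job I * host I * nat * nat)%type.

Definition schedule_of (I : instance) (ps : seq (piece I)) : schedule I :=
  fun i t => [set j | has (fun '(j', i', a, b) =>
                             [&& j' == j, i' == i & (a <= t <= b)%N]) ps].

Definition enc_piece (I : instance) (q : piece I) : data :=
  let '(j, i, a, b) := q in
  enc_seq [:: enc_nat j; enc_nat i; enc_nat a; enc_nat b].

Definition enc_solution (I : instance) (s : seq (job I))
    (ps : seq (piece I)) : data :=
  Node (enc_seq [seq enc_nat (nat_of_ord j) | j <- s])
       (enc_seq [seq enc_piece q | q <- ps]).

(* Main.v *)
(** Let the area of a job be its length times its requirement, W the length of
    a window and l the largest ratio of a length to the length of its window.  A
    feasible set has area at most mW inside every window.

    Selection: scan the jobs by decreasing profit per unit of area, and keep a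
    job unless the area kept inside some window around it would exceed
    (1 - l) mW / 2.  A job has area at most l W, so a rejection leaves area at
    least c mW in that window, with c = 1/2 - l (1/2 + 1/m).  Looking at the
    disjoint maximal windows of this kind, every prefix of the scan keeps at
    least c times the area of an optimal set, and Abel summation turns area
    into profit.

    Scheduling: insert the kept jobs by increasing window.  A narrow job
    (requirement at most 1/2) goes to the unique host of the slot that is
    nonempty but at most half full, or to an empty host; it prefers slots with
    such a low host, whence at most a fraction l of the slots of a window have
    one.  A wide job goes to an empty host.  A job that does not find enough
    slots would witness an area above (1 - l) mW / 2.

    As there may be exponentially many slots, the schedule is kept as a list of
    intervals of slots in the same state; each job adds at most three of them. *)

Require Import Defs.
From mathcomp Require Import all_boot all_order all_algebra.
From mathcomp Require Import boolp reals.
From mathcomp Require Import zify ring lra.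

Set Implicit Arguments.
Unset Strict Implicit.
Unset Printing Implicit Defensive.

Import Order.TTheory GRing.Theory Num.Theory.
Local Open Scope nat_scope.

(** * Sizes *)

Lemma dsize_gt0 v : 0 < dsize v.
Proof. by case: v. Qed.

Lemma trunc_log_add m n : trunc_log 2 (m + n) <= (trunc_log 2 m + trunc_log 2 n).+1.
Proof.
wlog le_mn : m n / m <= n.
  by move=> W; case: (leqP m n) => [/W//|/ltnW/W]; rewrite addnC [X in _ <= X.+1]addnC.
apply: (@leq_trans (trunc_log 2 n).+1); last by rewrite ltnS leq_addl.
case: (posnP n) le_mn => [-> | n_gt0 le_mn]; first by rewrite leqn0 => /eqP->.
rewrite -trunc_log2_double //; apply: leq_trunc_log.
by rewrite -addnn leq_add2r.
Qed.

Lemma trunc_log_mul m n : trunc_log 2 (m * n) <= (trunc_log 2 m + trunc_log 2 n).+1.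
Proof.
case: (posnP (m * n)) => [-> | mn_gt0]; first by rewrite trunc_log0.
have [m_gt0 n_gt0] : 0 < m /\ 0 < n by apply/andP; rewrite -muln_gt0.
rewrite -ltnS -(ltn_exp2l _ _ (isT : 1 < 2)).
apply: leq_ltn_trans (trunc_logP _ mn_gt0) _ => //.
have -> : forall a b, (a + b).+2 = a.+1 + b.+1 by move=> a b; rewrite addSn addnS.
by rewrite expnD; apply: ltn_mul; apply: trunc_log_ltn.
Qed.

Lemma dsize_atom_add (x y : int) :
  dsize (Atom (x + y)) <= dsize (Atom x) + dsize (Atom y).
Proof.
rewrite /= addSn addnS ltnS.
apply: leq_trans (trunc_log_add _ _); apply: leq_trunc_log; lia.
Qed.

Lemma dsize_atom_mul (x y : int) :
  dsize (Atom (x * y)) <= dsize (Atom x) + dsize (Atom y).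
Proof. by rewrite /= addSn addnS ltnS abszM trunc_log_mul. Qed.

Lemma dsize_bool (b : bool) : dsize (dbool b) = 1.
Proof. by case: b. Qed.

Lemma dsize_dint v : dsize (Atom (dint v)) <= dsize v.
Proof. by case: v. Qed.

Lemma dsize_dfst v : dsize (dfst v) <= dsize v.
Proof. by case: v => //= a b; rewrite leqW ?leq_addr. Qed.

Lemma dsize_dsnd v : dsize (dsnd v) <= dsize v.
Proof. by case: v => //= a b; rewrite leqW ?leq_addl. Qed.

Lemma dsize_nat_le m n : m <= n -> dsize (enc_nat m) <= dsize (enc_nat n).
Proof. by move=> le_mn; rewrite ltnS leq_trunc_log. Qed.

(** * Polynomially bounded functions *)

Definition pbounded A (P : A -> Prop) (N f : A -> nat) : Prop :=
  exists C k, forall a, P a -> f a <= C * N a ^ k.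

Section PBounded.
Variables (A : Type) (P : A -> Prop) (N : A -> nat).
Hypothesis N_gt0 : forall a, 0 < N a.

Lemma pb_const c : pbounded P N (fun=> c).
Proof. by exists c, 0 => a _; rewrite muln1. Qed.

Lemma pb_id : pbounded P N N.
Proof. by exists 1, 1 => a _; rewrite mul1n expn1. Qed.

Lemma pb_add f g : pbounded P N f -> pbounded P N g -> pbounded P N (fun a => f a + g a).
Proof.
move=> [C [k fP]] [C' [k' gP]]; exists (C + C'), (k + k') => a Pa.
rewrite mulnDl leq_add //.
  apply: leq_trans (fP a Pa) _; rewrite leq_mul2l leq_pexp2l ?leq_addr ?orbT //.
apply: leq_trans (gP a Pa) _; rewrite leq_mul2l leq_pexp2l ?leq_addl ?orbT //.
Qed.

Lemma pb_mul f g : pbounded P N f -> pbounded P N g -> pbounded P N (fun a => f a * g a).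
Proof.
move=> [C [k fP]] [C' [k' gP]]; exists (C * C'), (k + k') => a Pa.
by rewrite expnD mulnACA leq_mul ?fP ?gP.
Qed.

Lemma pb_exp f k : pbounded P N f -> pbounded P N (fun a => f a ^ k).
Proof.
move=> [C [l fP]]; exists (C ^ k), (l * k) => a Pa.
rewrite expnM -expnMn; case: k => // k.
by rewrite leq_exp2r // fP.
Qed.
End PBounded.

Ltac pb := match goal with
  | |- pbounded _ _ (fun a => @?f a + @?g a) =>
      refine (@pb_add _ _ _ _ f g _ _); [by move=> ?; apply: dsize_gt0 | pb | pb]
  | |- pbounded _ _ (fun a => @?f a * @?g a) =>
      refine (@pb_mul _ _ _ f g _ _); pb
  | |- pbounded _ _ (fun a => @?f a ^ ?k) =>
      refine (@pb_exp _ _ _ f k _); pb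
  | |- pbounded _ _ (fun _ => ?c) => refine (pb_const _ _ c)
  | |- _ => exact: pb_id
  end.

(** * Programs computing a function *)

Lemma exec_dsize c st st' n r :
  exec c st st' n -> dsize (st' r) <= maxn (dsize (st r)) n.
Proof.
elim=> {c st st' n}.
- by move=> st; rewrite leq_max leqnn.
- move=> st x e; rewrite /update; case: eqP => _; rewrite leq_max ?leqnn //.
  by apply/orP; right; case: e => * /=; rewrite leqW // leq_addr.
- by move=> c1 c2 st st1 st2 n1 n2 _ H1 _ H2; lia.
- by move=> e c1 c2 st st1 n _ _ H; lia.
- by move=> e c1 c2 st st1 n _ _ H; lia.
- by move=> e c st _; rewrite leq_max leqnn.
- by move=> e c st st1 st2 n1 n2 _ _ H1 _ H2; lia.
Qed.

(** [PT P e f]: some program turns [e a] into [f a] for all [a] in [P], in time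
    polynomial in the size of [e a].  The program exists at every base register
    [b], where it finds its input and leaves its output; it may start with
    arbitrary values in the registers above [b], and preserves those below. *)
Definition PT (A : Type) (P : A -> Prop) (e f : A -> data) : Prop :=
  exists (c : nat -> cmd) (C k : nat), forall a, P a ->
  forall b st, st b = e a ->
  exists st' n, [/\ exec (c b) st st' n, st' b = f a,
    forall r, r < b -> st' r = st r & n <= C * dsize (e a) ^ k].

Section Machine.
Variables (A : Type) (P : A -> Prop).
Implicit Types e f g : A -> data.

Lemma PT_size e f : PT P e f -> pbounded P (dsize \o e) (dsize \o f).
Proof.
move=> [c [C [k cP]]]; exists C.+1, k.+1 => a Pa /=.
have [st' [n [/exec_dsize-/(_ 0) H <- _ nP]]] := cP a Pa 0 (fun=> e a) erefl.
have := dsize_gt0 (e a); set d := dsize (e a) in H nP * => d_gt0.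
apply: leq_trans H _; rewrite geq_max; apply/andP; split.
  by rewrite -[X in X <= _]expn1 (leq_trans (leq_pexp2l d_gt0 (ltn0Sn k))) // leq_pmull.
apply: leq_trans nP _; apply: leq_mul => //.
by rewrite leq_pexp2l.
Qed.

Lemma PT_eq e f f' : (forall a, P a -> f a = f' a) -> PT P e f -> PT P e f'.
Proof.
by move=> ff' [c [C [k cP]]]; exists c, C, k => a Pa; rewrite -ff' //; apply: cP.
Qed.

Lemma PT_comp e f g : PT P e f -> PT P f g -> PT P e g.
Proof.
move=> ef; have [C0 [k0 fle]] := PT_size ef.
case: ef => [c1 [C1 [k1 c1P]]] [c2 [C2 [k2 c2P]]].
have [C [k CP]] : pbounded P (dsize \o e)
    (fun a => C1 * dsize (e a) ^ k1 + C2 * (C0 * dsize (e a) ^ k0) ^ k2 + 1).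
  by pb.
exists (fun b => Seq (c1 b) (c2 b)), C, k => a Pa b st stb.
have [st1 [n1 [H1 st1b F1 n1P]]] := c1P a Pa b st stb.
have [st2 [n2 [H2 st2b F2 n2P]]] := c2P a Pa b st1 st1b.
exists st2, (n1 + n2).+1; split=> //.
- exact: ExecSeq H1 H2.
- by move=> r rb; rewrite F2 ?F1.
apply: leq_trans (CP a Pa); rewrite -addn1 leq_add2r leq_add //.
apply: leq_trans n2P _; rewrite leq_mul2l; apply/orP; right.
by case: (k2) => // k'; rewrite leq_exp2r //; apply: fle.
Qed.

End Machine.

Lemma PT_reindex A A' (P : A -> Prop) (P' : A' -> Prop) (h : A' -> A) e f :
  (forall a, P' a -> P (h a)) -> PT P e f -> PT P' (e \o h) (f \o h).
Proof. by move=> PP' [c [C [k cP]]]; exists c, C, k => a /PP'; apply: cP. Qed.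

Lemma PT_sub A (P P' : A -> Prop) e f :
  (forall a, P' a -> P a) -> PT P e f -> PT P' e f.
Proof. exact: (@PT_reindex A A P P' id). Qed.

(** ** Straight-line code *)

Fixpoint at_reg (b : nat) (e : expr) : expr :=
  match e with
  | Var _ => Var b
  | Lit z => Lit z
  | Pair e1 e2 => Pair (at_reg b e1) (at_reg b e2)
  | Fst e1 => Fst (at_reg b e1)
  | Snd e1 => Snd (at_reg b e1)
  | IsPair e1 => IsPair (at_reg b e1)
  | Add e1 e2 => Add (at_reg b e1) (at_reg b e2)
  | Defs.Sub e1 e2 => Defs.Sub (at_reg b e1) (at_reg b e2)
  | Mul e1 e2 => Mul (at_reg b e1) (at_reg b e2)
  | Leq e1 e2 => Leq (at_reg b e1) (at_reg b e2)
  end.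

Lemma eval_at_reg st b e : eval st (at_reg b e) = eval (fun=> st b) e.
Proof. by elim: e => //= [e1 -> e2 ->|e ->|e ->|e ->|e1 -> e2 ->|e1 -> e2 ->|e1 -> e2 ->|e1 -> e2 ->]. Qed.

Lemma eval_linear e : exists C, forall st b,
  dsize (eval st (at_reg b e)) <= C * dsize (st b) /\
  ecost st (at_reg b e) <= C * dsize (st b).
Proof.
have two e1 e2 (op : expr -> expr -> expr) :
    (forall st b, dsize (eval st (op (at_reg b e1) (at_reg b e2))) <=
       (dsize (eval st (at_reg b e1)) + dsize (eval st (at_reg b e2))).+1) ->
    (forall st b, ecost st (op (at_reg b e1) (at_reg b e2)) =
       dsize (eval st (op (at_reg b e1) (at_reg b e2)))
         + (ecost st (at_reg b e1) + ecost st (at_reg b e2))) ->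
    (exists C, forall st b, dsize (eval st (at_reg b e1)) <= C * dsize (st b) /\
       ecost st (at_reg b e1) <= C * dsize (st b)) ->
    (exists C, forall st b, dsize (eval st (at_reg b e2)) <= C * dsize (st b) /\
       ecost st (at_reg b e2) <= C * dsize (st b)) ->
    exists C, forall st b,
      dsize (eval st (op (at_reg b e1) (at_reg b e2))) <= C * dsize (st b) /\
      ecost st (op (at_reg b e1) (at_reg b e2)) <= C * dsize (st b).
  move=> sz co [C1 H1] [C2 H2]; exists (C1 + C2 + C1 + C2 + 1) => st b.
  have [a1 b1] := H1 st b; have [a2 b2] := H2 st b.
  have := sz st b; rewrite co; have := dsize_gt0 (st b); rewrite !mulnDl mul1n.
  by lia.
have one e1 (op : expr -> expr) :
    (forall st b, dsize (eval st (op (at_reg b e1))) <=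
       dsize (eval st (at_reg b e1))) ->
    (forall st b, ecost st (op (at_reg b e1)) =
       dsize (eval st (op (at_reg b e1))) + ecost st (at_reg b e1)) ->
    (exists C, forall st b, dsize (eval st (at_reg b e1)) <= C * dsize (st b) /\
       ecost st (at_reg b e1) <= C * dsize (st b)) ->
    exists C, forall st b,
      dsize (eval st (op (at_reg b e1))) <= C * dsize (st b) /\
      ecost st (op (at_reg b e1)) <= C * dsize (st b).
  move=> sz co [C1 H1]; exists (C1 + C1) => st b.
  have [a1 b1] := H1 st b; have := sz st b; rewrite co !mulnDl; lia.
have bin (x y : data) (u : int) :
    dsize (Atom u) <= dsize (Atom (dint x)) + dsize (Atom (dint y)) ->
    dsize (Atom u) <= (dsize x + dsize y).+1.
  by have := dsize_dint x; have := dsize_dint y; lia.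
elim: e => [x|z|e1 IH1 e2 IH2|e1 IH1|e1 IH1|e1 IH1|e1 IH1 e2 IH2|e1 IH1 e2 IH2|e1 IH1 e2 IH2|e1 IH1 e2 IH2].
- by exists 1 => st b /=; rewrite mul1n addn0.
- exists (dsize (Atom z)) => st b; rewrite /= addn0.
  by rewrite leq_pmulr ?dsize_gt0.
- exact: (two e1 e2 Pair).
- by apply: (one e1 Fst) => // st b; apply: dsize_dfst.
- by apply: (one e1 Snd) => // st b; apply: dsize_dsnd.
- apply: (one e1 IsPair) => // st b; rewrite /eval -/eval dsize_bool.
  exact: dsize_gt0.
- by apply: (two e1 e2 Add) => // st b; apply: bin => //; apply: dsize_atom_add.
- apply: (two e1 e2 Defs.Sub) => // st b; apply: bin => //.
  set y := dint (eval _ (at_reg b e2)).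
  rewrite (_ : dsize (Atom y) = dsize (Atom (- y)%R)); last by rewrite /= abszN.
  exact: dsize_atom_add.
- by apply: (two e1 e2 Mul) => // st b; apply: bin => //; apply: dsize_atom_mul.
- by apply: (two e1 e2 Leq) => // st b; rewrite /eval -/eval dsize_bool.
Qed.

Section StraightLine.
Variables (A : Type) (P : A -> Prop).
Implicit Types e f g : A -> data.

Lemma PT_expr (x : expr) e f :
  (forall a, P a -> eval (fun=> e a) x = f a) -> PT P e f.
Proof.
move=> xP; have [C CP] := eval_linear x.
exists (fun b => Assign b (at_reg b x)), C.+1, 1 => a Pa b st stb.
exists (update st b (eval st (at_reg b x))), (ecost st (at_reg b x)).+1; split.
- exact: ExecAssign.
- by rewrite /update eqxx eval_at_reg stb xP.
- by move=> r rb; rewrite /update ltn_eqF.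
have [_ H] := CP st b; rewrite expn1 mulSn -stb -add1n leq_add ?dsize_gt0 //.
Qed.

Lemma PT_id e : PT P e e.
Proof. exact: (@PT_expr (Var 0)). Qed.

End StraightLine.

Section Branching.
Variables (A : Type) (P : A -> Prop).
Implicit Types e f g : A -> data.

Lemma PT_pair e f g : PT P e f -> PT P e g -> PT P e (fun a => Node (f a) (g a)).
Proof.
move=> ef eg; have [C0 [k0 fle]] := PT_size ef; have [C0' [k0' gle]] := PT_size eg.
case: ef => [c1 [C1 [k1 c1P]]]; case: eg => [c2 [C2 [k2 c2P]]].
have [C [k CP]] : pbounded P (dsize \o e) (fun a => 10 * (dsize (e a)
    + (C0 * dsize (e a) ^ k0 + C0' * dsize (e a) ^ k0')
    + (C1 * dsize (e a) ^ k1 + C2 * dsize (e a) ^ k2) + 1)).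
  by pb.
exists (fun b => Seq (Assign b.+1 (Var b)) (Seq (c1 b.+1)
    (Seq (Assign b.+2 (Var b)) (Seq (c2 b.+2)
       (Assign b (Pair (Var b.+1) (Var b.+2))))))), C, k => a Pa b st stb.
set st1 := update st b.+1 (st b).
have st1b : st1 b.+1 = e a by rewrite /st1 /update eqxx.
have [st2 [n2 [H2 st2b F2 n2P]]] := c1P a Pa b.+1 st1 st1b.
set st3 := update st2 b.+2 (st2 b).
have st3b : st3 b.+2 = e a.
  by rewrite /st3 /update eqxx F2 // /st1 /update ltn_eqF.
have [st4 [n4 [H4 st4b F4 n4P]]] := c2P a Pa b.+2 st3 st3b.
have st4b1 : st4 b.+1 = f a by rewrite F4 // /st3 /update ltn_eqF.
eexists; eexists; split.
- apply: ExecSeq; first exact: ExecAssign.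
  apply: ExecSeq; first exact: H2.
  apply: ExecSeq; first exact: ExecAssign.
  by apply: ExecSeq; [exact: H4 | exact: ExecAssign].
- by rewrite /update eqxx /= st4b st4b1.
- move=> r rb; rewrite /update ltn_eqF // F4 ?(ltn_trans rb) //.
  rewrite /st3 /update ltn_eqF ?(ltn_trans rb) // F2 ?(ltn_trans rb) //.
  by rewrite /st1 /update ltn_eqF ?(ltn_trans rb).
apply: leq_trans (CP a Pa).
have st2bb : st2 b = e a by rewrite F2 // /st1 /update ltn_eqF.
rewrite /= st4b st4b1 stb st2bb.
have := fle a Pa; have := gle a Pa => /=; lia.
Qed.

Lemma PT_if e f g (t : A -> bool) :
  PT P e (fun a => dbool (t a)) -> PT (fun a => P a /\ t a) e f ->
  PT (fun a => P a /\ ~~ t a) e g -> PT P e (fun a => if t a then f a else g a).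
Proof.
move=> [c0 [C0 [k0 c0P]]] [c1 [C1 [k1 c1P]]] [c2 [C2 [k2 c2P]]].
have [C [k CP]] : pbounded P (dsize \o e) (fun a => 10 * (dsize (e a)
    + (C0 * dsize (e a) ^ k0 + C1 * dsize (e a) ^ k1 + C2 * dsize (e a) ^ k2) + 1)).
  by pb.
exists (fun b => Seq (Assign b.+1 (Var b)) (Seq (c0 b.+1)
    (If (Var b.+1) (c1 b) (c2 b)))), C, k => a Pa b st stb.
set st1 := update st b.+1 (st b).
have st1b : st1 b.+1 = e a by rewrite /st1 /update eqxx.
have [st2 [n2 [H2 st2b F2 n2P]]] := c0P a Pa b.+1 st1 st1b.
have st2bb : st2 b = e a by rewrite F2 // /st1 /update ltn_eqF.
have F r : r < b -> st2 r = st r.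
  by move=> rb; rewrite F2 ?(ltn_trans rb) // /st1 /update ltn_eqF ?(ltn_trans rb).
have B := CP a Pa; have D := dsize_bool (t a).
case ta: (t a) in st2b D *.
  have [st3 [n3 [H3 st3b F3 n3P]]] := c1P a (conj Pa ta) b st2 st2bb.
  exists st3; eexists; split; [|exact: st3b| |].
  - apply: ExecSeq; first exact: ExecAssign.
    apply: ExecSeq; first exact: H2.
    by apply: ExecIfTrue H3; rewrite /= st2b.
  - by move=> r rb; rewrite F3 ?F.
  by apply: leq_trans B; rewrite /= st2b D stb; lia.
have [st3 [n3 [H3 st3b F3 n3P]]] := c2P a (conj Pa (negbT ta)) b st2 st2bb.
exists st3; eexists; split; [|exact: st3b| |].
- apply: ExecSeq; first exact: ExecAssign.
  apply: ExecSeq; first exact: H2.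
  by apply: ExecIfFalse H3; rewrite /= st2b.
- by move=> r rb; rewrite F3 ?F.
by apply: leq_trans B; rewrite /= st2b D stb; lia.
Qed.

End Branching.

(** ** Loops *)

Lemma dsize_enc_seq_cat s1 s2 :
  dsize (enc_seq (s1 ++ s2)) = (dsize (enc_seq s1) + dsize (enc_seq s2)).-1.
Proof. by elim: s1 => //= x s1 ->; have := dsize_gt0 (enc_seq s2); lia. Qed.

Lemma size_enc_seq s : size s < dsize (enc_seq s).
Proof. by elim: s => //= x s; lia. Qed.

Lemma dsize_enc_seq_mem T (enc : T -> data) l1 x l2 :
  dsize (enc x) <= dsize (enc_seq (map enc (l1 ++ x :: l2))).
Proof. by rewrite map_cat dsize_enc_seq_cat /=; have := dsize_gt0 (enc_seq (map enc l1)); lia. Qed.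

Lemma dsize_enc_seq_le (s : seq data) B :
  (forall x, List.In x s -> dsize x <= B) -> dsize (enc_seq s) <= size s * B.+1 + 1.
Proof.
elim: s => //= x s IH H; have := H x (or_introl erefl).
have := IH (fun y ys => H y (or_intror ys)); lia.
Qed.

Definition rev_loop (b : nat) : cmd :=
  While (IsPair (Var b))
    (Seq (Assign b.+1 (Pair (Fst (Var b)) (Var b.+1))) (Assign b (Snd (Var b)))).

Lemma exec_rev_loop b l : forall acc st,
  st b = enc_seq l -> st b.+1 = enc_seq acc ->
  exists st' n, [/\ exec (rev_loop b) st st' n, st' b.+1 = enc_seq (catrev l acc),
    forall r, r < b -> st' r = st r
    & n <= (10 * (dsize (enc_seq l) + dsize (enc_seq acc) + 1)) * (size l).+1].
Proof.
elim: l => [|x l IH] acc st stb stb1.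
  exists st; eexists; split; [by apply: ExecWhileFalse; rewrite /= stb| exact: stb1|by []|].
  by rewrite /= stb /=; lia.
set st1 := update st b.+1 (enc_seq (x :: acc)).
set st2 := update st1 b (enc_seq l).
have [||st' [n [H Hb F Hn]]] := IH (x :: acc) st2.
- by rewrite /st2 /update eqxx.
- by rewrite /st2 /st1 /update eqxx gtn_eqF.
exists st'; eexists; split; [|exact: Hb| |].
- apply: ExecWhileTrue; first by rewrite /= stb.
    apply: ExecSeq; apply: ExecAssign.
  rewrite /= stb stb1 /= {3}/update ltn_eqF // stb.
  exact: H.
- move=> r rb; rewrite F // /st2 /st1 /update !ltn_eqF // ltnW //.
rewrite /= stb stb1 /= /update ltn_eqF // stb /= trunc_log1.
move: Hn; rewrite /=; set u := dsize (enc_seq l); set v := dsize (enc_seq acc).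
set B := 10 * _; move=> Hn; have -> : 10 * ((dsize x + u).+1 + v + 1) = B by rewrite /B; lia.
by rewrite mulnS; move: Hn; rewrite /B; lia.
Qed.

Definition fold_body (cs : nat -> cmd) (b : nat) : cmd :=
  Seq (Assign b.+3 (Pair (Var b) (Pair (Fst (Var b.+2)) (Var b.+1))))
    (Seq (cs b.+3) (Seq (Assign b.+1 (Var b.+3)) (Assign b.+2 (Snd (Var b.+2))))).

Section Fold.
Variables (A : Type) (P : A -> Prop) (e : A -> data).
Variables (T S : A -> Type).
Variables (encT : forall a, T a -> data) (encS : forall a, S a -> data).
Variables (l : forall a, seq (T a)) (z : forall a, S a).
Variables (f : forall a, T a -> S a -> S a).

Local Notation state a s := (foldr (@f a) (z a) s).

Definition reached (u : {a : A & (T a * S a)%type}) : Prop :=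
  let: existT a (x, s) := u in
  P a /\ exists l1 l2, l a = l1 ++ x :: l2 /\ s = state a l2.

Lemma PT_foldr :
  PT P e (fun a => enc_seq (map (@encT a) (l a))) ->
  PT P e (fun a => encS (z a)) ->
  PT reached
     (fun u => let: existT a (x, s) := u in Node (e a) (Node (encT x) (encS s)))
     (fun u => let: existT a (x, s) := u in encS (f x s)) ->
  (exists C k, forall a l1 l2, P a -> l a = l1 ++ l2 ->
     dsize (encS (state a l2)) <= C * dsize (e a) ^ k) ->
  PT P e (fun a => encS (state a (l a))).
Proof.
move=> pl pz [c3 [C3 [k3 c3P]]] [C4 [k4 sP]].
have [C1' [k1' lle]] := PT_size pl; have [C2' [k2' zle]] := PT_size pz.
case: pl => [c1 [C1 [k1 c1P]]]; case: pz => [c2 [C2 [k2 c2P]]].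
pose L a := C1' * dsize (e a) ^ k1'.
pose X a := dsize (e a) + L a + C4 * dsize (e a) ^ k4 + 2.
pose Z a := C3 * X a ^ k3 + 20 * X a.
have [C [k CP]] : pbounded P (dsize \o e) (fun a => 10 * (dsize (e a)
    + C1 * dsize (e a) ^ k1 + C2 * dsize (e a) ^ k2 + L a
    + C2' * dsize (e a) ^ k2' + (10 * (L a + 2)) * (L a + 1)
    + (L a + 1) * Z a + X a + 1)).
  by rewrite /Z /X /L; pb.
pose loop b := While (IsPair (Var b.+2)) (fold_body c3 b).
have loopP a (Pa : P a) b : forall l1 l2 st, l a = catrev l1 l2 ->
    st b = e a -> st b.+2 = enc_seq (map (@encT a) l1) -> st b.+1 = encS (state a l2) ->
    exists st' n, [/\ exec (loop b) st st' n, st' b.+1 = encS (state a (l a)),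
      forall r, r < b -> st' r = st r & n <= (size l1).+1 * Z a].
  have X0 : 2 <= X a by rewrite /X leq_addl.
  have lleX : dsize (enc_seq (map (@encT a) (l a))) <= L a by apply: lle.
  have revle l1 l2 : l a = catrev l1 l2 -> dsize (enc_seq (map (@encT a) l1)) <= L a.
    move=> la; apply: leq_trans lleX; rewrite la catrevE map_cat dsize_enc_seq_cat map_rev.
    have -> : dsize (enc_seq (rev (map (@encT a) l1))) = dsize (enc_seq (map (@encT a) l1)).
      elim: {la} (map _ l1) => // y s IH.
      by rewrite rev_cons -cats1 dsize_enc_seq_cat IH /= addn1 addnS /= addnC.
    by have := dsize_gt0 (enc_seq (map (@encT a) l2)); lia.
  elim=> [|x l1 IH] l2 st la stb stb2 stb1.
    exists st; eexists; split; [by apply: ExecWhileFalse; rewrite /= stb2| |by []|].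
      by rewrite la.
    rewrite /= stb2 /= mul1n /Z trunc_log0.
    by apply: leq_trans (leq_addl _ _); apply: leq_trans (leq_mul (leqnn 20) X0).
  have Ru : reached (existT _ a (x, state a l2)).
    by split=> //; exists (rev l1), l2; rewrite la -catrevE.
  set st1 := update st b.+3 (eval st (Pair (Var b) (Pair (Fst (Var b.+2)) (Var b.+1)))).
  have [|st2 [n2 [H2 st2b F2 n2P]]] := c3P _ Ru b.+3 st1.
    by rewrite /st1 /update eqxx /= stb stb2 stb1.
  rewrite /= in st2b n2P.
  set st3 := update st2 b.+1 (eval st2 (Var b.+3)).
  set st4 := update st3 b.+2 (eval st3 (Snd (Var b.+2))).
  have st2E r : r < b.+3 -> st2 r = st r.
    by move=> rb; rewrite F2 // /st1 /update ltn_eqF.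
  have st3b2 : st3 b.+2 = enc_seq (map (@encT a) (x :: l1)).
    by rewrite /st3 /update gtn_eqF // st2E.
  have [||||st5 [n5 [H5 st5b F5 n5P]]] := IH (x :: l2) st4.
  - by rewrite la.
  - by rewrite /st4 /st3 /update !ltn_eqF // ?st2E //; lia.
  - by rewrite /st4 {1}/update eqxx /= st3b2.
  - by rewrite /st4 /st3 /update ltn_eqF // eqxx.
  exists st5; eexists; split; [|exact: st5b| |].
  - apply: ExecWhileTrue H5; first by rewrite /= stb2.
    apply: ExecSeq; first exact: ExecAssign.
    apply: ExecSeq; first exact: H2.
    by apply: ExecSeq; apply: ExecAssign.
  - move=> r rb; have rb' : r < b.+1 by lia. have rb'' : r < b.+2 by lia.
    by rewrite F5 // /st4 /st3 /update !ltn_eqF // st2E //; lia.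
  have D2 : dsize (encS (f x (state a l2))) <= C4 * dsize (e a) ^ k4.
    by apply: (sP a (rev l1) (x :: l2)) => //; rewrite la -catrevE.
  have D1 : dsize (encS (state a l2)) <= C4 * dsize (e a) ^ k4.
    by apply: (sP a (rev (x :: l1)) l2) => //; rewrite la -catrevE.
  have D3 := revle (x :: l1) l2 la; rewrite /= in D3.
  have n2Z : n2 <= C3 * X a ^ k3.
    apply: leq_trans n2P _; rewrite leq_mul2l; apply/orP; right.
    by case: (k3) => // k'; rewrite leq_exp2r // /X; lia.
  have st3b2' : update st2 b.+1 (encS (f x (state a l2))) b.+2 = enc_seq (map (@encT a) (x :: l1)).
    by rewrite -st2b.
  rewrite /= stb stb1 stb2 st2b /=. rewrite st3b2' /= [in X in _ <= X]mulSn trunc_log1.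
  move: n5P n2Z; rewrite /Z; set u := (size l1).+1 * _; rewrite /X.
  lia.
exists (fun b => Seq (Assign b.+1 (Var b)) (Seq (c1 b.+1)
    (Seq (Assign b.+2 (Lit 0)) (Seq (rev_loop b.+1)
    (Seq (Assign b.+3 (Var b)) (Seq (c2 b.+3) (Seq (Assign b.+1 (Var b.+3))
    (Seq (loop b) (Assign b (Var b.+1)))))))))), C, k => a Pa b st stb.
set st1 := update st b.+1 (st b).
have st1b : st1 b.+1 = e a by rewrite /st1 /update eqxx.
have [st2 [n2 [H2 st2b F2 n2P]]] := c1P a Pa b.+1 st1 st1b.
have st2E r : r <= b -> st2 r = st r by move=> rb; rewrite F2 // /st1 /update ltn_eqF.
set st3 := update st2 b.+2 (Atom 0).
have [||st4 [n4 [H4 st4b F4 n4P]]] :=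
   @exec_rev_loop b.+1 (map (@encT a) (l a)) [::] st3.
- by rewrite /st3 /update ltn_eqF.
- by rewrite /st3 /update eqxx.
have st4E r : r <= b -> st4 r = st r.
  by move=> rb; rewrite F4 // /st3 /update ltn_eqF ?st2E //; lia.
set st5 := update st4 b.+3 (st4 b).
have st5b : st5 b.+3 = e a by rewrite /st5 /update eqxx st4E.
have [st6 [n6 [H6 st6b F6 n6P]]] := c2P a Pa b.+3 st5 st5b.
have st6E r : r <= b.+2 -> st6 r = st4 r.
  by move=> rb; rewrite F6 // /st5 /update ltn_eqF.
set st7 := update st6 b.+1 (st6 b.+3).
have [||||st8 [n8 [H8 st8b F8 n8P]]] := loopP a Pa b (rev (l a)) [::] st7.
- by rewrite catrevE cats0 revK.
- by rewrite /st7 /update ltn_eqF // st6E ?st4E //; lia.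
- by rewrite /st7 /update gtn_eqF // st6E // st4b -/(rev _) map_rev.
- by rewrite /st7 /update eqxx st6b.
exists (update st8 b (eval st8 (Var b.+1))); eexists; split.
- apply: ExecSeq; first exact: ExecAssign.
  apply: ExecSeq; first exact: H2.
  apply: ExecSeq; first exact: ExecAssign.
  apply: ExecSeq; first exact: H4.
  apply: ExecSeq; first exact: ExecAssign.
  apply: ExecSeq; first exact: H6.
  apply: ExecSeq; first exact: ExecAssign.
  apply: ExecSeq; first exact: H8.
  exact: ExecAssign.
- by rewrite /update eqxx.
- move=> r rb; have rb' : r <= b by lia. have rb'' : r < b.+1 by lia.
  rewrite /update ltn_eqF // F8 // /st7 /update ltn_eqF // st6E ?st4E //; lia.
apply: leq_trans (CP a Pa).
have D8 : dsize (encS (state a (l a))) <= C4 * dsize (e a) ^ k4 by apply: (sP a [::] (l a)).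
have lleX : dsize (enc_seq (map (@encT a) (l a))) <= L a by apply: lle.
have zleX : dsize (encS (z a)) <= C2' * dsize (e a) ^ k2' by apply: zle.
have szl : size (l a) < L a.
  by apply: leq_trans lleX; rewrite -(size_map (@encT a)); apply: size_enc_seq.
move: n8P n4P; rewrite size_rev size_map => n8P n4P.
have n8Z : n8 <= (L a + 1) * Z a.
  by apply: leq_trans n8P _; rewrite leq_mul2r; apply/orP; right; lia.
have n4Z : n4 <= 10 * (L a + 2) * (L a + 1).
  by apply: leq_trans n4P _; rewrite /= trunc_log0; apply: leq_mul; lia.
rewrite /= stb st8b st4E // stb st6b.
move: n8Z n4Z; set u := (L a + 1) * Z a; set v := 10 * _ * _.
rewrite /= in n2P n6P; rewrite /X trunc_log0; lia.
Qed.

End Fold.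

Section ListLoops.
Variables (A : Type) (P : A -> Prop) (e : A -> data).
Variables (T : A -> Type) (encT : forall a, T a -> data) (l : forall a, seq (T a)).

Definition member (u : {a : A & T a}) : Prop :=
  P (tag u) /\ exists l1 l2, l (tag u) = l1 ++ tagged u :: l2.

Definition enc_member (u : {a : A & T a}) : data := Node (e (tag u)) (encT (tagged u)).

Hypothesis lP : PT P e (fun a => enc_seq (map (@encT a) (l a))).

Lemma PT_elem (S : A -> Type) (encS : forall a, S a -> data) z f (g : {a : A & T a} -> data) :
  PT member enc_member g ->
  PT (@reached A P T S l z f)
    (fun u => let: existT a (x, s) := u in Node (e a) (Node (encT x) (encS a s)))
    (fun u => let: existT a (x, s) := u in g (existT T a x)).
Proof.
move=> gP; pose h (u : {a : A & (T a * S a)%type}) := existT T (tag u) (tagged u).1.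
apply: (@PT_comp _ _ _ (enc_member \o h)).
  by apply: (PT_expr (x := Pair (Fst (Var 0)) (Fst (Snd (Var 0))))) => -[a [x s]].
apply: (@PT_eq _ _ _ (g \o h)); first by case=> a [x s].
apply: PT_reindex gP => -[a [x s]] [Pa [l1 [l2 [la _]]]].
by split=> //; exists l1, l2.
Qed.

Lemma PT_state (S : A -> Type) (encS : forall a, S a -> data) z f :
  PT (@reached A P T S l z f)
    (fun u => let: existT a (x, s) := u in Node (e a) (Node (encT x) (encS a s)))
    (fun u => let: existT a (x, s) := u in encS a s).
Proof. by apply: (PT_expr (x := Snd (Snd (Var 0)))) => -[a [x s]]. Qed.

Lemma PT_map (U : A -> Type) (encU : forall a, U a -> data) (g : forall a, T a -> U a) :
  PT member enc_member (fun u => encU _ (g _ (tagged u))) ->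
  PT P e (fun a => enc_seq (map (@encU a) (map (@g a) (l a)))).
Proof.
move=> gP.
apply: (@PT_eq _ _ _ (fun a => enc_seq (map (@encU a)
    (foldr (fun x s => g a x :: s) [::] (l a))))).
  by move=> a _; congr (enc_seq (map _ _)); elim: (l a) => //= x s ->.
apply: (PT_foldr (encT := encT) (encS := fun a s => enc_seq (map (@encU a) s)) lP).
- exact: (PT_expr (x := Lit 0)).
- apply: (@PT_eq _ _ _ (fun u => Node (let: existT a (x, s) := u in encU a (g a x))
      (let: existT a (x, s) := u in enc_seq (map (@encU a) s)))).
    by case=> a [x s].
  apply: PT_pair; last exact: PT_state.
  exact: (PT_elem _ _ _ gP).
have [C [k gle]] := PT_size gP; have [C' [k' lle]] := PT_size lP.
have [C2 [k2 CP]] : pbounded P (dsize \o e) (fun a => (C' * dsize (e a) ^ k') *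
    (C * (dsize (e a) + C' * dsize (e a) ^ k' + 1) ^ k + 1) + 1).
  by pb.
exists C2, k2 => a l1 l2 Pa la; apply: leq_trans (CP a Pa).
have L : dsize (enc_seq (map (@encT a) (l a))) <= C' * dsize (e a) ^ k' by apply: lle.
apply: leq_trans (dsize_enc_seq_le (B := C * (dsize (e a) + C' * dsize (e a) ^ k' + 1) ^ k) _) _.
  have -> : foldr (fun x s => g a x :: s) [::] l2 = map (g a) l2 by elim: (l2) => //= ? ? ->.
  move=> y; rewrite -map_comp => yl.
  have [x [-> [l3 [l4 xl]]]] : exists x, y = encU a (g a x) /\ exists l3 l4, l a = l3 ++ x :: l4.
    rewrite la; elim: l2 {la} l1 yl => //= x s IH l1 [<-|/IH-/(_ (rcons l1 x)) [x' [-> [l3 [l4]]]]].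
      by exists x; split=> //; exists l1, s.
    by rewrite cat_rcons => lE; exists x'; split=> //; exists l3, l4.
  have /= H := gle (existT T a x) (conj Pa (ex_intro _ l3 (ex_intro _ l4 xl))).
  apply: leq_trans H _; rewrite leq_mul2l; apply/orP; right.
  case: (k) => // k0; rewrite leq_exp2r //.
  by move: L; rewrite xl => L; have := dsize_enc_seq_mem (@encT a) l3 x l4; lia.
rewrite !addn1 ltnS leq_mul2r; apply/orP; right.
have -> : foldr (fun x s => g a x :: s) [::] l2 = map (g a) l2 by elim: (l2) => //= ? ? ->.
rewrite !size_map; apply: leq_trans L.
have := size_enc_seq (map (@encT a) (l a)); rewrite size_map la size_cat; lia.
Qed.

Lemma PT_filter (t : forall a, T a -> bool) :
  PT member enc_member (fun u => dbool (t _ (tagged u))) ->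
  PT P e (fun a => enc_seq (map (@encT a) (filter (@t a) (l a)))).
Proof.
move=> tP.
apply: (@PT_eq _ _ _ (fun a => enc_seq (map (@encT a)
    (foldr (fun x s => if t a x then x :: s else s) [::] (l a))))).
  by move=> a _; congr (enc_seq (map _ _)); elim: (l a) => //= x s ->.
apply: (PT_foldr (encT := encT) (encS := fun a s => enc_seq (map (@encT a) s)) lP).
- exact: (PT_expr (x := Lit 0)).
- pose tt (u : {a : A & (T a * seq (T a))%type}) := t (tag u) (tagged u).1.
  apply: (@PT_eq _ _ _ (fun u => if tt u then let: existT a (x, s) := u in
      enc_seq (map (@encT a) (x :: s)) else let: existT a (x, s) := u in enc_seq (map (@encT a) s))).
    by case=> a [x s] _; rewrite /tt /=; case: (t a x).
  apply: PT_if.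
  + apply: (@PT_eq _ _ _ (fun u => let: existT a (x, s) := u in dbool (t a x))); first by case=> a [x s].
    exact: (PT_elem _ _ _ tP).
  + by apply: (PT_expr (x := Snd (Var 0))) => -[a [x s]].
  + by apply: (PT_expr (x := Snd (Snd (Var 0)))) => -[a [x s]].
have [C [k lle]] := PT_size lP; exists C, k => a l1 l2 Pa la.
apply: leq_trans (lle a Pa); rewrite /= la {la} map_cat dsize_enc_seq_cat.
apply: (@leq_trans (dsize (enc_seq (map (@encT a) l2)))).
  by elim: l2 => //= x s IH; case: ifP => _ //=; lia.
by have := dsize_gt0 (enc_seq (map (@encT a) l1)); lia.
Qed.

Lemma PT_all (t : forall a, T a -> bool) :
  PT member enc_member (fun u => dbool (t _ (tagged u))) ->
  PT P e (fun a => dbool (all (@t a) (l a))).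
Proof.
move=> tP.
apply: (@PT_eq _ _ _ (fun a => dbool (foldr (fun x b => t a x && b) true (l a)))).
  by move=> a _; congr dbool; elim: (l a) => //= x s ->.
apply: (PT_foldr (S := fun=> bool) (encT := encT) (encS := fun=> dbool) lP).
- exact: (PT_expr (x := Lit 1)).
- apply: (@PT_comp _ _ _ (fun u => Node (let: existT a (x, s) := u in dbool (t a x))
      (let: existT a (x, s) := u in dbool s))).
    apply: PT_pair; first exact: (PT_elem _ _ _ tP).
    exact: (PT_state (S := fun=> bool) (fun=> dbool)).
  apply: (PT_expr (x := Mul (Fst (Var 0)) (Snd (Var 0)))) => -[a [x s]] _ /=.
  by case: (t a x); case: s.
by exists 1, 0 => a l1 l2 _ _; rewrite dsize_bool.
Qed.

Lemma PT_bigop (op : nat -> nat -> nat) (idx : nat) (x : expr) (g : forall a, T a -> nat) :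
  (forall m n, dsize (enc_nat (op m n)) <= dsize (enc_nat m) + dsize (enc_nat n)) ->
  (forall m n, eval (fun=> Node (enc_nat m) (enc_nat n)) x = enc_nat (op m n)) ->
  PT member enc_member (fun u => enc_nat (g _ (tagged u))) ->
  PT P e (fun a => enc_nat (\big[op/idx]_(i <- l a) g a i)).
Proof.
move=> opS opE gP.
apply: (@PT_eq _ _ _ (fun a => enc_nat (foldr (fun x s => op (g a x) s) idx (l a)))).
  by move=> a _; congr enc_nat; elim: (l a) => [|y s /= ->]; rewrite (big_nil, big_cons).
apply: (PT_foldr (S := fun=> nat) (encT := encT) (encS := fun=> enc_nat) lP).
- exact: (PT_expr (x := Lit idx)).
- apply: (@PT_comp _ _ _ (fun u => Node (let: existT a (x, s) := u in enc_nat (g a x))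
      (let: existT a (x, s) := u in enc_nat s))).
    apply: PT_pair; first exact: (PT_elem _ _ _ gP).
    exact: (PT_state (S := fun=> nat) (fun=> enc_nat)).
  by apply: (PT_expr (x := x)) => -[a [y s]] _ /=; rewrite opE.
have [C [k gle]] := PT_size (PT_map (encU := fun=> enc_nat) gP).
exists (C + dsize (enc_nat idx)), k => a l1 l2 Pa la.
rewrite mulnDl; apply: (@leq_trans (dsize (enc_seq (map enc_nat (map (g a) l2))) + dsize (enc_nat idx))).
  by elim: (l2) => //= y s IH; apply: leq_trans (opS _ _) _; rewrite /= in IH *; lia.
apply: leq_add; last by rewrite leq_pmulr // expn_gt0 dsize_gt0.
apply: leq_trans (gle a Pa); rewrite /= la !map_cat dsize_enc_seq_cat.
by have := dsize_gt0 (enc_seq (map enc_nat (map (g a) l1))); lia.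
Qed.

Lemma PT_sum (g : forall a, T a -> nat) :
  PT member enc_member (fun u => enc_nat (g _ (tagged u))) ->
  PT P e (fun a => enc_nat (\sum_(i <- l a) g a i)).
Proof.
apply: (@PT_bigop addn 0 (Add (Fst (Var 0)) (Snd (Var 0)))) => // m n.
exact: dsize_atom_add.
Qed.

Lemma PT_prod (g : forall a, T a -> nat) :
  PT member enc_member (fun u => enc_nat (g _ (tagged u))) ->
  PT P e (fun a => enc_nat (\prod_(i <- l a) g a i)).
Proof.
apply: (@PT_bigop muln 1 (Mul (Fst (Var 0)) (Snd (Var 0)))) => // m n.
by rewrite /enc_nat PoszM; apply: dsize_atom_mul.
Qed.

Lemma PT_cat (s : forall a, seq (T a)) :
  PT P e (fun a => enc_seq (map (@encT a) (s a))) ->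
  PT P e (fun a => enc_seq (map (@encT a) (l a ++ s a))).
Proof.
move=> sP; have catE a s1 : foldr (fun x s' => x :: s') (s a) s1 = s1 ++ s a.
  by elim: s1 => //= ? ? ->.
apply: (@PT_eq _ _ _ (fun a => enc_seq (map (@encT a)
    (foldr (fun x s' => x :: s') (s a) (l a))))); first by move=> a _; rewrite catE.
apply: (PT_foldr (S := fun a => seq (T a)) (encT := encT)
    (encS := fun a s => enc_seq (map (@encT a) s)) (z := s) (f := fun a x s => x :: s) lP) => //.
  by apply: (PT_expr (x := Snd (Var 0))) => -[a [x s']].
have [C [k sle]] := PT_size sP; have [C' [k' lle]] := PT_size lP.
exists (C + C'), (k + k') => a l1 l2 Pa la.
rewrite catE.
have /= L := lle a Pa; have /= S := sle a Pa; rewrite la map_cat dsize_enc_seq_cat in L.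
rewrite map_cat dsize_enc_seq_cat.
have E1 : dsize (e a) ^ k <= dsize (e a) ^ (k + k') by rewrite leq_pexp2l ?dsize_gt0 ?leq_addr.
have E2 : dsize (e a) ^ k' <= dsize (e a) ^ (k + k') by rewrite leq_pexp2l ?dsize_gt0 ?leq_addl.
have := leq_mul (leqnn C) E1; have := leq_mul (leqnn C') E2; rewrite mulnDl.
have := dsize_gt0 (enc_seq (map (@encT a) l1)); lia.
Qed.

End ListLoops.

Section InsertionSort.
Variables (T : eqType) (le : rel T).

Definition insert (x : T) (s : seq T) : seq T :=
  [seq y <- s | ~~ le x y] ++ x :: [seq y <- s | le x y].
Definition isort (s : seq T) : seq T := foldr insert [::] s.

Lemma perm_insert x s : perm_eq (insert x s) (x :: s).
Proof.
rewrite /insert perm_catC cat_cons perm_cons.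
by have /permPl -> := perm_filterC (le x) s.
Qed.

Lemma perm_isort s : perm_eq (isort s) s.
Proof.
elim: s => //= x s IH; apply: perm_trans (perm_insert x _) _.
by rewrite perm_cons.
Qed.

Lemma isort_pairwise s : total le -> transitive le -> pairwise le (isort s).
Proof.
move=> tot tr; elim: s => //= x s IH.
rewrite /insert pairwise_cat /= !(pairwise_filter _ IH) filter_all !andbT.
apply/allrelP => y z; rewrite mem_filter inE => /andP[nxy _].
have yx : le y x by have := tot x y; rewrite (negbTE nxy).
by case/predU1P=> [->//|]; rewrite mem_filter => /andP[/(tr _ _ _ yx)].
Qed.

End InsertionSort.

(** * Greedy selection *)

Lemma laminar_sum_ge0 (R : numDomainType) (T : Type) (I : eqType) (C : seq T)
    (K : seq I) (A : I -> T -> bool) (f : T -> R) :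
  {in K &, forall k l, [\/ forall x, A k x -> A l x, forall x, A l x -> A k x
                         | forall x, A k x -> ~~ A l x]} ->
  {in K, forall k, 0 <= \sum_(x <- C | A k x) f x}%R ->
  (0 <= \sum_(x <- C | has (A^~ x) K) f x)%R.
Proof.
have [n] := ubnP (size K); elim: n K => // n IH [|k K] /= sK lam f_ge0.
  by rewrite big_pred0.
have kK l : l \in K -> l \in k :: K by rewrite inE orbC => ->.
have lamK : {in K &, forall k l, [\/ forall x, A k x -> A l x,
    forall x, A l x -> A k x | forall x, A k x -> ~~ A l x]}.
  by move=> l1 l2 /kK ? /kK ?; apply: lam.
have [[l lK kl]|no] := EM (exists2 l, l \in K & forall x, A k x -> A l x).
  rewrite (eq_bigl (fun x => has (A^~ x) K)).
    by apply: IH => // l' /kK; apply: f_ge0.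
  move=> x; case Akx: (A k x) => //=; apply/esym/hasP; exists l => //; exact: kl.
pose K1 := [seq l <- K | `[< forall x, A k x -> ~~ A l x >]].
have K1K l : l \in K1 -> l \in K by rewrite mem_filter => /andP[].
rewrite (bigID (A k)) /= addr_ge0 //.
  rewrite (eq_bigl (A k)); first by apply: f_ge0; rewrite mem_head.
  by move=> x; case: (A k x); rewrite ?andbF.
rewrite (eq_bigl (fun x => has (A^~ x) K1)).
  apply: IH => [|l1 l2 /K1K ? /K1K ?|l /K1K/kK]; [|exact: lamK|exact: f_ge0].
  by apply: leq_ltn_trans (size_subseq (filter_subseq _ _)) _.
move=> x; apply/andP/hasP => [[/orP[->//|/hasP[l lK Alx]] nAkx]|[l lK1 Alx]].
  exists l => //; rewrite mem_filter lK andbT; apply/asboolP.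
  case: (lam k l (mem_head _ _) (kK l lK)) => // [kl|/(_ x Alx)]; last by rewrite (negbTE nAkx).
  by case: no; exists l.
split; first by apply/orP; right; apply/hasP; exists l => //; apply: K1K.
move: lK1; rewrite mem_filter => /andP[/asboolP H _].
by apply/negP => /H; rewrite Alx.
Qed.

(* Abel summation; the lower bound [r] makes the induction go through. *)
Lemma sorted_weighted_sum (R : numDomainType) (T : Type) (w f : T -> R) (L : seq T) (r : R) :
  sorted (fun x y => w x <= w y)%R L -> (forall x, 0 <= w x)%R ->
  all (fun x => r <= w x)%R L ->
  (forall L1 L2, L = L1 ++ L2 -> 0 <= \sum_(x <- L2) f x)%R ->
  (r * \sum_(x <- L) f x <= \sum_(x <- L) w x * f x)%R.
Proof.
move=> sL w_ge0; elim: L r sL => [|x L IH] r sL rL f_ge0; first by rewrite !big_nil mulr0.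
have f0 := f_ge0 [::] (x :: L) erefl.
have tr : transitive (fun x y => w x <= w y)%R by move=> y u v; apply: le_trans.
have xL : all (fun y => w x <= w y)%R L by apply: (order_path_min tr).
have {IH} := IH (w x) (path_sorted sL) xL (fun L1 L2 LE => f_ge0 (x :: L1) L2 (congr1 (cons x) LE)).
move: rL => /andP[rx _]; rewrite !big_cons in f0 *.
rewrite -(lerD2l (w x * f x)) -mulrDr; apply: le_trans.
by rewrite ler_wpM2r.
Qed.

Section Jobs.
Variables (J : eqType) (rel due len sz : J -> nat) (m D : nat).

Definition width j := (due j).+1 - rel j.
Definition sub j k := (rel k <= rel j) && (due j <= due k).
Definition disj j k := (due j < rel k) || (due k < rel j).
Definition area j := len j * sz j.
Definition load (S : seq J) k := \sum_(j <- S | sub j k) area j.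

(** With [i] ranging over all jobs this says [2 x <= D m (1 - l) width k],
    where [l] is the largest ratio [len i / width i]. *)
Definition within (x : nat) (k i : J) : bool :=
  2 * x * width i + D * m * len i * width k <= D * m * width i * width k.

Definition fits (all_jobs S : seq J) (j : J) : bool :=
  all (fun k => sub j k ==> all (within (load S k + area j) k) all_jobs) all_jobs.

Definition select (all_jobs L : seq J) : seq J :=
  foldr (fun j S => if fits all_jobs S j then j :: S else S) [::] L.

Lemma sub_trans : transitive sub.
Proof. by move=> k j l /andP[a b] /andP[c d]; rewrite /sub; lia. Qed.

Lemma select_cat all_jobs L1 L2 :
  exists2 S1, subseq S1 L1 & select all_jobs (L1 ++ L2) = S1 ++ select all_jobs L2.
Proof.
elim: L1 => [|j L1 [S1 sS1 SE]] /=; first by exists [::].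
rewrite SE; case: ifP => _; first by exists (j :: S1) => //=; rewrite eqxx.
by exists S1 => //; apply: subseq_trans sS1 (subseq_cons _ _).
Qed.

Lemma select_subseq all_jobs L : subseq (select all_jobs L) L.
Proof. by have [S1 sS] := select_cat all_jobs L [::]; rewrite !cats0 => ->. Qed.

Lemma load_cons j S k : load (j :: S) k = (if sub j k then area j else 0) + load S k.
Proof. by rewrite /load big_cons; case: ifP. Qed.

Lemma select_within all_jobs L k i :
  {in all_jobs, forall j, len j <= width j} ->
  k \in all_jobs -> i \in all_jobs -> within (load (select all_jobs L) k) k i.
Proof.
move=> lenle kA iA; elim: L => [|j L IH] /=.
  rewrite /load big_nil /within muln0 mul0n add0n leq_mul //.
  by rewrite leq_mul // lenle.
case: ifP => // /allP/(_ k kA) /implyP fit; rewrite load_cons.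
by case: ifP => [/fit /allP/(_ i iA)|//]; rewrite addnC.
Qed.

Section Profit.
Variables (R : realFieldType) (lambda c : R) (all_jobs : seq J).
Local Open Scope ring_scope.
Hypothesis m_gt0 : (0 < m)%N.
Hypothesis D_gt0 : (0 < D)%N.
Hypothesis cE : 2 * c * m%:R = m%:R - lambda * (m%:R + 2).
Hypothesis c01 : 0 <= c <= 1.
Hypothesis rel_due : {in all_jobs, forall j, rel j <= due j}%N.
Hypothesis lenP : {in all_jobs, forall j, (len j)%:R <= lambda * (width j)%:R}.
Hypothesis szD : {in all_jobs, forall j, sz j <= D}%N.
Hypothesis lam : {in all_jobs &, forall j k, [|| sub j k, sub k j | disj j k]}.

Lemma lambda_ge0 j : j \in all_jobs -> 0 <= lambda.
Proof.
move=> jA; have := lenP jA; have := rel_due jA => rd.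
have W : (0 < (width j)%:R :> R) by rewrite ltr0n /width; lia.
by move=> H; rewrite -(pmulr_lge0 _ W) (le_trans _ H).
Qed.

Lemma select_rejected L j : uniq L -> {subset L <= all_jobs} -> j \in L ->
  j \notin select all_jobs L ->
  exists2 k, k \in all_jobs & sub j k /\
    c * (D * m * width k)%:R <= (load (select all_jobs L) k)%:R.
Proof.
elim: L j => // x L IH j /= /andP[xL uL] LA.
have LA' : {subset L <= all_jobs} by move=> y yL; apply: LA; rewrite inE yL orbT.
rewrite inE => /predU1P[-> {j}|jL] jS; last first.
  have [|k kA [jk le]] := IH j uL LA' jL.
    by apply: contraNN jS; case: ifP => // _; rewrite inE orbC => ->.
  exists k => //; split=> //; case: ifP => // _; apply: le_trans le _.
  by rewrite ler_nat load_cons leq_addl.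
move: jS; case: ifPn => [|nfit _]; first by rewrite mem_head.
have [k kA] := allPn nfit; rewrite negb_imply => /andP[xk /allPn[i iA]].
rewrite -ltnNge => H; exists k => //; split=> //.
have xA := LA x (mem_head _ _).
have xW : (width x <= width k)%N by case/andP: xk; rewrite /width; lia.
have Wi : 0 < (width i)%:R :> R by rewrite ltr0n /width; have := rel_due iA; lia.
set l := load _ _ in H *.
have {}H : (D * m)%:R * (width i)%:R * (width k)%:R <
    2 * (l%:R + (area x)%:R) * (width i)%:R + (D * m)%:R * (len i)%:R * (width k)%:R :> R.
  by rewrite -!natrM -natrD -!natrM -natrD ltr_nat.
have ax : (area x)%:R <= lambda * (width k)%:R * D%:R.
  rewrite natrM ler_pM //; last by rewrite ler_nat szD.
  by apply: le_trans (lenP xA) _; rewrite ler_wpM2l ?ler_nat ?(lambda_ge0 xA).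
have H2 : (D * m)%:R * (width i)%:R * (width k)%:R <
    (2 * (l%:R + lambda * (width k)%:R * D%:R) + (D * m)%:R * lambda * (width k)%:R) * (width i)%:R :> R.
  apply: lt_le_trans H _; rewrite [X in _ <= X]mulrDl lerD //.
    by rewrite ler_wpM2r // ler_wpM2l // lerD2l.
  have -> : (D * m)%:R * (len i)%:R * (width k)%:R
      = (D * m)%:R * (width k)%:R * (len i)%:R :> R by ring.
  have -> : (D * m)%:R * lambda * (width k)%:R * (width i)%:R
      = (D * m)%:R * (width k)%:R * (lambda * (width i)%:R) :> R by ring.
  by rewrite ler_wpM2l ?mulr_ge0 ?lenP.
have {}H2 : (D * m)%:R * (width k)%:R <
    2 * (l%:R + lambda * (width k)%:R * D%:R) + (D * m)%:R * lambda * (width k)%:R :> R.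
  by rewrite -(ltr_pM2r Wi) mulrAC.
apply: ltW; rewrite -(ltr_pM2l (ltr0Sn R 1)).
have -> : 2 * (c * (D * m * width k)%:R) = (2 * c * m%:R) * (D%:R * (width k)%:R).
  by rewrite !natrM; ring.
by rewrite cE; move: H2; rewrite natrM; lra.
Qed.

Variable O : pred J.
Hypothesis areaO : {in all_jobs, forall k,
  (\sum_(j <- all_jobs | O j && sub j k) area j)%:R <= (D * m * width k)%:R :> R}.

(* Outside the windows saturated by [load >= c D m width], all jobs considered so
   far are selected; the maximal saturated windows are disjoint. *)
Lemma select_area L1 L2 : perm_eq (L1 ++ L2) all_jobs -> uniq (L1 ++ L2) ->
  0 <= \sum_(j <- L2) ((j \in select all_jobs (L1 ++ L2))%:R - c * (O j)%:R) * (area j)%:R.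
Proof.
move=> LP uL; have /andP[c_ge0 c_le1] := c01.
have L2A : {subset L2 <= all_jobs}.
  by move=> j jL; rewrite -(perm_mem LP) mem_cat jL orbT.
have uL2 : uniq L2 by move: uL; rewrite cat_uniq => /and3P[].
have [S1 sS1 SE] := select_cat all_jobs L1 L2.
have sS := select_subseq all_jobs L2.
set S := select all_jobs L2 in SE sS.
rewrite (eq_big_seq (fun j => ((j \in S)%:R - c * (O j)%:R) * (area j)%:R)); last first.
  move=> j jL; rewrite SE mem_cat; case jS1 : (j \in S1) => //=.
  move: uL; rewrite cat_uniq => /and3P[_ /hasPn/(_ j jL)/=/negP[]].
  exact: mem_subseq sS1 _ jS1.
pose K := [seq k <- all_jobs | c * (D * m * width k)%:R <= (load S k)%:R].
have KA k : k \in K -> k \in all_jobs by rewrite mem_filter => /andP[].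
have sumS (p : pred J) : (\sum_(j <- S | p j) area j)%:R
    = \sum_(j <- L2 | p j) (j \in S)%:R * (area j)%:R :> R.
  rewrite {1}(subseq_uniqP uL2 sS) big_filter_cond natr_sum big_mkcond /=.
  rewrite [RHS]big_mkcond; apply: eq_bigr => j _.
  by case: (j \in S); case: (p j); rewrite ?mul1r ?mul0r.
rewrite (bigID (fun j => has (fun k => sub j k) K)) /= addr_ge0 //.
  rewrite big_seq_cond (eq_bigl (fun j => has (fun k => (j \in L2) && sub j k) K)); last first.
    by move=> j; case: (j \in L2) => //=; rewrite has_pred0.
  apply: (@laminar_sum_ge0 _ _ _ L2 K (fun k j => (j \in L2) && sub j k)
    (fun j => ((j \in S)%:R - c * (O j)%:R) * (area j)%:R)) => [k l /KA kA /KA lA|k].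
    have /or3P[kl|lk|dkl] := lam kA lA.
    - by constructor 1 => j /andP[-> jk] /=; apply: sub_trans jk kl.
    - by constructor 2 => j /andP[-> jk] /=; apply: sub_trans jk lk.
    constructor 3 => j /andP[jL2 jk]; rewrite jL2 /=; apply/negP => jl.
    by move: jk jl dkl; rewrite /sub /disj; have := rel_due (L2A j jL2); lia.
  rewrite mem_filter => /andP[Kk kA]; rewrite -big_seq_cond.
  under eq_bigr do rewrite mulrBl -mulrA.
  rewrite sumrB subr_ge0 -mulr_sumr -sumS; apply: le_trans Kk.
  rewrite ler_wpM2l //; apply: le_trans (areaO kA).
  rewrite natr_sum -(perm_big _ LP) /= big_cat /=.
  have E (s : seq J) : \sum_(j <- s | sub j k) (O j)%:R * (area j)%:R
      = \sum_(j <- s | O j && sub j k) (area j)%:R :> R.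
    rewrite big_mkcond [RHS]big_mkcond; apply: eq_bigr => j _.
    by case: (O j); case: (sub j k); rewrite ?mul1r ?mul0r.
  by rewrite E lerDr sumr_ge0.
rewrite big_seq_cond sumr_ge0 // => j /andP[jL2 nK]; rewrite mulr_ge0 //.
have -> : j \in S.
  apply: contraNT nK => jS; have [k kA [jk le]] := select_rejected uL2 L2A jL2 jS.
  by apply/hasP; exists k => //; rewrite mem_filter le.
by case: (O j); rewrite subr_ge0 ?mulr1 ?mulr0.
Qed.

Lemma select_profit (w : J -> R) L : perm_eq L all_jobs -> uniq L ->
  (forall j, 0 <= w j) -> {in all_jobs, forall j, (0 < area j)%N} ->
  sorted (fun j k => w j * (area k)%:R <= w k * (area j)%:R) L ->
  c * \sum_(j <- L | O j) w j <= \sum_(j <- select all_jobs L) w j.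
Proof.
move=> LP uL w_ge0 area_gt0 sL.
pose f j := ((j \in select all_jobs L)%:R - c * (O j)%:R) * (area j)%:R.
pose r j := w j / (area j)%:R.
have := @sorted_weighted_sum _ _ r f L 0.
rewrite mul0r => H; rewrite -subr_ge0; apply: le_trans (H _ _ _ _) _.
- have LA : all (mem L) L by apply/allP.
  apply: sub_in_sorted LA sL => j k; rewrite !inE !(perm_mem LP) => jA kA le.
  by rewrite /r ler_pdivrMr ?ltr0n ?area_gt0 // mulrAC ler_pdivlMr ?ltr0n ?area_gt0.
- by move=> j; rewrite divr_ge0.
- by apply/allP => j _; rewrite divr_ge0.
- by move=> L1 L2 LE; rewrite /f LE; apply: select_area; rewrite -LE.
rewrite (eq_big_seq (fun j => (j \in select all_jobs L)%:R * w j - c * ((O j)%:R * w j))); last first.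
  move=> j; rewrite (perm_mem LP) => jA; rewrite /r /f.
  have : (area j)%:R != 0 :> R by rewrite pnatr_eq0 gtn_eqF ?area_gt0.
  by move: (area j)%:R (j \in _)%:R => a x a0; field.
rewrite sumrB -mulr_sumr lerB //.
  rewrite {2}(subseq_uniqP uL (select_subseq all_jobs L)) big_filter [leRHS]big_mkcond.
  by apply: ler_sum => j _; case: (_ \in _); rewrite ?mul1r ?mul0r.
rewrite ler_wpM2l ?(andP c01).1 // big_mkcond.
by apply: ler_sum => j _; case: (O j); rewrite ?mul1r ?mul0r.
Qed.

End Profit.

(** * Scheduling *)

(** The state [(h, g, l)] of a slot: hosts [0 .. h - 1] are more than half full
    of narrow jobs, host [h] has narrow jobs of total size [l], at most half,
    and the last [g] hosts run one wide job each. *)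
Definition state := (nat * nat * nat)%type.

(** [(a, b, p)]: the slots [a .. b - 1], all in state [p]. *)
Definition segment := (nat * nat * state)%type.

Definition narrow j := 2 * sz j <= D.

Definition open_for j (p : state) : bool :=
  let: (h, g, l) := p in
  if narrow j then h + g < m else h + g + (0 < l) < m.

Definition add_job j (p : state) : state :=
  let: (h, g, l) := p in
  if narrow j then
    if 2 * (l + sz j) <= D then (h, g, l + sz j) else (h.+1, g, 0)
  else (h, g.+1, l).

Definition host_for j (p : state) : nat :=
  let: (h, g, l) := p in if narrow j then h else m - g.+1.

Definition low (p : state) : bool := 0 < p.2.

Definition consif T (c : bool) (x : T) (s : seq T) := if c then x :: s else s.

Definition run := (J * nat * nat * nat)%type.

(** Uses as many slots of the segment as possible, the last ones first; [R] is
    the number of slots that [j] still needs. *)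
Definition place_seg j (x : segment) (st : nat * (seq segment * seq run)) :
    nat * (seq segment * seq run) :=
  let: (a, b, p) := x in let: (R, (out, ps)) := st in
  let b' := minn b (due j).+1 in
  let k := minn R (b' - maxn a (rel j)) in
  if open_for j p && (0 < k) then
    (R - k,
     (consif (a < b' - k) (a, b' - k, p)
        ((b' - k, b', add_job j p) :: consif (b' < b) (b', b, p) out),
      (j, host_for j p, b' - k, b'.-1) :: ps))
  else (R, (x :: out, ps)).

(** Slots with a low host come last, so that [foldr] tries them first. *)
Definition low_last T (st : T -> state) (s : seq T) : seq T :=
  [seq x <- s | ~~ low (st x)] ++ [seq x <- s | low (st x)].

Definition place_job j (st : seq segment * seq run) :=
  (foldr (place_seg j) (len j, ([::], st.2)) (low_last snd st.1)).2.

Definition schedule_jobs (T : nat) (S : seq J) : seq segment * seq run :=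
  foldr place_job ([:: (1, T.+1, (0, 0, 0))], [::]) S.

(** ** Slot by slot *)

Definition cell := (nat * state)%type.

Definition cells1 (x : segment) : seq cell :=
  [seq (t, x.2) | t <- iota x.1.1 (x.1.2 - x.1.1)].
Definition cells (s : seq segment) : seq cell := flatten (map cells1 s).

Definition unit_run := (J * nat * nat)%type.
Definition runs1 (q : run) : seq unit_run :=
  let: (j, i, a, b) := q in [seq (j, i, t) | t <- iota a (b.+1 - a)].
Definition unit_runs (ps : seq run) : seq unit_run := flatten (map runs1 ps).

Definition inwin j t := rel j <= t <= due j.
Definition eligible j (c : cell) : bool := inwin j c.1 && open_for j c.2.
Definition addc j (c : cell) : cell := (c.1, add_job j c.2).
Definition runc j (c : cell) : unit_run := (j, host_for j c.2, c.1).

Definition place_cell j (c : cell) (st : nat * (seq cell * seq unit_run)) :=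
  let: (R, (out, us)) := st in
  if eligible j c && (0 < R) then (R.-1, (addc j c :: out, runc j c :: us))
  else (R, (c :: out, us)).

Lemma place_cells_skip j R out us cs :
  all (fun c => ~~ eligible j c) cs || (R == 0) ->
  foldr (place_cell j) (R, (out, us)) cs = (R, (cs ++ out, us)).
Proof.
elim: cs => //= c cs IH H; rewrite IH; last by case: (_ == 0) H; rewrite ?orbT ?orbF // => /andP[].
rewrite /place_cell; case: ifP => // /andP[el R_gt0].
by move: H; rewrite el gtn_eqF.
Qed.

Lemma place_cells_take j R out us cs :
  all (eligible j) cs -> size cs <= R ->
  foldr (place_cell j) (R, (out, us)) cs =
    (R - size cs, (map (addc j) cs ++ out, map (runc j) cs ++ us)).
Proof.
elim: cs => [|c cs IH] /=; first by rewrite subn0.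
move=> /andP[el els] sz_le; rewrite IH ?(ltnW sz_le) //= el subn_gt0 sz_le /=.
by rewrite subnS.
Qed.

Lemma cells_cat s1 s2 : cells (s1 ++ s2) = cells s1 ++ cells s2.
Proof. by rewrite /cells map_cat flatten_cat. Qed.

Lemma cells_cons x s : cells (x :: s) = cells1 x ++ cells s.
Proof. by []. Qed.

Lemma cells_consif a b p s : cells (consif (a < b) (a, b, p) s) = cells1 (a, b, p) ++ cells s.
Proof.
rewrite /consif; case: ltnP => // ba.
by rewrite /cells1 /= (eqP (ba : b - a == 0)).
Qed.

Lemma place_seg_cells j x R out ps :
  let: (R', (out', ps')) := place_seg j x (R, (out, ps)) in
  foldr (place_cell j) (R, (cells out, unit_runs ps)) (cells1 x)
    = (R', (cells out', unit_runs ps')).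
Proof.
case: x => [[a b] p] /=; set b' := minn b _; set k := minn R _.
case: ifPn => [/andP[op k_gt0]|no]; last first.
  rewrite cells_cons; apply: place_cells_skip; rewrite all_map.
  case: (posnP R) => [_|R_gt0]; rewrite ?orbT // orbF.
  apply/allP => t; rewrite mem_iota /= => tab; apply/negP => /andP[/= tw op].
  move: no; rewrite op /= -leqNgt leqn0 /k /b' => /eqP.
  by move: tw R_gt0 tab; rewrite /inwin; lia.
have kE : a <= b' - k /\ b' - k + k = b' /\ b' <= b /\ rel j <= b' - k /\ k <= R
   /\ b' <= (due j).+1 /\ (k = R \/ b' - k <= maxn a (rel j)).
  by move: k_gt0; rewrite /k /b'; lia.
case: kE => k1 [k2 [k3 [k4 [k5 [k6 k7]]]]].
rewrite cells_consif cells_cons cells_consif.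
have -> : cells1 (a, b, p) = cells1 (a, b' - k, p) ++ cells1 (b' - k, b', p) ++ cells1 (b', b, p).
  rewrite /cells1 /= -!map_cat; congr map.
  have -> : b - a = (b' - k - a) + ((b' - (b' - k)) + (b - b')) by lia.
  by rewrite !iotaD; congr (_ ++ (iota _ _ ++ iota _ _)); lia.
rewrite !foldr_cat place_cells_skip; last first.
  rewrite all_map; apply/orP; left; apply/allP => t; rewrite mem_iota /= => tb.
  apply/negP => /andP[/andP[_ /= tw] _].
  have : b' <= t /\ t < b by lia.
  by move: tw; rewrite /b'; lia.
rewrite place_cells_take; first last.
- by rewrite size_map size_iota /=; lia.
- rewrite all_map; apply/allP => t; rewrite mem_iota /= => tb.
  by rewrite /= /eligible op andbT /inwin /=; lia.
have sz2 : size (cells1 (b' - k, b', p)) = k by rewrite size_map size_iota /=; lia.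
rewrite place_cells_skip; last first.
  rewrite all_map sz2; case: k7 => [->|k7]; first by rewrite subnn eqxx orbT.
  apply/orP; left; apply/allP => t; rewrite mem_iota /= => tb.
  by apply/negP => /andP[/andP[/= tw _] _]; lia.
rewrite sz2; congr (_, (_ ++ _ ++ _, _)).
  by rewrite /cells1 -map_comp.
by rewrite /unit_runs /= /cells1 -map_comp prednK //; lia.
Qed.

Lemma place_segs_cells j X R out ps :
  let: (R', (out', ps')) := foldr (place_seg j) (R, (out, ps)) X in
  foldr (place_cell j) (R, (cells out, unit_runs ps)) (cells X)
    = (R', (cells out', unit_runs ps')).
Proof.
elim: X => //= x X; case: (foldr _ _ X) => R' [out' ps'] E.
by rewrite cells_cons foldr_cat E; apply: place_seg_cells.
Qed.

Lemma cells_low_last s : cells (low_last snd s) = low_last snd (cells s).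
Proof.
have H p s' : cells [seq x <- s' | p x.2] = [seq c <- cells s' | p c.2].
  have H1 x : [seq c <- cells1 x | p c.2] = if p x.2 then cells1 x else [::].
    rewrite /cells1 filter_map; case px: (p x.2).
      by rewrite (@eq_filter _ _ predT) ?filter_predT // => t /=.
    by rewrite (@eq_filter _ _ pred0) ?filter_pred0 // => t /=.
  elim: s' => //= x s' IH; rewrite cells_cons filter_cat -IH H1.
  by case: (p x.2).
by rewrite /low_last cells_cat (H low) (H (fun p => ~~ low p)).
Qed.

Lemma perm_low_last (s : seq cell) : perm_eq (low_last snd s) s.
Proof.
rewrite /low_last perm_catC.
by have /permPl -> := perm_filterC (fun x : cell => low x.2) s.
Qed.

Definition taken j (R : nat) (C : seq cell) : seq cell :=
  let E := [seq c <- C | eligible j c] in drop (size E - R) E.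

Lemma taken_sub j R C : {subset taken j R C <= [seq c <- C | eligible j c]}.
Proof. by move=> c; apply: mem_drop. Qed.

Lemma place_cells j R us C : uniq C ->
  foldr (place_cell j) (R, ([::], us)) C =
    (R - size (taken j R C),
      ([seq (if c \in taken j R C then addc j c else c) | c <- C],
       map (runc j) (taken j R C) ++ us)).
Proof.
elim: C => [|c C IH] /=; first by rewrite subn0.
move=> /andP[cC uC]; rewrite {}IH // /taken /=; case el: (eligible j c) => /=; last first.
  case: ifP => // /taken_sub.
  by rewrite mem_filter (negbTE cC) andbF.
set E := [seq _ <- _ | _]; have cE : c \notin E by rewrite mem_filter (negbTE cC) andbF.
have mapE (F : seq cell) : {subset F <= E} ->
    [seq (if x \in c :: F then addc j x else x) | x <- C]
      = [seq (if x \in F then addc j x else x) | x <- C].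
  move=> FE; apply/eq_in_map => x xC; rewrite inE.
  by case: eqP xC cC => // -> ->.
case: (ltnP (size E) R) => [ltR|leR].
  have -> : (size E - R) = 0 by lia.
  have -> : ((size E).+1 - R) = 0 by lia.
  rewrite !drop0 mem_head subn_gt0 ltR mapE //=.
  by rewrite subnS.
have -> : (size E).+1 - R = (size E - R).+1 by lia.
rewrite /= size_drop; have -> : R - (size E - (size E - R)) = 0 by lia.
case: ifP => // H; first by case/negP: cE; apply: mem_drop H.
Qed.

Lemma place_job_cells j st : uniq (cells st.1) ->
  len j <= count (eligible j) (cells st.1) ->
  exists tk, [/\ uniq tk, size tk = len j,
    {subset tk <= [seq c <- cells st.1 | eligible j c]},
    perm_eq (cells (place_job j st).1)
      [seq (if c \in tk then addc j c else c) | c <- cells st.1]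
    & unit_runs (place_job j st).2 = map (runc j) tk ++ unit_runs st.2 /\
      (all (fun c => low c.2) tk \/
       {in cells st.1, forall c, eligible j c -> low c.2 -> c \in tk})].
Proof.
case: st => segs ps /= uC le_len; pose X := low_last snd (cells segs).
have XP : perm_eq X (cells segs) by apply: perm_low_last.
have uX : uniq X by rewrite (perm_uniq XP).
have := place_segs_cells j (low_last snd segs) (len j) [::] ps.
rewrite /place_job /=; case: (foldr _ _ _) => R' [out' ps'] /=.
rewrite cells_low_last -/X [X in foldr _ X]/= place_cells // => -[_ <- <-].
exists (taken j (len j) X); split.
- by rewrite drop_uniq // filter_uniq.
- by rewrite /taken size_drop subKn // size_filter (permP XP).
- by move=> c /taken_sub; rewrite !mem_filter (perm_mem XP).
- exact: perm_map.
split=> //; rewrite /taken; set E := [seq _ <- _ | _].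
pose U := [seq c <- [seq c <- cells segs | ~~ low c.2] | eligible j c].
pose V := [seq c <- [seq c <- cells segs | low c.2] | eligible j c].
have EE : E = U ++ V by rewrite /E /X /low_last filter_cat.
case: (leqP (size U) (size E - len j)) => [le_U|lt_U].
  left; rewrite EE drop_cat ltnNge -EE le_U /=; apply/allP => c /mem_drop.
  by rewrite !mem_filter => /and3P[].
right=> c cC el lo; rewrite EE drop_cat -EE lt_U mem_cat; apply/orP; right.
by rewrite !mem_filter el lo.
Qed.

Definition phi (p : state) : nat := let: (h, g, l) := p in D * (h + g) + 2 * l.

Definition room (p : state) (i : nat) : nat :=
  let: (h, g, l) := p in
  if (i < h) || (m - g <= i) then D else if i == h then l else 0.

Definition good (p : state) : bool :=
  let: (h, g, l) := p in [&& 2 * l <= D, h + g <= m & (0 < l) ==> (h + g < m)].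

Lemma good_add j p : good p -> open_for j p -> good (add_job j p).
Proof.
case: p => [[h g] l]; rewrite /good /open_for /add_job; case: ifP => nj.
  by case: ifP; lia.
by case: (posnP l) => [->|l_gt0] /=; lia.
Qed.

Lemma phi_add j p : good p -> phi (add_job j p) <= phi p + 2 * sz j.
Proof.
case: p => [[h g] l]; rewrite /good /phi /add_job; case: ifP; rewrite /narrow => nj; last first.
  by move=> _; rewrite addnS mulnS; lia.
by case: ifP; rewrite ?addSn ?mulnS; lia.
Qed.

Lemma room_add j p i : sz j <= D -> good p -> open_for j p -> i < m ->
  room p i + (if host_for j p == i then sz j else 0) <= room (add_job j p) i.
Proof.
case: p => [[h g] l]; rewrite /good /open_for /room /add_job /host_for /narrow => szD.
case: ifP => nj gp op im; last by case: (posnP l) op gp => [->|l_gt0] /=; do ![case: ifP => //]; lia.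
by case: ifP => ?; do ![case: ifP => //]; lia.
Qed.

Lemma host_lt j p : good p -> open_for j p -> host_for j p < m.
Proof.
by case: p => [[h g] l]; rewrite /good /open_for /host_for; case: ifP; lia.
Qed.

Lemma closed_phi j p : good p -> ~~ open_for j p ->
  D * m <= phi p + (if narrow j then 0 else D * low p).
Proof.
case: p => [[h g] l]; rewrite /good /open_for /phi /low /=; case: ifP => _ gp.
  rewrite -leqNgt => le; have E : h + g = m by lia.
  by rewrite E; lia.
rewrite -leqNgt => le; case: (posnP l) le => [-> | l_gt0] /=.
  by rewrite !addn0 muln0 addn0 => le; rewrite leq_mul.
move=> le; rewrite muln1; apply: leq_trans (leq_mul (leqnn D) le) _.
by rewrite mulnDr muln1; lia.
Qed.

Variables (T : nat) (i0 : J).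

Definition nlow j (C : seq cell) := count (fun c => inwin j c.1 && low c.2) C.
Definition host_load (us : seq unit_run) i t :=
  \sum_(u <- us | (u.1.2 == i) && (u.2 == t)) sz u.1.1.
Definition times_of k (us : seq unit_run) := [seq u.2 | u <- us & u.1.1 == k].

(** [inv_low] speaks of the maximal windows only: adding a job may spoil the
    bound for the smaller windows inside its own. *)
Record sched_inv (Q : seq J) (C : seq cell) (us : seq unit_run) : Prop := Inv {
  inv_uniq : uniq (map fst C);
  inv_cover : forall t, 1 <= t <= T -> t \in map fst C;
  inv_good : {in C, forall c, good c.2};
  inv_load : {in C, forall c i, i < m -> host_load us i c.1 <= room c.2 i};
  inv_phi : forall j, {in Q, forall k, sub k j || disj k j} ->
    \sum_(c <- C | inwin j c.1) phi c.2 <= 2 * load Q j;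
  inv_low : {in Q, forall k, exists2 l, l \in Q & sub k l /\
    nlow l C * width i0 <= len i0 * width l};
  inv_lowin : {in C, forall c, low c.2 -> has (fun k => inwin k c.1) Q};
  inv_times : {in Q, forall k, uniq (times_of k us) /\ size (times_of k us) = len k};
  inv_runs : {in us, forall u, [/\ u.1.1 \in Q, u.1.2 < m & inwin u.1.1 u.2]} }.

Lemma inv_perm Q C C' us : perm_eq C C' -> sched_inv Q C us -> sched_inv Q C' us.
Proof.
move=> CC' [I1 I2 I3 I4 I5 I6 I7 I8 I9].
have fCC' := perm_map fst CC'.
split=> //.
- by rewrite -(perm_uniq fCC').
- by move=> t /I2; rewrite (perm_mem fCC').
- by move=> c; rewrite -(perm_mem CC'); apply: I3.
- by move=> c; rewrite -(perm_mem CC'); apply: I4.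
- by move=> j /I5; rewrite (perm_big _ CC').
- by move=> k /I6[l lQ [kl H]]; exists l => //; split=> //; rewrite /nlow -(permP CC').
- by move=> c; rewrite -(perm_mem CC'); apply: I7.
Qed.

Definition valid_job j :=
  [&& 1 <= rel j, rel j <= due j, due j <= T, 0 < len j & sz j <= D].

Lemma count_window j (C : seq cell) : valid_job j -> uniq (map fst C) ->
  (forall t, 1 <= t <= T -> t \in map fst C) ->
  count (fun c => inwin j c.1) C = width j.
Proof.
move=> /and5P[v1 v2 v3 _ _] uC cC.
rewrite (_ : count _ C = count (inwin j) (map fst C)); last by rewrite count_map.
have P : perm_eq [seq t <- map fst C | inwin j t] (iota (rel j) (width j)).
  apply: uniq_perm; rewrite ?filter_uniq ?iota_uniq // => t.
  rewrite mem_filter mem_iota /inwin /width; apply/andP/idP; first by case=> tj _; lia.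
  by move=> H; split; [lia|apply: cC; lia].
by rewrite -size_filter (perm_size P) size_iota.
Qed.

Lemma inwin_sub l j t : sub l j -> inwin l t -> inwin j t.
Proof. by rewrite /inwin /sub; lia. Qed.

Lemma inwin_meet l j t : sub l j || disj l j -> inwin l t -> inwin j t -> sub l j.
Proof. by rewrite /inwin /sub /disj; lia. Qed.

Lemma inv_low_before Q C us j : sched_inv Q C us -> {in Q, forall k, valid_job k} ->
  valid_job j -> {in Q, forall k, sub k j || disj k j} ->
  {in Q &, forall k l, [|| sub k l, sub l k | disj k l]} ->
  nlow j C * width i0 <= len i0 * width j.
Proof.
move=> IQ vQ vj Qj lam.
pose K := [seq l <- Q | sub l j && (nlow l C * width i0 <= len i0 * width l)].
have KQ l : l \in K -> l \in Q by rewrite mem_filter => /andP[].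
pose f (c : cell) : rat := ((len i0)%:R - (width i0)%:R * (low c.2)%:R)%R.
have sumf (p : pred cell) : (\sum_(c <- C | p c) f c =
    (len i0 * count p C)%:R - (width i0 * count (fun c => p c && low c.2) C)%:R)%R.
  rewrite /f sumrB -mulr_sumr -!sum1_count !natrM !natr_sum; congr (_ - _ * _)%R.
    by rewrite mulr_sumr; apply: eq_bigr => c _; rewrite mulr1.
  by rewrite [RHS]big_mkcondr; apply: eq_bigr => c _; case: (low _).
have H : (0 <= \sum_(c <- C | has (fun l => inwin l c.1) K) f c)%R.
  apply: (@laminar_sum_ge0 _ _ _ C K (fun l c => inwin l c.1) f).
    move=> k l /KQ kQ /KQ lQ; case/or3P: (lam k l kQ lQ) => [kl|lk|dkl].
    - by constructor 1 => c; apply: inwin_sub.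
    - by constructor 2 => c; apply: inwin_sub.
    by constructor 3 => c; move: dkl; rewrite /inwin /disj; lia.
  move=> l; rewrite mem_filter => /andP[/andP[_ le] lQ].
  rewrite sumf subr_ge0 ler_nat.
  rewrite (count_window (vQ l lQ) (inv_uniq IQ) (inv_cover IQ)).
  by rewrite mulnC.
move: H; rewrite sumf subr_ge0 ler_nat => H.
rewrite mulnC; apply: leq_trans (leq_trans H _).
  rewrite leq_mul2l; apply/orP; right; rewrite /nlow -!size_filter.
  rewrite (@eq_in_filter _ (fun c => inwin j c.1 && low c.2)
     (fun c => [&& inwin j c.1, has (fun l => inwin l c.1) K & low c.2])).
    by rewrite !size_filter; apply: sub_count => c /andP[].
  move=> c cC; case lo: (low c.2); rewrite ?andbF // !andbT.
  case cj: (inwin j c.1) => //=; apply/esym.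
  have /hasP[k kQ kc] := inv_lowin IQ cC lo.
  have [l lQ [kl le]] := inv_low IQ kQ.
  have lc := inwin_sub kl kc.
  apply/hasP; exists l => //; rewrite mem_filter lQ le andbT.
  by rewrite (inwin_meet (Qj l lQ) lc cj).
rewrite leq_mul2l -(count_window vj (inv_uniq IQ) (inv_cover IQ)); apply/orP; right.
apply: sub_count => c /hasP[l]; rewrite mem_filter => /andP[/andP[lj _] _].
exact: inwin_sub.
Qed.

(* The closed slots of the window of [j] are full up to a half in the sense of
   [phi], except, if [j] is wide, for the low slots; there the missing half host
   is paid for by the size of [j], which exceeds 1/2. *)
Lemma enough_slots Q C us j : 0 < m -> 0 < D -> sched_inv Q C us -> {in Q, forall k, valid_job k} ->
  valid_job j -> {in Q, forall k, sub k j || disj k j} ->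
  {in Q &, forall k l, [|| sub k l, sub l k | disj k l]} ->
  0 < width i0 -> len j * width i0 <= len i0 * width j ->
  within (load (j :: Q) j) j j -> within (load (j :: Q) j) j i0 ->
  len j <= count (eligible j) C.
Proof.
move=> m_gt0 D_gt0 IQ vQ vj Qj lam W0 ratio wj wi0.
rewrite leqNgt; apply/negP; set E := count _ _ => ltE.
have low0 := inv_low_before IQ vQ vj Qj lam.
have phiQ := inv_phi IQ Qj.
have cW := count_window vj (inv_uniq IQ) (inv_cover IQ).
have key : D * m * (width j - E) <=
    \sum_(c <- C | inwin j c.1) phi c.2 + (if narrow j then 0 else D * nlow j C).
  have -> : width j - E = \sum_(c <- C | inwin j c.1) ~~ open_for j c.2.
    have := congr1 (fun n => n - E) (esym cW); rewrite /E => ->.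
    rewrite -!sum1_count [X in X - _](bigID (fun c => open_for j c.2)) /= addKn.
    by rewrite [LHS]big_mkcondr; apply: eq_bigr => c _; case: open_for.
  have -> : nlow j C = \sum_(c <- C | inwin j c.1) low c.2.
    by rewrite /nlow -sum1_count big_mkcondr; apply: eq_bigr => c _; case: low.
  have -> : (if narrow j then 0 else D * \sum_(c <- C | inwin j c.1) low c.2) =
      \sum_(c <- C | inwin j c.1) (if narrow j then 0 else D * low c.2).
    by case: ifP => _; [rewrite big1 | rewrite big_distrr].
  rewrite -big_split big_distrr big_seq_cond [leqRHS]big_seq_cond /=; apply: leq_sum => c /andP[cC _].
  case op: (open_for j c.2); rewrite ?muln0 // muln1.
  by apply: closed_phi; rewrite ?op //; apply: inv_good IQ _ cC.
have sub_jj : sub j j by rewrite /sub !leqnn.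
move: wj wi0; rewrite /within load_cons sub_jj /area.
have /and5P[v1 v2 _ pj szD] := vj.
have Wj : 0 < width j by rewrite /width; lia.
have EW : E <= width j.
  by rewrite -cW; apply: sub_count => c /andP[].
move: key phiQ low0 ratio ltE pj szD; rewrite /narrow.
move: (len j) (sz j) (width j) (load Q j) (width i0) (len i0) (nlow j C) Wj W0 EW
  (\sum_(_ <- _ | _) _) => p s W L W0' p0 lo Wj W0'_gt0 EW ph.
case: ifP => nj; rewrite mulnBr.
  rewrite addn0 => key ph_le _ _ ltE p_gt0 _ wj _.
  have H : 2 * (p * s + L) + D * m * p <= D * m * W.
    by rewrite -(leq_pmul2r Wj) mulnDl; lia.
  have : D * m * E < D * m * p by rewrite ltn_pmul2l // muln_gt0 D_gt0.
  by lia.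
move=> key ph_le lo_le ratio ltE p_gt0 _ _ H.
have a_ge : p * D + p <= 2 * (p * s).
  have : D.+1 <= 2 * s by lia.
  by move/(leq_mul (leqnn p)); lia.
have K1 : D * m * W * W0' <= D * m * E * W0' + 2 * L * W0' + D * (p0 * W).
  have : (D * m * W - D * m * E) * W0' <= (2 * L + D * lo) * W0'.
    by rewrite leq_mul2r (leq_trans key) ?orbT // leq_add2r.
  have := leq_mul (leqnn D) lo_le; rewrite mulnBl mulnDl; lia.
have K2 : (p * D + p) * W0' + D * m * p0 * W <= D * m * E * W0' + D * (p0 * W).
  have := leq_mul a_ge (leqnn W0'); move: H K1.
  by rewrite mulnDr mulnDl [2 * (p * s) * W0' + _]addnC; lia.
have K3 : D * m * E * W0' <= D * m * (p.-1) * W0' by rewrite !leq_mul //; lia.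
case: (m) m_gt0 K2 K3 => // m' _ K2 K3.
have K4 := leq_mul (leqnn (D * m')) ratio.
have K5 : D * m'.+1 * p.-1 * W0' + D * m'.+1 * W0' = D * m'.+1 * p * W0'.
  by rewrite -{2}(prednK p_gt0); ring.
have K6 : 0 < p * W0' by rewrite muln_gt0 p_gt0.
have K7 : D * m'.+1 * p0 * W = D * m' * (p0 * W) + D * (p0 * W) by ring.
have K8 : D * m'.+1 * p * W0' = D * m' * (p * W0') + p * D * W0' by ring.
rewrite mulnDl in K2; lia.
Qed.

Lemma uniq_map_inj (A B : eqType) (f : A -> B) (s : seq A) :
  uniq (map f s) -> {in s &, injective f}.
Proof.
elim: s => //= z s IH /andP[zs us] x y; rewrite !inE.
case/predU1P=> [->|xs] /predU1P[->|ys] // xy; last exact: IH.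
  by case/negP: zs; rewrite xy map_f.
by case/negP: zs; rewrite -xy map_f.
Qed.

Lemma inwin_disj j k t : inwin j t -> inwin k t -> ~~ disj j k.
Proof. by rewrite /inwin /disj; lia. Qed.

Lemma low_open j p : narrow j -> good p -> low p -> open_for j p.
Proof. by case: p => [[h g] l]; rewrite /open_for /good /low /= => ->; lia. Qed.

Lemma low_wide j p : ~~ narrow j -> low (add_job j p) = low p.
Proof. by case: p => [[h g] l]; rewrite /add_job /good /low /= => /negbTE ->. Qed.

Section Step.
Variables (Q : seq J) (C tk : seq cell) (us : seq unit_run) (j : J).
Hypothesis IQ : sched_inv Q C us.
Hypothesis jQ : j \notin Q.
Hypothesis vj : valid_job j.
Hypothesis Qj : {in Q, forall k, sub k j || disj k j}.
Hypothesis ratio : len j * width i0 <= len i0 * width j.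
Hypothesis low0 : nlow j C * width i0 <= len i0 * width j.
Hypothesis utk : uniq tk.
Hypothesis stk : size tk = len j.
Hypothesis tkC : {subset tk <= [seq c <- C | eligible j c]}.
Hypothesis prio : all (fun c => low c.2) tk \/
   {in C, forall c, eligible j c -> low c.2 -> c \in tk}.

Let g c := if c \in tk then addc j c else c.

Let g1 c : (g c).1 = c.1.
Proof. by rewrite /g; case: ifP. Qed.

Let inC c : c \in tk -> c \in C.
Proof. by move/tkC; rewrite mem_filter => /andP[]. Qed.

Let inj : {in C &, injective fst}.
Proof. exact/uniq_map_inj/(inv_uniq IQ). Qed.

Let el c : c \in tk -> inwin j c.1 /\ open_for j c.2.
Proof. by move/tkC; rewrite mem_filter => /andP[/andP[]]. Qed.

Let good_g : {in C, forall c, good c.2}.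
Proof. exact: inv_good IQ. Qed.

Let uC : uniq C.
Proof. exact: map_uniq (inv_uniq IQ). Qed.

Let count_tk : count (mem tk) C <= len j.
Proof.
rewrite -stk -size_filter uniq_leq_size ?filter_uniq // => c.
by rewrite mem_filter => /andP[].
Qed.

Lemma step_load c i : c \in C -> i < m ->
  host_load (map (runc j) tk ++ us) i (g c).1 <= room (g c).2 i.
Proof.
move=> cC im; rewrite g1 /host_load big_cat /= -/(host_load us i c.1).
have old := inv_load IQ cC im.
have szD : sz j <= D by case/and5P: vj.
have new : \sum_(u <- map (runc j) tk | (u.1.2 == i) && (u.2 == c.1)) sz u.1.1
    <= (if (c \in tk) && (host_for j c.2 == i) then sz j else 0).
  rewrite big_map /= big_seq_cond.
  rewrite (eq_bigl (fun x => (x == c) && ((c \in tk) && (host_for j c.2 == i)))).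
    case: ifP => H; last by rewrite big1 // => x /andP[].
    rewrite (eq_bigl (fun x => x == c)); last by move=> x; rewrite andbT.
    by rewrite -big_filter filter_pred1_uniq ?big_seq1 //; case/andP: H.
  move=> x; apply/andP/andP => [[xt /andP[h /eqP xc]]|[/eqP-> /andP[-> ->]]]; last by rewrite eqxx.
  have E : x = c by apply: inj => //; apply: inC.
  by rewrite -E eqxx xt h.
apply: leq_trans (leq_add new old) _; rewrite addnC /g.
case ctk: (c \in tk) => /=; last by rewrite addn0.
have [_ op] := el ctk.
exact: room_add szD (good_g cC) op im.
Qed.

Lemma step_phi j' : {in j :: Q, forall k, sub k j' || disj k j'} ->
  \sum_(c <- map g C | inwin j' c.1) phi c.2 <= 2 * load (j :: Q) j'.
Proof.
move=> H; rewrite big_map load_cons mulnDr.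
have HQ : {in Q, forall k, sub k j' || disj k j'}.
  by move=> k kQ; apply: H; rewrite inE kQ orbT.
rewrite addnC; have old := inv_phi IQ HQ.
rewrite (eq_bigl (fun c => inwin j' c.1)); last by move=> c; rewrite g1.
apply: (@leq_trans (\sum_(c <- C | inwin j' c.1) (phi c.2 + (c \in tk) * (2 * sz j)))).
  rewrite big_seq_cond [leqRHS]big_seq_cond; apply: leq_sum => c /andP[cC _].
  rewrite /g; case: ifP => ctk; last by rewrite mul0n addn0.
  by rewrite mul1n; apply: phi_add; apply: good_g.
rewrite big_split /= leq_add // -big_distrl /=.
case: ifPn => [jj'|njj'].
  apply: (@leq_trans (len j * (2 * sz j))); last by rewrite /area; lia.
  rewrite leq_mul2r; apply/orP; right; apply: leq_trans count_tk.
  rewrite -sum1_count big_mkcond [leqRHS]big_mkcond; apply: leq_sum => c _ /=.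
  by case: ifP; case: (c \in tk).
rewrite big1 // => c cj'; case ctk: (c \in tk) => //.
have [cj _] := el ctk; have := H j (mem_head _ _).
by rewrite (negbTE njj') (negbTE (inwin_disj cj cj')).
Qed.

Lemma step_nlow : nlow j (map g C) * width i0 <= len i0 * width j.
Proof.
have le_old : {in C, forall c, inwin j c.1 -> low (g c).2 -> low c.2} ->
    nlow j (map g C) <= nlow j C.
  move=> H; rewrite /nlow count_map -!sum1_count big_mkcond [leqRHS]big_mkcond /=.
  rewrite big_seq_cond [leqRHS]big_seq_cond; apply: leq_sum => c /andP[cC _].
  by rewrite g1; case: ifP => // /andP[cj lo]; rewrite cj H.
case nj: (narrow j); last first.
  apply: leq_trans low0; rewrite leq_mul2r le_old ?orbT // => c _ _.
  by rewrite /g; case: ifP => // _; rewrite low_wide ?nj.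
case: prio => [all_low|all_taken].
  apply: leq_trans low0; rewrite leq_mul2r le_old ?orbT // => c _ _.
  by rewrite /g; case: ifP => // ctk _; apply: (allP all_low).
apply: leq_trans ratio; rewrite leq_mul2r; apply/orP; right.
apply: leq_trans count_tk; rewrite /nlow count_map.
rewrite -!sum1_count big_mkcond [leqRHS]big_mkcond big_seq_cond [leqRHS]big_seq_cond.
apply: leq_sum => c /andP[cC _] /=; case: ifP => // /andP[].
rewrite g1 => cj; rewrite /g; case: ifP => // ctk lo.
by case/negP: (negbT ctk); apply: all_taken => //; rewrite /eligible cj low_open // good_g.
Qed.

Lemma step_times k : k \in j :: Q ->
  uniq (times_of k (map (runc j) tk ++ us)) /\
  size (times_of k (map (runc j) tk ++ us)) = len k.
Proof.
rewrite /times_of filter_cat map_cat inE => /predU1P[->|kQ].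
  rewrite (@eq_in_filter _ _ predT) => [|u /mapP[c _ ->]]; last by rewrite /= eqxx.
  rewrite filter_predT -map_comp.
  rewrite (@eq_in_filter _ _ pred0) => [|u /(inv_runs IQ)[uQ _ _]]; last first.
    by apply: contraNF jQ => /eqP <-.
  rewrite filter_pred0 cats0 size_map stk; split=> //.
  by rewrite map_inj_in_uniq // => x y /inC xC /inC yC; apply: inj.
rewrite (@eq_in_filter _ _ pred0) => [|u /mapP[c _ ->]] /=; last first.
  by apply: contraNF jQ => /eqP ->.
by rewrite filter_pred0; apply: inv_times IQ _ kQ.
Qed.

Lemma sched_inv_step : sched_inv (j :: Q) (map g C) (map (runc j) tk ++ us).
Proof.
have fstE : map fst (map g C) = map fst C by rewrite -map_comp; apply: eq_map => c; apply: g1.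
split.
- by rewrite fstE; apply: inv_uniq IQ.
- by rewrite fstE; apply: inv_cover IQ.
- move=> _ /mapP[c cC ->]; rewrite /g; case: ifP => [/el[_ op]|_]; last exact: good_g.
  by apply: good_add => //; apply: good_g.
- by move=> _ /mapP[c cC ->] i im; apply: step_load.
- exact: step_phi.
- have sub_jj : sub j j by rewrite /sub !leqnn.
  have easy k : sub k j -> exists2 l, l \in j :: Q & sub k l /\
      nlow l (map g C) * width i0 <= len i0 * width l.
    by move=> kj; exists j; [exact: mem_head | split=> //; apply: step_nlow].
  move=> k; rewrite inE => /predU1P[->|kQ]; first exact: easy.
  have /orP[/easy //|dkj] := Qj kQ.
  have [l lQ [kl le]] := inv_low IQ kQ.
  have /orP[lj|dlj] := Qj lQ; first exact/easy/(sub_trans kl lj).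
  exists l; first by rewrite inE lQ orbT.
  split=> //; rewrite /nlow count_map (@eq_in_count _ _ (fun c => inwin l c.1 && low c.2)) //.
  move=> c _ /=; rewrite g1; case cl: (inwin l c.1) => //=.
  rewrite /g; case: ifP => // /el[cj _].
  by move: dlj; rewrite (negbTE (inwin_disj cl cj)).
- move=> _ /mapP[c cC ->]; rewrite g1 /= /g; case: ifP => [/el[-> //]|_ lo].
  by rewrite (inv_lowin IQ cC lo) orbT.
- exact: step_times.
move=> u; rewrite mem_cat => /orP[/mapP[c ctk ->]|/(inv_runs IQ)[uQ -> ->]]; last first.
  by rewrite inE uQ orbT.
have [cj op] := el ctk; rewrite /= mem_head cj host_lt //.
by apply: good_g; apply: inC.
Qed.

End Step.

Lemma within_le x y k i : x <= y -> within y k i -> within x k i.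
Proof.
move=> xy; rewrite /within; apply: leq_trans; rewrite leq_add2r leq_mul2r.
by rewrite leq_mul2l xy !orbT.
Qed.

Lemma schedule_inv (S : seq J) : 0 < m -> 0 < D -> uniq S -> {in S, forall j, valid_job j} ->
  pairwise (fun j k => sub k j || disj k j) S ->
  {in S &, forall k l, [|| sub k l, sub l k | disj k l]} ->
  0 < width i0 -> {in S, forall j, len j * width i0 <= len i0 * width j} ->
  {in S, forall j, within (load S j) j j /\ within (load S j) j i0} ->
  sched_inv S (cells (schedule_jobs T S).1) (unit_runs (schedule_jobs T S).2).
Proof.
move=> m_gt0 D_gt0 uS vS pS lam W0; elim: S uS vS pS lam => [|j Q IH] /=.
  move=> _ _ _ _ _ _; rewrite /cells /= cats0 /cells1 /= subSS subn0.
  have E : map fst [seq (t, (0, 0, 0)) | t <- iota 1 T] = iota 1 T.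
    by rewrite -map_comp map_id.
  split=> //.
  - by rewrite E iota_uniq.
  - by move=> t; rewrite E mem_iota; lia.
  - by move=> _ /mapP[t _ ->].
  - by move=> _ /mapP[t _ ->] i im; rewrite /host_load big_nil.
  - move=> j _; rewrite big_map big1 // => t _; rewrite /= /phi; lia.
  by move=> _ /mapP[t _ ->].
move=> /andP[jQ uQ] vS /andP[/allP Qj pQ] lam ratio wi.
have QS k : k \in Q -> k \in j :: Q by rewrite inE orbC => ->.
have vQ : {in Q, forall k, valid_job k} by move=> k /QS; apply: vS.
have lamQ : {in Q &, forall k l, [|| sub k l, sub l k | disj k l]}.
  by move=> k l /QS kS /QS lS; apply: lam.
have wQ : {in Q, forall k, within (load Q k) k k /\ within (load Q k) k i0}.
  by move=> k /QS/wi[w1 w2]; split; [apply: within_le w1|apply: within_le w2];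
     rewrite load_cons leq_addl.
have ratioQ : {in Q, forall k, len k * width i0 <= len i0 * width k}.
  by move=> k /QS; apply: ratio.
have IQ := IH uQ vQ pQ lamQ ratioQ wQ.
set st := schedule_jobs T Q in IQ.
have jS : j \in j :: Q by rewrite mem_head.
have uC : uniq (cells st.1) by exact: map_uniq (inv_uniq IQ).
have [w1 w2] := wi j jS.
have enough := enough_slots m_gt0 D_gt0 IQ vQ (vS j jS) Qj lamQ W0 (ratio j jS) w1 w2.
have [tk [utk stk tkC CP [usE prio]]] := place_job_cells uC enough.
rewrite -/st usE; apply: inv_perm.
  by rewrite perm_sym; exact: CP.
apply: sched_inv_step => //; [exact: vS|exact: ratio|].
exact: inv_low_before IQ vQ (vS j jS) Qj lamQ.
Qed.

Definition covers t (x : segment) := x.1.1 <= t < x.1.2.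

Lemma count_covers t X : uniq (map fst (cells X)) -> count (covers t) X <= 1.
Proof.
move=> uX; apply: (@leq_trans (count_mem t (map fst (cells X)))); last first.
  by rewrite count_uniq_mem //; apply: leq_b1.
elim: X {uX} => //= x X IH; rewrite cells_cons map_cat count_cat leq_add //.
rewrite /cells1 -map_comp map_id count_uniq_mem ?iota_uniq // mem_iota /covers.
by case: x => [[a b] p] /=; lia.
Qed.

Lemma place_seg_size j x R out ps :
  let: (R', (out', ps')) := place_seg j x (R, (out, ps)) in
  size out' + (0 < R') <= size out + (0 < R) + covers (rel j) x + covers (due j).+1 x + 1
  /\ size ps' <= (size ps).+1.
Proof.
case: x => [[a b] p] /=; set b' := minn b _; set k := minn R _; rewrite /covers /=.
case: ifP => [/andP[_ k_gt0]|_] /=; last first.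
  by split; rewrite // [leqRHS]addn1 ltnS -!addnA leq_add2l leq_addr.
split=> //; rewrite /consif.
have -> : size (if a < b' - k then (a, b' - k, p) :: (b' - k, b', add_job j p)
      :: (if b' < b then (b', b, p) :: out else out) else (b' - k, b', add_job j p)
      :: (if b' < b then (b', b, p) :: out else out))
    = (a < b' - k) + (b' < b) + size out + 1.
  by case: (a < _); case: (b' < b) => /=; rewrite addn1.
have R0 : 0 < R by move: k_gt0; rewrite /k; lia.
have H1 : (b' < b) <= (a <= (due j).+1 < b).
  by case: ltnP => // lt; rewrite lt0b; move: lt k_gt0; rewrite /k /b'; lia.
have H2 : (a < b' - k) + (0 < R - k) <= 1 + (a <= rel j < b).
  case: (posnP (R - k)) => [_|H]; first by case: (a < _); lia.
  rewrite addnC leq_add2l; case: ltnP => // lt; rewrite lt0b.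
  by move: lt H k_gt0; rewrite /k /b'; lia.
by move: H1 H2; rewrite R0; lia.
Qed.

Lemma place_segs_size j X R ps :
  let: (R', (out', ps')) := foldr (place_seg j) (R, ([::], ps)) X in
  size out' + (0 < R') <= size X + (0 < R) + count (covers (rel j)) X + count (covers (due j).+1) X
  /\ size ps' <= size X + size ps.
Proof.
elim: X => [|x X] /=; first by split; lia.
case: (foldr _ _ X) => R' [out' ps'] [IH1 IH2].
have := place_seg_size j x R' out' ps'; case: (place_seg j x _) => R2 [out2 ps2] [H1 H2].
by split; lia.
Qed.

Lemma size_low_last (s : seq segment) : size (low_last snd s) = size s.
Proof. by rewrite size_cat !size_filter addnC count_predC. Qed.

Lemma place_job_size j st : uniq (map fst (cells st.1)) ->
  size (place_job j st).1 <= size st.1 + 3 /\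
  size (place_job j st).2 <= size st.1 + size st.2.
Proof.
case: st => segs ps /= uC.
have := place_segs_size j (low_last snd segs) (len j) ps.
rewrite /place_job /=; case: (foldr _ _ _) => R' [out' ps'] /= [H1 H2].
have P : uniq (map fst (cells (low_last snd segs))).
  by rewrite cells_low_last (perm_uniq (perm_map fst (perm_low_last _))).
have := count_covers (rel j) P; have := count_covers (due j).+1 P.
by rewrite size_low_last in H1 H2; split; lia.
Qed.

Definition seg_ok (x : segment) := [&& x.1.1 <= T.+1, x.1.2 <= T.+1 & good x.2].
Definition run_ok (q : run) :=
  let: (j, i, a, b) := q in [&& i < m, a <= T.+1 & b <= T.+1].

Lemma place_seg_ok j x R out ps : seg_ok x -> all seg_ok out -> all run_ok ps ->
  let: (R', (out', ps')) := place_seg j x (R, (out, ps)) in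
  [/\ R' <= R, all seg_ok out' & all run_ok ps'].
Proof.
case: x => [[a b] p] /=; rewrite /seg_ok /= => /and3P[a_le b_le gp] out_ok ps_ok.
set b' := minn b _; set k := minn R _.
case: ifP => [/andP[op k_gt0]|_] /=; last by rewrite a_le b_le gp.
have b'_le : b' <= T.+1 by rewrite /b'; lia.
split; first by rewrite leq_subr.
  have H c x s : all seg_ok s -> seg_ok x -> all seg_ok (consif c x s).
    by move=> sP xP; case: c => //=; rewrite xP.
  apply: (H); last by rewrite /seg_ok /= a_le gp andbT; lia.
  rewrite /= H //; first by rewrite /seg_ok /= b'_le good_add //; lia.
  by rewrite /seg_ok /= b_le b'_le gp.
by rewrite ps_ok host_lt //= andbT; move: b'_le; lia.
Qed.

Lemma place_segs_ok j X R ps : all seg_ok X -> all run_ok ps ->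
  let: (R', (out', ps')) := foldr (place_seg j) (R, ([::], ps)) X in
  [/\ R' <= R, all seg_ok out' & all run_ok ps'].
Proof.
move=> + ps_ok; elim: X => //= x X IH /andP[x_ok /IH].
case: (foldr _ _ X) => R' [out' ps'] [R_le out_ok ps'_ok].
have := place_seg_ok j R' x_ok out_ok ps'_ok.
case: (place_seg j x _) => R2 [out2 ps2] [R2_le -> ->]; split=> //.
exact: leq_trans R2_le R_le.
Qed.

Lemma schedule_bounds (S : seq J) :
  let: (segs, ps) := schedule_jobs T S in
  [/\ uniq (map fst (cells segs)), size segs <= 1 + 3 * size S,
    size ps <= size S * (1 + 3 * size S), all seg_ok segs & all run_ok ps].
Proof.
elim: S => [|j S] /=.
  split=> //; last by rewrite /seg_ok /= !ltnS leqnn.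
  by rewrite /cells /= cats0 /cells1 -map_comp map_id iota_uniq.
case E: (schedule_jobs T S) => [segs ps].
move=> [uC le_segs le_ps segs_ok ps_ok].
have [/= H1 H2] := place_job_size j (st := (segs, ps)) uC.
have X_ok : all seg_ok (low_last snd segs).
  by rewrite /low_last all_cat; apply/andP; split; apply/allP => x;
    rewrite mem_filter => /andP[_ /(allP segs_ok)].
have CP := place_segs_cells j (low_last snd segs) (len j) [::] ps.
have := place_segs_ok j (len j) X_ok ps_ok.
move: H1 H2; rewrite /place_job /=.
case: (foldr _ _ _) CP => R' [out' ps'] /= CP H1 H2 [_ -> ->]; split=> //; first last.
- by rewrite mulSn !mulnS in le_ps *; nia.
- by lia.
have XP : perm_eq (low_last snd (cells segs)) (cells segs) by apply: perm_low_last.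
move: CP; rewrite cells_low_last [X in foldr _ X]/= place_cells; last first.
  by rewrite (perm_uniq XP) (map_uniq uC).
move=> [_ <- _]; rewrite -map_comp (eq_map (g := fst)) ?(perm_uniq (perm_map _ XP)) // => c /=.
by case: ifP.
Qed.

End Jobs.

(** * The program *)

(** Expressions with natural values; [esub] truncates, and booleans are the
    numbers 0 and 1. *)
Definition evn (st : store) (x : expr) (n : nat) : Prop := eval st x = enc_nat n.
Definition esub x y := Mul (Leq y x) (Defs.Sub x y).
Definition enot x := Defs.Sub (Lit 1) x.
Definition eif c x y := Add (Mul c x) (Mul (enot c) y).
Definition emin x y := eif (Leq x y) x y.
Definition emax x y := eif (Leq x y) y x.
Definition elt x y := Leq (Add x (Lit 1)) y.

Section Evn.
Variable st : store.
Implicit Types (x y : expr) (m n : nat) (b c : bool).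

Lemma ev_lit n : evn st (Lit n%:Z) n. Proof. by []. Qed.

Lemma ev_add x y m n : evn st x m -> evn st y n -> evn st (Add x y) (m + n).
Proof. by rewrite /evn /= => -> ->. Qed.

Lemma ev_mul x y m n : evn st x m -> evn st y n -> evn st (Mul x y) (m * n).
Proof. by rewrite /evn /= => -> -> /=; rewrite -PoszM. Qed.

Lemma ev_leq x y m n : evn st x m -> evn st y n -> evn st (Leq x y) (m <= n).
Proof. by rewrite /evn /= => -> -> /=. Qed.

Lemma ev_lt x y m n : evn st x m -> evn st y n -> evn st (elt x y) (m < n).
Proof. by rewrite -addn1 => xm yn; apply: ev_leq => //; apply: ev_add. Qed.

Lemma ev_sub x y m n : evn st x m -> evn st y n -> evn st (esub x y) (m - n).
Proof.
rewrite /evn /= => -> -> /=; congr Atom; rewrite lez_nat.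
by case: leqP => [le_nm|/ltnW lt_mn]; rewrite ?mul1r ?mul0r ?subzn //; congr Posz; lia.
Qed.

Lemma ev_not x b : evn st x b -> evn st (enot x) (~~ b).
Proof. by rewrite /evn /= => ->; case: b. Qed.

Lemma ev_and x y b c : evn st x b -> evn st y c -> evn st (Mul x y) (b && c).
Proof. by move=> xb yc; rewrite -mulnb; apply: ev_mul. Qed.

Lemma ev_if z x y b m n : evn st z b -> evn st x m -> evn st y n ->
  evn st (eif z x y) (if b then m else n).
Proof.
move=> zb xm yn; rewrite (_ : (if b then m else n) = b * m + (~~ b) * n); last first.
  by case: (b); rewrite ?mul1n ?mul0n ?addn0.
by apply: ev_add; apply: ev_mul => //; apply: ev_not.
Qed.

Lemma ev_min x y m n : evn st x m -> evn st y n -> evn st (emin x y) (minn m n).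
Proof.
move=> xm yn; rewrite (_ : minn m n = if m <= n then m else n); last by case: leqP; lia.
by apply: ev_if => //; apply: ev_leq.
Qed.

Lemma ev_max x y m n : evn st x m -> evn st y n -> evn st (emax x y) (maxn m n).
Proof.
move=> xm yn; rewrite (_ : maxn m n = if m <= n then n else m); last by case: leqP; lia.
by apply: ev_if => //; apply: ev_leq.
Qed.

End Evn.

Lemma PT_consif A (P : A -> Prop) e (t : A -> bool) (x : A -> data) (s : A -> seq data) :
  PT P e (fun a => dbool (t a)) -> PT P e x -> PT P e (fun a => enc_seq (s a)) ->
  PT P e (fun a => enc_seq (consif (t a) (x a) (s a))).
Proof.
move=> tP xP sP.
apply: (@PT_eq _ _ _ (fun a => if t a then Node (x a) (enc_seq (s a)) else enc_seq (s a))).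
  by move=> a _; rewrite /consif; case: ifP.
apply: PT_if => //; last by apply: PT_sub sP => a [].
apply: PT_pair; first by apply: PT_sub xP => a [].
by apply: PT_sub sP => a [].
Qed.

Section SortProgram.
Variables (A : Type) (P : A -> Prop) (e : A -> data).
Variables (T : A -> eqType) (encT : forall a, T a -> data) (l : forall a, seq (T a)).
Variable le : forall a, rel (T a).

Lemma dsize_perm a (s s' : seq (T a)) : perm_eq s s' ->
  dsize (enc_seq (map (@encT a) s)) = dsize (enc_seq (map (@encT a) s')).
Proof.
have E (u : seq (T a)) : dsize (enc_seq (map (@encT a) u)) = 1 + \sum_(x <- u) (dsize (encT x) + 1).
  elim: u => [|x u IH]; rewrite ?big_nil ?big_cons //= IH; lia.
by move=> ss'; rewrite !E (perm_big _ ss').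
Qed.

Lemma PT_isort :
  PT P e (fun a => enc_seq (map (@encT a) (l a))) ->
  PT (fun u : {a : A & (T a * T a)%type} => P (tag u))
    (fun u => Node (e (tag u)) (Node (encT (tagged u).1) (encT (tagged u).2)))
    (fun u => dbool (le (tagged u).1 (tagged u).2)) ->
  PT P e (fun a => enc_seq (map (@encT a) (isort (@le a) (l a)))).
Proof.
move=> lP leP; pose enc a s := enc_seq (map (@encT a) s).
apply: (@PT_foldr _ _ _ T (fun a => seq (T a)) encT enc l (fun=> [::]) (fun a => insert (@le a))) => //.
- exact: (PT_expr (x := Lit 0)).
- pose B := {a : A & (T a * seq (T a))%type}.
  pose eB (u : B) := Node (e (tag u)) (Node (encT (tagged u).1) (enc _ (tagged u).2)).
  pose PB (u : B) := P (tag u).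
  pose lB (u : B) : seq (T (tag u)) := (tagged u).2.
  pose encB (u : B) : T (tag u) -> data := @encT (tag u).
  have lBP : PT PB eB (fun u => enc_seq (map (@encB u) (lB u))).
    exact: (PT_expr (x := Snd (Snd (Var 0)))).
  have leB : PT (member PB lB) (enc_member eB encB)
      (fun v => dbool (le (tagged (tag v)).1 (tagged v))).
    pose h (v : {u : B & T (tag u)}) : {a : A & (T a * T a)%type} :=
      existT (fun a => (T a * T a)%type) (tag (tag v)) ((tagged (tag v)).1, tagged v).
    pose x := Pair (Fst (Fst (Var 0))) (Pair (Fst (Snd (Fst (Var 0)))) (Snd (Var 0))).
    apply: (PT_comp (PT_expr (x := x) (f := _ \o h) _) (PT_reindex _ leP)) => //.
    by move=> v [].
  have lenB : PT (member PB lB) (enc_member eB encB)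
      (fun v => dbool (~~ le (tagged (tag v)).1 (tagged v))).
    apply: PT_comp leB _; apply: (PT_expr (x := enot (Var 0))) => v _.
    exact: (@ev_not _ _ (le _ _)).
  have Pl := PT_filter (t := fun (u : B) y => le (tagged u).1 y) lBP leB.
  have Pg := PT_filter (t := fun (u : B) y => ~~ le (tagged u).1 y) lBP lenB.
  apply: (@PT_sub _ PB); first by case=> a [x s] [].
  apply: (@PT_eq _ _ _ (fun u : B => enc_seq (map (@encB u)
     ([seq y <- lB u | ~~ le (tagged u).1 y] ++
      (tagged u).1 :: [seq y <- lB u | le (tagged u).1 y])))); first by case=> a [].
  have -> : (fun u : B => let: existT a (x, s) := u in Node (e a) (Node (encT x) (enc a s))) = eB.
    by apply/funext => -[a [x s]].
  apply: PT_cat => //=.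
  by apply: PT_pair => //; apply: (PT_expr (x := Fst (Snd (Var 0)))).
have [C [k lle]] := PT_size lP; exists C, k => a l1 l2 Pa la.
apply: leq_trans (lle a Pa) => /=; rewrite la map_cat.
rewrite dsize_enc_seq_cat.
rewrite /enc (dsize_perm (perm_isort (@le a) l2)).
by have := dsize_gt0 (enc_seq (map (@encT a) l1)); lia.
Qed.

End SortProgram.

Section InstanceData.
Variable I : instance.
Implicit Types j k : job I.

Definition req_num j : nat := `|numq (req j)|.
Definition req_den j : nat := `|denq (req j)|.
Definition weight_num j : nat := `|numq (weight j)|.
Definition weight_den j : nat := `|denq (weight j)|.

(** Requirements and loads are integers in the unit [1 / capacity]. *)
Definition capacity : nat := \prod_(k <- enum (job I)) req_den k.
Definition scaled_req j : nat :=
  req_num j * \prod_(k <- enum (job I)) (if k == j then 1 else req_den k).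

Definition job_area j := area (@len I) scaled_req j.

(** Compares the profits per unit of area, cross-multiplied. *)
Definition less_dense j k :=
  weight_num j * weight_den k * job_area k <= weight_num k * weight_den j * job_area j.
Definition wider j k := width (@release I) (@due I) k <= width (@release I) (@due I) j.

Definition enc_record j : data :=
  Node (enc_nat j) (Node (enc_nat (release j)) (Node (enc_nat (due j))
    (Node (enc_nat (len j)) (Node (enc_nat (scaled_req j))
      (Node (enc_nat (weight_num j)) (enc_nat (weight_den j))))))).

Definition enc_scaled : data :=
  Node (enc_nat (hosts I)) (Node (enc_nat (horizon I)) (Node (enc_nat capacity)
    (enc_seq (map enc_record (enum (job I)))))).

Definition greedy : seq (job I) :=
  select (@release I) (@due I) (@len I) scaled_req (hosts I) capacity
    (enum (job I)) (isort less_dense (enum (job I))).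

End InstanceData.

Definition get_index x := Fst x.
Definition get_release x := Fst (Snd x).
Definition get_due x := Fst (Snd (Snd x)).
Definition get_len x := Fst (Snd (Snd (Snd x))).
Definition get_req x := Fst (Snd (Snd (Snd (Snd x)))).
Definition get_wnum x := Fst (Snd (Snd (Snd (Snd (Snd x))))).
Definition get_wden x := Snd (Snd (Snd (Snd (Snd (Snd x))))).
Definition get_hosts x := Fst x.
Definition get_horizon x := Fst (Snd x).
Definition get_cap x := Fst (Snd (Snd x)).
Definition get_jobs x := Snd (Snd (Snd x)).
Definition get_width x := esub (Add (get_due x) (Lit 1)) (get_release x).
Definition get_area x := Mul (get_len x) (get_req x).
Definition esubwin x y :=
  Mul (Leq (get_release y) (get_release x)) (Leq (get_due x) (get_due y)).

Section Records.
Variables (st : store) (I : instance) (x y : expr) (j k : job I).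
Hypothesis xj : eval st x = enc_record j.
Hypothesis yk : eval st y = enc_record k.

Lemma ev_width : evn st (get_width x) (width (@release I) (@due I) j).
Proof.
by rewrite /width -addn1; apply: ev_sub; first apply: ev_add; rewrite /evn //= xj.
Qed.

Lemma ev_area : evn st (get_area x) (job_area j).
Proof. by apply: ev_mul; rewrite /evn /= xj. Qed.

Lemma ev_subwin : evn st (esubwin x y) (sub (@release I) (@due I) j k).
Proof. by apply: ev_and; apply: ev_leq; rewrite /evn /= ?xj ?yk. Qed.

End Records.

Section SelectProgram.
Variable P : instance -> Prop.

Local Notation inst_load I := (load (@release I) (@due I) (@len I) (@scaled_req I)).
Local Notation inst_within I := (within (@release I) (@due I) (@len I) (hosts I) (capacity I)).
Local Notation inst_fits I :=
  (fits (@release I) (@due I) (@len I) (@scaled_req I) (hosts I) (capacity I)).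

Lemma PT_jobs : PT P enc_scaled (fun I => enc_seq (map (@enc_record I) (enum (job I)))).
Proof. exact: (PT_expr (x := get_jobs (Var 0))). Qed.

Lemma PT_sorted_jobs : PT P enc_scaled
  (fun I => enc_seq (map (@enc_record I) (isort (@less_dense I) (enum (job I))))).
Proof.
apply: (@PT_isort _ _ _ (fun I => job I : eqType) enc_record (fun I => enum (job I))).
  exact: PT_jobs.
pose j := Fst (Snd (Var 0)); pose k := Snd (Snd (Var 0)).
pose x := Leq (Mul (Mul (get_wnum j) (get_wden k)) (get_area k))
  (Mul (Mul (get_wnum k) (get_wden j)) (get_area j)).
apply: (PT_expr (x := x)) => -[I [j' k']] _.
by apply: ev_leq; (apply: ev_mul; [exact: ev_mul | exact: ev_area]).
Qed.

Definition with_jobs (I : instance) := (job I * seq (job I))%type.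
Definition enc_with_jobs (u : {I : instance & with_jobs I}) : data :=
  Node (enc_scaled (tag u)) (Node (enc_record (tagged u).1)
    (enc_seq (map (@enc_record (tag u)) (tagged u).2))).

Lemma PT_fits : PT (fun u : {I : instance & with_jobs I} => P (tag u)) enc_with_jobs
  (fun u => dbool (inst_fits (tag u) (enum (job (tag u))) (tagged u).2 (tagged u).1)).
Proof.
set PB := (fun u => P (tag u)).
pose B := {I : instance & with_jobs I}.
pose jobs (u : B) := enum (job (tag u)).
have jobsP : PT PB enc_with_jobs (fun u => enc_seq (map (@enc_record (tag u)) (jobs u))).
  exact: (PT_expr (x := get_jobs (Fst (Var 0)))).
apply: (@PT_all _ _ _ (fun u => job (tag u)) _ _ jobsP (fun u k =>
  sub (@release (tag u)) (@due (tag u)) (tagged u).1 k ==>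
   all (inst_within (tag u) (inst_load (tag u) (tagged u).2 k + area (@len _) (@scaled_req _) (tagged u).1) k)
     (enum (job (tag u))))).
pose eB := enc_member enc_with_jobs (fun (u : B) => @enc_record (tag u)).
set PB1 := member _ _.
pose S (v : {u : B & job (tag u)}) := (tagged (tag v)).2.
have SP : PT PB1 eB (fun v => enc_seq (map (@enc_record (tag (tag v))) (S v))).
  exact: (PT_expr (x := Snd (Snd (Fst (Var 0))))).
have loadP : PT PB1 eB (fun v => enc_nat (inst_load (tag (tag v)) (S v) (tagged v))).
  apply: (@PT_eq _ _ _ (fun v => enc_nat (\sum_(i <- S v)
      (sub (@release _) (@due _) i (tagged v) * job_area i)))).
    move=> v _; congr enc_nat; rewrite /load [RHS]big_mkcond; apply: eq_bigr => i _.
    by case: ifP => _; rewrite ?mul1n ?mul0n.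
  apply: (@PT_sum _ _ _ (fun v => job (tag (tag v))) _ _ SP (fun v i =>
      sub (@release _) (@due _) i (tagged v) * job_area i)).
  pose i := Snd (Var 0); pose k := Snd (Fst (Var 0)).
  apply: (PT_expr (x := Mul (esubwin i k) (get_area i))) => v _.
  apply: ev_mul; last exact: ev_area.
  exact: ev_subwin.
pose e2 v := Node (eB v) (enc_nat (inst_load (tag (tag v)) (S v) (tagged v))).
have e2P : PT PB1 eB e2 by apply: PT_pair loadP; apply: PT_id.
have allP : PT PB1 eB (fun v => dbool (all (inst_within (tag (tag v))
    (inst_load (tag (tag v)) (S v) (tagged v) + job_area (tagged (tag v)).1) (tagged v))
     (enum (job (tag (tag v)))))).
  apply: PT_comp e2P _.
  have jobs2 : PT PB1 e2 (fun v => enc_seq (map (@enc_record (tag (tag v))) (jobs (tag v)))).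
    exact: (PT_expr (x := get_jobs (Fst (Fst (Fst (Var 0)))))).
  apply: (@PT_all _ _ _ (fun v => job (tag (tag v))) _ _ jobs2 (fun v i => inst_within (tag (tag v))
    (inst_load (tag (tag v)) (S v) (tagged v) + job_area (tagged (tag v)).1) (tagged v) i)).
  pose i := Snd (Var 0); pose k := Snd (Fst (Fst (Var 0))).
  pose j := Fst (Snd (Fst (Fst (Fst (Var 0))))); pose c := Fst (Fst (Fst (Fst (Var 0)))).
  pose l := Snd (Fst (Var 0)).
  pose Dm := Mul (get_cap c) (get_hosts c).
  apply: (PT_expr (x := Leq (Add (Mul (Mul (Lit 2) (Add l (get_area j))) (get_width i))
      (Mul (Mul Dm (get_len i)) (get_width k))) (Mul (Mul Dm (get_width i)) (get_width k)))) => v _.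
  apply: ev_leq.
    apply: ev_add; apply: ev_mul; [|exact: ev_width| |exact: ev_width].
      by apply: ev_mul; [exact: ev_lit | apply: ev_add; [exact: erefl | exact: ev_area]].
    by apply: ev_mul; first exact: ev_mul.
  by apply: ev_mul; [apply: ev_mul; [exact: ev_mul | exact: ev_width] | exact: ev_width].
have := PT_pair (PT_id PB1 eB) allP; move/PT_comp; apply.
pose j := Fst (Snd (Fst (Fst (Var 0)))); pose k := Snd (Fst (Var 0)).
apply: (PT_expr (x := enot (Mul (esubwin j k) (enot (Snd (Var 0)))))) => v _.
rewrite -[_ ==> _]negbK negb_imply.
by apply: ev_not; apply: ev_and; [exact: ev_subwin | exact: ev_not].
Qed.

Lemma PT_greedy : PT P enc_scaled (fun I => enc_seq (map (@enc_record I) (greedy I))).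
Proof.
apply: (@PT_foldr _ _ _ (fun I => job I) (fun I => seq (job I)) enc_record
  (fun I s => enc_seq (map (@enc_record I) s)) _ (fun=> [::])
  (fun I j S => if inst_fits I (enum (job I)) S j then j :: S else S) PT_sorted_jobs).
- exact: (PT_expr (x := Lit 0)).
- set R := reached _ _ _ _.
  have -> : (fun u : {I : instance & with_jobs I} => let: existT a (x, s) := u in
     Node (enc_scaled a) (Node (enc_record x) (enc_seq (map (@enc_record a) s)))) = enc_with_jobs.
    by apply/funext => -[I [j s]].
  apply: (@PT_eq _ _ _ (fun u : {I : instance & with_jobs I} =>
     if inst_fits (tag u) (enum (job (tag u))) (tagged u).2 (tagged u).1
     then enc_seq (map (@enc_record (tag u)) ((tagged u).1 :: (tagged u).2))
     else enc_seq (map (@enc_record (tag u)) (tagged u).2))).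
    by case=> I [j s] _ /=; case: ifP.
  apply: PT_if.
  + by apply: PT_sub PT_fits => -[I [j s]] [].
  + exact: (PT_expr (x := Snd (Var 0))).
  + exact: (PT_expr (x := Snd (Snd (Var 0)))).
have [C [k le]] := PT_size PT_sorted_jobs; exists C, k => I l1 l2 PI lE.
apply: leq_trans (le I PI) => /=; rewrite lE map_cat dsize_enc_seq_cat.
apply: (@leq_trans (dsize (enc_seq (map (@enc_record I) l2)))).
  by elim: l2 {lE} => //= x s IH; case: ifP => _ //=; lia.
by have := dsize_gt0 (enc_seq (map (@enc_record I) l1)); lia.
Qed.

Lemma PT_greedy_by_width : PT P enc_scaled
  (fun I => enc_seq (map (@enc_record I) (isort (@wider I) (greedy I)))).
Proof.
apply: (@PT_isort _ _ _ (fun I => job I : eqType) enc_record (fun I => greedy I)).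
  exact: PT_greedy.
pose j := Fst (Snd (Var 0)); pose k := Snd (Snd (Var 0)).
apply: (PT_expr (x := Leq (get_width k) (get_width j))) => -[I [j' k']] _.
by apply: ev_leq; apply: ev_width.
Qed.

End SelectProgram.

Lemma ev_ifb st z x y (b c d : bool) : evn st z b -> evn st x c -> evn st y d ->
  evn st (eif z x y) (if b then c else d : bool).
Proof.
move=> zb xc yd; rewrite (_ : nat_of_bool _ = if b then nat_of_bool c else nat_of_bool d).
  exact: ev_if.
by case: (b).
Qed.

Lemma eval_pair st x y : eval st (Pair x y) = Node (eval st x) (eval st y).
Proof. by []. Qed.

Lemma ev_S st x n : evn st x n -> evn st (Add x (Lit 1)) n.+1.
Proof. by rewrite -addn1 => xn; apply: ev_add. Qed.

Definition enc_state (p : state) : data :=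
  Node (enc_nat p.1.1) (Node (enc_nat p.1.2) (enc_nat p.2)).
Definition enc_segment (x : segment) : data :=
  Node (enc_nat x.1.1) (Node (enc_nat x.1.2) (enc_state x.2)).
Definition enc_run I (q : run (job I)) : data :=
  let: (j, i, a, b) := q in enc_seq [:: enc_nat j; enc_nat i; enc_nat a; enc_nat b].
Definition plan_of (I : instance) := (seq segment * seq (run (job I)))%type.
Definition enc_plan I (st : plan_of I) : data :=
  Node (enc_seq (map enc_segment st.1)) (enc_seq (map (@enc_run I) st.2)).

Local Notation inst_place_seg I :=
  (place_seg (@release I) (@due I) (@scaled_req I) (hosts I) (capacity I)).
Local Notation inst_place_job I :=
  (place_job (@release I) (@due I) (@len I) (@scaled_req I) (hosts I) (capacity I)).
Local Notation inst_schedule I :=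
  (schedule_jobs (@release I) (@due I) (@len I) (@scaled_req I) (hosts I) (capacity I) (horizon I)).

Definition plan (I : instance) : plan_of I :=
  inst_schedule I (isort (@wider I) (greedy I)).

Section StateExpr.
Variables (J : eqType) (sz : J -> nat) (m D : nat) (j : J) (p : state).
Variables (st : store) (xp xs xm xD : expr).
Hypothesis xpE : eval st xp = enc_state p.
Hypothesis xsE : evn st xs (sz j).
Hypothesis xmE : evn st xm m.
Hypothesis xDE : evn st xD D.

Definition get_h := Fst xp.
Definition get_g := Fst (Snd xp).
Definition get_l := Snd (Snd xp).

Let hE : evn st get_h p.1.1. Proof. by rewrite /evn /= xpE. Qed.
Let gE : evn st get_g p.1.2. Proof. by rewrite /evn /= xpE. Qed.
Let lE : evn st get_l p.2. Proof. by rewrite /evn /= xpE. Qed.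

Definition enarrow := Leq (Mul (Lit 2) xs) xD.
Definition eopen := eif enarrow (elt (Add get_h get_g) xm)
  (elt (Add (Add get_h get_g) (elt (Lit 0) get_l)) xm).
Definition esmall := Leq (Mul (Lit 2) (Add get_l xs)) xD.
Definition eadd := Pair (eif enarrow (eif esmall get_h (Add get_h (Lit 1))) get_h)
  (Pair (eif enarrow get_g (Add get_g (Lit 1)))
        (eif enarrow (eif esmall (Add get_l xs) (Lit 0)) get_l)).
Definition ehost := eif enarrow get_h (esub xm (Add get_g (Lit 1))).

Let narrowE : evn st enarrow (narrow sz D j).
Proof. by apply: ev_leq => //; apply: ev_mul. Qed.

Let smallE : evn st esmall (2 * (p.2 + sz j) <= D).
Proof. by apply: ev_leq => //; apply: ev_mul => //; apply: ev_add. Qed.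

Lemma ev_open : evn st eopen (open_for sz m D j p).
Proof.
have -> : open_for sz m D j p = if narrow sz D j then p.1.1 + p.1.2 < m
    else p.1.1 + p.1.2 + (0 < p.2) < m by case: (p) => [[]].
apply: ev_ifb => //; apply: ev_lt => //; first exact: ev_add.
by apply: ev_add; [exact: ev_add | exact: ev_lt].
Qed.

Lemma eval_add : eval st eadd = enc_state (add_job sz D j p).
Proof.
pose s := 2 * (p.2 + sz j) <= D; pose n := narrow sz D j.
have -> : add_job sz D j p = ((if n then if s then p.1.1 else p.1.1.+1 else p.1.1),
    (if n then p.1.2 else p.1.2.+1), (if n then if s then p.2 + sz j else 0 else p.2)).
  by case: (p) @s => [[h g] l] /=; rewrite /n; case: ifP => // _; case: ifP.
have E1 : evn st (eif enarrow (eif esmall get_h (Add get_h (Lit 1))) get_h)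
    (if n then if s then p.1.1 else p.1.1.+1 else p.1.1).
  by apply: ev_if => //; apply: ev_if => //; apply: ev_S.
have E2 : evn st (eif enarrow get_g (Add get_g (Lit 1))) (if n then p.1.2 else p.1.2.+1).
  by apply: ev_if => //; apply: ev_S.
have E3 : evn st (eif enarrow (eif esmall (Add get_l xs) (Lit 0)) get_l)
    (if n then if s then p.2 + sz j else 0 else p.2).
  by apply: ev_if => //; apply: ev_if => //; apply: ev_add.
rewrite /evn in E1 E2 E3.
by rewrite /eadd !eval_pair E1 E2 E3.
Qed.

Lemma ev_host : evn st ehost (host_for sz m D j p).
Proof.
have -> : host_for sz m D j p = if narrow sz D j then p.1.1 else m - p.1.2.+1.
  by case: (p) => [[]].
by apply: ev_if => //; apply: ev_sub => //; apply: ev_S.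
Qed.
End StateExpr.

Section PlaceProgram.
Definition job_plan (I : instance) := (job I * plan_of I)%type.
Definition enc_job_plan (u : {I : instance & job_plan I}) : data :=
  Node (enc_scaled (tag u)) (Node (enc_record (tagged u).1) (enc_plan (tagged u).2)).

Definition place_state (u : {I : instance & job_plan I}) :=
  (segment * (nat * plan_of (tag u)))%type.
Definition enc_place_state (u : {I : instance & job_plan I}) (s : nat * plan_of (tag u)) : data :=
  Node (enc_nat s.1) (enc_plan s.2).
Definition enc_place (w : {u : {I : instance & job_plan I} & place_state u}) : data :=
  Node (enc_job_plan (tag w)) (Node (enc_segment (tagged w).1) (enc_place_state (tagged w).2)).

Lemma map_consif T U (f : T -> U) c x s : map f (consif c x s) = consif c (f x) (map f s).
Proof. by case: c. Qed.

Lemma PT_place_seg PW : PT PW enc_place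
  (fun w => enc_place_state (inst_place_seg (tag (tag w)) (tagged (tag w)).1 (tagged w).1 (tagged w).2)).
Proof.
pose W := {u : {I : instance & job_plan I} & place_state u}.
pose X (w : W) := (tagged w).1.
pose j (w : W) : job (tag (tag w)) := (tagged (tag w)).1.
pose b' (w : W) := minn (X w).1.2 (due (j w)).+1.
pose k (w : W) := minn (tagged w).2.1 (b' w - maxn (X w).1.1 (release (j w))).
pose e1 (w : W) := Node (enc_place w) (enc_nat (b' w)).
pose e2 (w : W) := Node (e1 w) (enc_nat (k w)).
have e1P : PT PW enc_place e1.
  apply: PT_pair; first exact: PT_id.
  pose rj := Fst (Snd (Fst (Var 0))); pose x := Fst (Snd (Var 0)).
  apply: (PT_expr (x := emin (Fst (Snd x)) (Add (get_due rj) (Lit 1)))) => w _.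
  by apply: ev_min => //; apply: ev_S.
have e2P : PT PW enc_place e2.
  apply: (PT_comp e1P); apply: PT_pair; first exact: PT_id.
  pose w := Fst (Var 0); pose rj := Fst (Snd (Fst w)); pose x := Fst (Snd w).
  apply: (PT_expr (x := emin (Fst (Snd (Snd w))) (esub (Snd (Var 0))
     (emax (Fst x) (get_release rj))))) => a _.
  by apply: ev_min => //; apply: ev_sub => //; apply: ev_max.
apply: (PT_comp e2P) => {e1P e2P}.
pose w := Fst (Fst (Var 0)); pose rj := Fst (Snd (Fst w)); pose x := Fst (Snd w).
pose c := Fst (Fst w); pose xb := Snd (Fst (Var 0)); pose xk := Snd (Var 0).
pose xp := Snd (Snd x); pose xs := get_req rj; pose xm := get_hosts c; pose xD := get_cap c.
pose R (a : W) := (tagged a).2.1 : nat.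
pose op (a : W) := open_for (@scaled_req (tag (tag a))) (hosts (tag (tag a))) (capacity (tag (tag a))) (j a) (X a).2.
pose out (a : W) := (tagged a).2.2.1 : seq segment.
apply: (@PT_eq _ _ _ (fun a => if op a && (0 < k a)
  then Node (enc_nat (R a - k a)) (Node
    (enc_seq (consif ((X a).1.1 < b' a - k a) (enc_segment ((X a).1.1, b' a - k a, (X a).2))
       (enc_segment (b' a - k a, b' a, add_job (@scaled_req (tag (tag a))) (capacity (tag (tag a))) (j a) (X a).2)
        :: consif (b' a < (X a).1.2) (enc_segment (b' a, (X a).1.2, (X a).2)) (map enc_segment (out a)))))
    (Node (enc_run (j a, host_for (@scaled_req (tag (tag a))) (hosts (tag (tag a))) (capacity (tag (tag a))) (j a) (X a).2, b' a - k a, (b' a).-1))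
      (enc_seq (map (@enc_run (tag (tag a))) (tagged a).2.2.2))))
  else Node (enc_nat (R a)) (Node (enc_seq (map enc_segment (X a :: out a)))
      (enc_seq (map (@enc_run (tag (tag a))) (tagged a).2.2.2))))).
  case=> [[I [j0 st]] [[[a b] p] [R0 [o ps]]]] _.
  rewrite /X /j /k /b' /op /R /out /place_seg /=; case: ifP => _ //.
  by rewrite /enc_place_state /enc_plan /= map_consif /= map_consif.
apply: PT_if.
- apply: (PT_expr (x := Mul (eopen xp xs xm xD) (elt (Lit 0) xk))) => a _.
  by apply: ev_and; [exact: ev_open | exact: ev_lt].
- apply: PT_pair.
    by apply: (PT_expr (x := esub (Fst (Snd (Snd w))) xk)) => a _; apply: ev_sub.
  apply: PT_pair.
    have e0P PW' : PT PW' e2 (fun a => enc_nat (b' a - k a)).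
      by apply: (PT_expr (x := esub xb xk)) => a _; apply: ev_sub.
    apply: PT_consif.
    + by apply: (PT_expr (x := elt (Fst x) (esub xb xk))) => a _; apply: ev_lt => //; apply: ev_sub.
    + apply: PT_pair; first exact: (PT_expr (x := Fst x)).
      by apply: PT_pair => //; exact: (PT_expr (x := xp)).
    apply: PT_pair.
      apply: PT_pair => //; apply: PT_pair; first exact: (PT_expr (x := xb)).
      by apply: (PT_expr (x := eadd xp xs xD)) => a _; apply: eval_add.
    apply: PT_consif.
    + by apply: (PT_expr (x := elt xb (Fst (Snd x)))) => a _; apply: ev_lt.
    + exact: (PT_expr (x := Pair xb (Snd x))).
    exact: (PT_expr (x := Fst (Snd (Snd (Snd w))))).
  apply: PT_pair; last exact: (PT_expr (x := Snd (Snd (Snd (Snd w))))).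
  apply: (PT_expr (x := Pair (get_index rj) (Pair (ehost xp xs xm xD) (Pair (esub xb xk)
     (Pair (esub xb (Lit 1)) (Lit 0)))))) => a _.
  have H1 : evn (fun=> e2 a) (ehost xp xs xm xD)
      (host_for (@scaled_req (tag (tag a))) (hosts (tag (tag a))) (capacity (tag (tag a))) (j a) (X a).2) by apply: ev_host.
  have H2 : evn (fun=> e2 a) (esub xb xk) (b' a - k a) by apply: ev_sub.
  have H3 : evn (fun=> e2 a) (esub xb (Lit 1)) (b' a).-1 by rewrite -subn1; apply: ev_sub.
  by rewrite !eval_pair H1 H2 H3.
by apply: (PT_expr (x := Pair (Fst (Snd (Snd w))) (Pair (Pair x (Fst (Snd (Snd (Snd w)))))
   (Snd (Snd (Snd (Snd w))))))).
Qed.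

End PlaceProgram.

Lemma dsize_node a b : dsize (Node a b) = (dsize a + dsize b).+1.
Proof. by []. Qed.

Section PlanSize.
Variable I : instance.
Local Notation N := (dsize (enc_scaled I)).
Local Notation inst_seg_ok := (seg_ok (hosts I) (capacity I) (horizon I)).
Local Notation inst_run_ok := (@run_ok (job I) (hosts I) (horizon I)).

Lemma dsize_record_le (j : job I) : dsize (enc_record j) <= N.
Proof.
have /splitPr E : j \in enum (job I) by rewrite mem_enum.
rewrite /enc_scaled; case: E => l1 l2.
have := dsize_enc_seq_mem (@enc_record I) l1 j l2; rewrite /=; lia.
Qed.

Lemma dsize_num n : [|| n <= hosts I, n <= (horizon I).+1 | n <= capacity I] ->
  dsize (enc_nat n) <= N.
Proof.
have N1 : dsize (enc_nat (hosts I)) + dsize (enc_nat (horizon I))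
    + dsize (enc_nat (capacity I)) + 3 <= N by rewrite /enc_scaled /=; lia.
have N2 : dsize (enc_nat (horizon I).+1) <= dsize (enc_nat (horizon I)) + 1.
  by have := dsize_atom_add (horizon I) 1; rewrite -PoszD addn1 [dsize (Atom 1)]/= trunc_log1.
by case/or3P=> /dsize_nat_le; lia.
Qed.

Lemma dsize_segment x : inst_seg_ok x -> dsize (enc_segment x) <= 5 * N + 4.
Proof.
case: x => [[a b] [[h g] l]] /and3P[/= a_le b_le /and3P[l_le hg _]].
have := @dsize_num a; have := @dsize_num b; have := @dsize_num h; have := @dsize_num g.
have := @dsize_num l; rewrite a_le b_le !orbT.
have -> : l <= capacity I by lia.
have -> : h <= hosts I by lia.
have -> : g <= hosts I by lia.
by rewrite !orbT /enc_segment /enc_state /= => /(_ isT) ? /(_ isT) ? /(_ isT) ? /(_ isT) ? /(_ isT) ?; lia.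
Qed.

Lemma dsize_run q : inst_run_ok q -> dsize (enc_run q) <= 5 * N + 5.
Proof.
case: q => [[[j i] a] b] /and3P[i_lt a_le b_le].
have := @dsize_num a; have := @dsize_num b; have := @dsize_num i.
rewrite a_le b_le (ltnW i_lt) !orbT => /(_ isT) Hi /(_ isT) Hb /(_ isT) Ha.
have Hj : dsize (enc_nat j) <= dsize (enc_record j) by rewrite /enc_record /=; lia.
have E : dsize (enc_run (j, i, a, b)) = dsize (enc_nat j) + dsize (enc_nat i)
   + dsize (enc_nat a) + dsize (enc_nat b) + 5 by rewrite /= trunc_log0; lia.
by have := dsize_record_le j; rewrite E; lia.
Qed.

Lemma dsize_plan segs ps : all inst_seg_ok segs -> all inst_run_ok ps ->
  dsize (enc_plan (segs, ps)) <= (size segs + size ps) * (5 * N + 6) + 3.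
Proof.
move=> segs_ok ps_ok.
rewrite -[dsize (enc_plan _)]/((dsize (enc_seq (map enc_segment segs))
  + dsize (enc_seq (map (@enc_run I) ps))).+1).
have H (T : Type) (enc : T -> data) (p : pred T) s :
    (forall x, p x -> dsize (enc x) <= 5 * N + 5) -> all p s ->
    dsize (enc_seq (map enc s)) <= size s * (5 * N + 6) + 1.
  move=> le_p; elim: s => [|x s IH] /= => [_|/andP[/le_p px /IH]]; first by rewrite trunc_log0.
  by rewrite mulSn; lia.
have le1 := H _ _ _ ps dsize_run ps_ok.
have le2 : dsize (enc_seq (map enc_segment segs)) <= size segs * (5 * N + 6) + 1.
  apply: (H _ _ inst_seg_ok) => // x /dsize_segment xP; apply: leq_trans xP _.
  by rewrite leq_add2l.
by rewrite mulnDl; lia.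
Qed.

End PlanSize.

Section PlanProgram.
Variable P : instance -> Prop.

Definition plan_ok (u : {I : instance & job_plan I}) : Prop :=
  all (seg_ok (hosts (tag u)) (capacity (tag u)) (horizon (tag u))) (tagged u).2.1 /\
  all (@run_ok (job (tag u)) (hosts (tag u)) (horizon (tag u))) (tagged u).2.2.

Definition candidates (u : {I : instance & job_plan I}) : seq segment :=
  low_last snd (tagged u).2.1.

Lemma PT_candidates PB :
  PT PB enc_job_plan (fun u => enc_seq (map enc_segment (candidates u))).
Proof.
have segsP : PT PB enc_job_plan (fun u => enc_seq (map enc_segment (tagged u).2.1)).
  exact: (PT_expr (x := Fst (Snd (Snd (Var 0))))).
have lowP : PT (member PB (fun u => (tagged u).2.1)) (enc_member enc_job_plan (fun=> enc_segment))
    (fun v => dbool (low (tagged v).2)).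
  apply: (PT_expr (x := elt (Lit 0) (Snd (Snd (Snd (Snd (Snd (Var 0)))))))) => v _.
  exact: ev_lt.
apply: (@PT_cat _ _ _ (fun=> segment) (fun=> enc_segment)).
  apply: (@PT_filter _ _ _ (fun=> segment) (fun=> enc_segment) _ segsP (fun _ x => ~~ low x.2)).
  by apply: (PT_comp lowP); apply: (PT_expr (x := enot (Var 0))) => v _; apply: ev_not.
exact: (@PT_filter _ _ _ (fun=> segment) (fun=> enc_segment) _ segsP (fun _ x => low x.2)).
Qed.

Lemma PT_place_job : PT plan_ok enc_job_plan
  (fun u => enc_plan (inst_place_job (tag u) (tagged u).1 (tagged u).2)).
Proof.
pose B := {I : instance & job_plan I}.
pose fin (u : B) := foldr (inst_place_seg (tag u) (tagged u).1)
   (len (tagged u).1, ([::], (tagged u).2.2)) (candidates u).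
have H : PT plan_ok enc_job_plan (fun u => enc_place_state (fin u)).
  apply: (@PT_foldr _ _ _ (fun=> segment) (fun u : B => (nat * plan_of (tag u))%type)
    (fun=> enc_segment) enc_place_state candidates _
    (fun u : B => inst_place_seg (tag u) (tagged u).1)).
  - exact: PT_candidates.
  - pose j := Fst (Snd (Var 0)).
    exact: (PT_expr (x := Pair (get_len j) (Pair (Lit 0) (Snd (Snd (Snd (Var 0))))))).
  - set R := reached _ _ _ _.
    apply: (@PT_eq _ _ _ (fun w : {u : B & place_state u} => enc_place_state
       (inst_place_seg (tag (tag w)) (tagged (tag w)).1 (tagged w).1 (tagged w).2))).
      by case=> u [x s].
    have := PT_place_seg R; congr PT.
    by apply/funext => -[u [x s]].
  have [C [k CP]] : pbounded plan_ok (dsize \o enc_job_plan) (fun u : B =>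
      10 * dsize (enc_job_plan u) * (10 * dsize (enc_job_plan u)) + 10 * dsize (enc_job_plan u)).
    by pb.
  exists C, k => u l1 l2 [segs_ok ps_ok] lE; apply: leq_trans (CP u (conj segs_ok ps_ok)).
  have all2 : all (seg_ok (hosts (tag u)) (capacity (tag u)) (horizon (tag u))) l2.
    have : all (seg_ok (hosts (tag u)) (capacity (tag u)) (horizon (tag u))) (candidates u).
      by rewrite /candidates /low_last all_cat; apply/andP; split; apply/allP => x;
         rewrite mem_filter => /andP[_ /(allP segs_ok)].
    by rewrite lE all_cat => /andP[].
  have := @place_segs_ok _ (@release (tag u)) (@due (tag u)) (@scaled_req (tag u))
    (hosts (tag u)) (capacity (tag u)) (horizon (tag u)) (tagged u).1 l2 (len (tagged u).1) _ all2 ps_ok.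
  have := @place_segs_size _ (@release (tag u)) (@due (tag u)) (@scaled_req (tag u))
    (hosts (tag u)) (capacity (tag u)) (tagged u).1 l2 (len (tagged u).1) (tagged u).2.2.
  have le2 : size l2 <= size (tagged u).2.1.
    by rewrite -(size_low_last (tagged u).2.1) -/(candidates u) lE size_cat leq_addl.
  case: (foldr _ _ l2) => R' [out' ps'] [H1 H2] [H3 H4 H5].
  have := dsize_plan H4 H5.
  rewrite -[dsize (@enc_place_state u _)]/((dsize (enc_nat R') + dsize (@enc_plan (tag u) (out', ps'))).+1).
  have := dsize_nat_le H3.
  have D1 : dsize (enc_record (tagged u).1) + dsize (enc_scaled (tag u))
     + dsize (enc_plan (tagged u).2) < dsize (enc_job_plan u).
    rewrite -[dsize (enc_job_plan u)]/((dsize (enc_scaled (tag u)) +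
      (dsize (enc_record (tagged u).1) + dsize (enc_plan (tagged u).2)).+1).+1); lia.
  have D2 : dsize (enc_nat (len (tagged u).1)) <= dsize (enc_record (tagged u).1).
    by rewrite /enc_record /=; lia.
  have D3 : size (tagged u).2.1 + size (tagged u).2.2 <= dsize (enc_plan (tagged u).2).
    have := size_enc_seq (map enc_segment (tagged u).2.1).
    have := size_enc_seq (map (@enc_run (tag u)) (tagged u).2.2).
    by rewrite !size_map /enc_plan /=; lia.
  have D4 := count_size (covers (release (tagged u).1)) l2.
  have D5 := count_size (covers (due (tagged u).1).+1) l2.
  move: (dsize (enc_job_plan u)) (dsize (enc_scaled (tag u))) D1 => M N D1 le_n le_plan.
  have {}H2 : size ps' <= size l2 + size (tagged u).2.2 := H2.
  have D6 : size out' + size ps' <= 10 * M by lia.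
  have D7 : 5 * N + 6 <= 10 * M by lia.
  apply: (@leq_trans (dsize (enc_nat (len (tagged u).1)) + ((size out' + size ps') * (5 * N + 6) + 3)).+1).
    by rewrite ltnS leq_add.
  by have := leq_mul D6 D7; lia.
apply: (PT_comp H).
have E : (fun u : B => enc_plan (inst_place_job (tag u) (tagged u).1 (tagged u).2)) =
    (fun u => enc_plan (fin u).2) by [].
by rewrite E; apply: (PT_expr (x := Snd (Var 0))).
Qed.

Lemma PT_plan : PT P enc_scaled (fun I => enc_plan (plan I)).
Proof.
apply: (@PT_foldr _ _ _ (fun I => job I) (fun I => plan_of I) (fun I => @enc_record I)
  (fun I => @enc_plan I) (fun I => isort (@wider I) (greedy I)) _ (fun I => inst_place_job I)).
- exact: PT_greedy_by_width.
- apply: (PT_expr (x := Pair (Pair (Pair (Lit 1) (Pair (Add (get_horizon (Var 0)) (Lit 1))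
     (Pair (Lit 0) (Pair (Lit 0) (Lit 0))))) (Lit 0)) (Lit 0))) => I _ /=.
  by rewrite -PoszD addn1.
- set R := reached _ _ _ _.
  have := PT_sub (P' := R) _ PT_place_job => H.
  apply: (@PT_eq _ _ _ (fun u : {I : instance & job_plan I} =>
     enc_plan (inst_place_job (tag u) (tagged u).1 (tagged u).2))); first by case=> I [j s].
  have -> : (fun u : {I : instance & job_plan I} => let: existT a (x, s) := u in
      Node (enc_scaled a) (Node (enc_record x) (enc_plan s))) = enc_job_plan.
    by apply/funext => -[I [j s]].
  apply: H => -[I [j st]] [_ [l1 [l2 [_ E]]]].
  have := schedule_bounds (@release I) (@due I) (@len I) (@scaled_req I) (hosts I)
    (capacity I) (horizon I) l2.
  rewrite /schedule_jobs -E /plan_ok /=.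
  by case: (st) => segs ps [].
have [C [k CP]] : pbounded P (dsize \o enc_scaled) (fun I =>
   (1 + 3 * dsize (enc_scaled I) + dsize (enc_scaled I) * (1 + 3 * dsize (enc_scaled I)))
    * (5 * dsize (enc_scaled I) + 6) + 3) by pb.
exists C, k => I l1 l2 PI lE; apply: leq_trans (CP I PI).
have := schedule_bounds (@release I) (@due I) (@len I) (@scaled_req I) (hosts I)
  (capacity I) (horizon I) l2.
rewrite /schedule_jobs; case: (foldr _ _ l2) => segs ps [_ le_segs le_ps segs_ok ps_ok].
apply: leq_trans (dsize_plan segs_ok ps_ok) _; rewrite leq_add2r leq_mul2r; apply/orP; right.
have le2 : size l2 <= dsize (enc_scaled I).
  apply: (@leq_trans (size (enum (job I)))).
    apply: (@leq_trans (size (isort (@wider I) (greedy I)))).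
      by rewrite lE size_cat leq_addl.
    rewrite (perm_size (perm_isort _ _)).
    apply: leq_trans (size_subseq (select_subseq _ _ _ _ _ _ _ _)) _.
    by rewrite (perm_size (perm_isort _ _)).
  have := size_enc_seq (map (@enc_record I) (enum (job I))); rewrite size_map => H.
  by apply: leq_trans (ltnW H) _; rewrite /enc_scaled !dsize_node; lia.
apply: leq_add.
  by apply: leq_trans le_segs _; rewrite leq_add2l leq_mul2l.
by apply: leq_trans le_ps _; apply: leq_mul => //; rewrite leq_add2l leq_mul2l.
Qed.

End PlanProgram.

Section ParseProgram.
Let P (I : instance) := valid I.

Definition enc_numbered I (j : job I) : data := Node (enc_nat j) (enc_job j).

Lemma dsize_nat_leS n : dsize (enc_nat n) <= n.+1.
Proof.
rewrite /= ltnS; case: n => [|n]; first by rewrite trunc_log0.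
by apply: leq_trans (trunc_logP (isT : 1 < 2) (ltn0Sn n)); apply/ltnW/ltn_expl.
Qed.

Lemma enum_split_ord n (l1 l2 : seq 'I_n) i : enum 'I_n = l1 ++ i :: l2 ->
  i = size l1 :> nat /\ size l1 + (size l2).+1 = n.
Proof.
move=> E; have := val_enum_ord n; rewrite E map_cat /= => E'.
have nE : size l1 + (size l2).+1 = n by have := size_enum_ord n; rewrite E size_cat.
split=> //; have := congr1 (fun s => nth 0 s (size l1)) E'.
by rewrite nth_cat size_map ltnn subnn /= nth_iota //; lia.
Qed.

Lemma PT_raw_jobs : PT P enc_instance (fun I => enc_seq (map (@enc_job I) (enum (job I)))).
Proof. exact: (PT_expr (x := Fst (Snd (Snd (Var 0))))). Qed.

Lemma PT_njobs : PT P enc_instance (fun I => enc_nat (njobs I)).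
Proof.
apply: (@PT_eq _ _ _ (fun I => enc_nat (\sum_(j <- enum (job I)) 1))).
  by move=> I _; rewrite sum1_size size_enum_ord.
apply: (@PT_sum _ _ _ (fun I => job I) _ _ PT_raw_jobs (fun _ _ => 1)).
exact: (PT_expr (x := Lit 1)).
Qed.

Lemma PT_numbered : PT P enc_instance
  (fun I => enc_seq (map (@enc_numbered I) (enum (job I)))).
Proof.
pose S (I : instance) := (nat * seq (job I))%type.
pose encS I (s : S I) := Node (enc_nat s.1) (enc_seq (map (@enc_numbered I) s.2)).
pose f I (j : job I) (s : S I) : S I := (s.1.-1, j :: s.2).
have fE I l : foldr (@f I) (njobs I, [::]) l = (njobs I - size l, l).
  elim: l => [|x l IH] /=; first by rewrite subn0.
  by rewrite IH /f /= subnS.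
have H : PT P enc_instance (fun I => encS I (foldr (@f I) (njobs I, [::]) (enum (job I)))).
  apply: (PT_foldr (encS := encS) (f := f) PT_raw_jobs).
  - apply: PT_pair; first exact: PT_njobs.
    exact: (PT_expr (x := Lit 0)).
  - pose x := Fst (Snd (Var 0)); pose c := Fst (Snd (Snd (Var 0))).
    pose c1 := esub c (Lit 1).
    apply: (PT_expr (x := Pair c1 (Pair (Pair c1 x) (Snd (Snd (Snd (Var 0))))))).
    move=> [I [j s]] [_ [l1 [l2 [lE sE]]]]; rewrite !eval_pair.
    have [jE nE] := enum_split_ord lE.
    have c1E : evn (fun=> Node (enc_instance I) (Node (enc_job j) (encS I s))) c1 s.1.-1.
      by rewrite -subn1; apply: ev_sub.
    rewrite c1E /encS /= /enc_numbered; congr (Node _ (Node (Node _ _) _)).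
    by rewrite sE fE /= jE; congr enc_nat; lia.
  have [C [k CP]] : pbounded P (dsize \o enc_instance) (fun I =>
      dsize (enc_instance I) + (dsize (enc_instance I)
        + dsize (enc_instance I) * (dsize (enc_instance I) + 2)) + 3) by pb.
  exists C, k => I l1 l2 PI lE; apply: leq_trans (CP I PI); rewrite fE /encS dsize_node.
  set N := dsize (enc_instance I).
  have raw_le : dsize (enc_seq (map (@enc_job I) (enum (job I)))) <= N.
    rewrite /N -[dsize (enc_instance I)]/((dsize (enc_nat (hosts I)) + (dsize (enc_nat (horizon I))
      + (dsize (enc_seq (map (@enc_job I) (enum (job I)))) + dsize (Atom 0)).+1).+1).+1); lia.
  have n_lt : njobs I < N.
    apply: leq_trans raw_le; rewrite -[X in X < _](size_enum_ord (njobs I)).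
    by rewrite -(size_map (@enc_job I)) size_enc_seq.
  have l2_le : dsize (enc_seq (map (@enc_job I) l2)) <= N.
    apply: leq_trans raw_le; rewrite lE map_cat dsize_enc_seq_cat.
    by have := dsize_gt0 (enc_seq (map (@enc_job I) l1)); lia.
  have sz2 : size l2 <= N.
    by apply: ltnW; apply: leq_trans l2_le; rewrite -(size_map (@enc_job I)) size_enc_seq.
  have num_le : dsize (enc_seq (map (@enc_numbered I) l2)) <=
      dsize (enc_seq (map (@enc_job I) l2)) + size l2 * (N + 2).
    elim: (l2) => [|x l IH]; first by rewrite addn0.
    have Hx := dsize_nat_leS x; have Hn := ltn_ord x.
    change (((dsize (enc_nat x) + dsize (enc_job x)).+1
      + dsize (enc_seq (map (@enc_numbered I) l))).+1 <=
      (dsize (enc_job x) + dsize (enc_seq (map (@enc_job I) l))).+1 + (size l).+1 * (N + 2)).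
    by rewrite mulSn; lia.
  apply: (@leq_trans ((njobs I - size l2).+1
      + (dsize (enc_seq (map (@enc_job I) l2)) + size l2 * (N + 2))).+1).
    by rewrite ltnS leq_add // dsize_nat_leS.
  by have := leq_mul sz2 (leqnn (N + 2)); move: l2_le n_lt; rewrite -/N; lia.
apply: (PT_comp H); apply: (PT_expr (x := Snd (Var 0))) => I _.
by rewrite fE.
Qed.

Definition get_raw_req x := Fst (Snd (Snd (Snd x))).
Definition get_raw_weight x := Fst (Snd (Snd (Snd (Snd x)))).

Lemma denq_nat q : Atom (denq q) = enc_nat `|denq q|.
Proof. by rewrite /enc_nat absz_denq. Qed.

Lemma numq_nat q : (0 <= q)%R -> Atom (numq q) = enc_nat `|numq q|.
Proof. by move=> q_ge0; rewrite /enc_nat gez0_abs // numq_ge0. Qed.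

Lemma PT_capacity : PT P enc_instance (fun I => enc_nat (capacity I)).
Proof.
apply: (@PT_prod _ _ _ (fun I => job I) _ _ PT_raw_jobs (@req_den)).
by apply: (PT_expr (x := Snd (get_raw_req (Snd (Var 0))))) => v _; rewrite /= denq_nat.
Qed.

Lemma PT_scaled : PT P enc_instance enc_scaled.
Proof.
apply: PT_pair; first exact: (PT_expr (x := Fst (Var 0))).
apply: PT_pair; first exact: (PT_expr (x := Fst (Snd (Var 0)))).
apply: PT_pair; first exact: PT_capacity.
apply: (PT_comp PT_numbered).
set e1 := fun I : instance => enc_seq _.
have numP : PT P e1 e1 by apply: PT_id.
pose B := {I : instance & job I}.
pose M : B -> Prop := member P (fun I : instance => enum (job I)).
pose eM : B -> data := enc_member e1 enc_numbered.
apply: (@PT_eq _ _ _ (fun I => enc_seq (map (@enc_record I) (map id (enum (job I)))))).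
  by move=> I _; rewrite map_id.
apply: (@PT_map _ _ e1 (fun I => job I) enc_numbered _ numP (fun I => job I) enc_record (fun _ => id)).
pose others (v : B) := \prod_(k <- enum (job (tag v))) (if k == tagged v then 1 else req_den k).
have othersP : PT M eM (fun v => enc_nat (others v)).
  have listP : PT M eM (fun v => enc_seq (map (@enc_numbered (tag v)) (enum (job (tag v))))).
    exact: (PT_expr (x := Fst (Var 0))).
  apply: (@PT_prod _ _ _ (fun v : B => job (tag v)) _ _ listP
    (fun v k => if k == tagged v then 1 else req_den k)).
  pose k := Fst (Snd (Var 0)); pose j := Fst (Snd (Fst (Var 0))).
  apply: (PT_expr (x := eif (Mul (Leq k j) (Leq j k)) (Lit 1)
    (Snd (get_raw_req (Snd (Snd (Var 0))))))) => w _.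
  rewrite -val_eqE eqn_leq.
  apply: ev_if; [by apply: ev_and; apply: ev_leq | exact: ev_lit | ].
  by rewrite /evn /= denq_nat.
apply: (PT_comp (PT_pair (PT_id _ _) othersP)).
pose x := Snd (Snd (Fst (Var 0))); pose o := Snd (Var 0).
apply: (PT_expr (x := Pair (Fst (Snd (Fst (Var 0)))) (Pair (Fst x) (Pair (Fst (Snd x))
  (Pair (Fst (Snd (Snd x))) (Pair (Mul (Fst (get_raw_req x)) o)
    (Pair (Fst (get_raw_weight x)) (Snd (get_raw_weight x))))))))) => -[I j] [vI _].
have [_ _ _ /andP[req_gt0 _] w_ge0] := vI j.
pose v : B := existT _ I j.
have E : evn (fun=> Node (eM v) (enc_nat (others v))) (Mul (Fst (get_raw_req x)) o) (scaled_req j).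
  by apply: ev_mul => //; rewrite /evn /= numq_nat // ltW.
by rewrite !eval_pair E /enc_record /= denq_nat numq_nat.
Qed.

Lemma PT_solution : PT P enc_instance
  (fun I => Node (enc_seq (map enc_nat (map val (isort (@wider I) (greedy I)))))
                 (enc_seq (map (@enc_run I) (plan I).2))).
Proof.
apply: (PT_comp PT_scaled); apply: PT_pair.
  apply: (@PT_map _ _ _ (fun I => job I) enc_record _ (PT_greedy_by_width P)
    (fun=> nat) (fun=> enc_nat) (fun I => val)).
  exact: (PT_expr (x := Fst (Snd (Var 0)))).
apply: (PT_comp (PT_plan P)).
exact: (PT_expr (x := Snd (Var 0))).
Qed.

Lemma PT_polytime A (P' : A -> Prop) (enc f : A -> data) (Q : A -> data -> Prop) :
  PT P' enc f -> (forall a, P' a -> Q a (f a)) ->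
  exists c, polytime_solves enc P' Q c.
Proof.
move=> [c [C [k cP]]] fQ; exists (c 0), C, k => a Pa.
have [st' [n [H1 H2 _ H3]]] := cP a Pa 0 (update (fun=> Atom 0) 0 (enc a)) erefl.
exists (f a), n; split; [by exists st' | by apply: leq_trans H3 (leq_addr _ _) | exact: fQ].
Qed.

End ParseProgram.

Section ScaledInstance.
Variable I : instance.
Hypothesis vI : valid I.
Implicit Types j k : job I.

Local Notation m := (hosts I).
Local Notation D := (capacity I).
Local Notation sz := (@scaled_req I).
Local Notation wid := (width (@release I) (@due I)).
Local Notation sb := (sub (@release I) (@due I)).
Local Notation dj := (disj (@release I) (@due I)).

Lemma rel_due j : 1 <= release j <= due j.
Proof. by case: (vI j). Qed.

Lemma card_window j : #|window j| = wid j.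
Proof.
have [/andP[r1 rd] dT _ _ _] := vI j.
have -> : #|window j| = size [seq t <- iota 0 (horizon I).+1 | release j <= t <= due j].
  rewrite -val_enum_ord filter_map size_map cardE; congr size.
  by rewrite enumT; apply: eq_filter => t; rewrite /= !inE.
have P : perm_eq [seq t <- iota 0 (horizon I).+1 | release j <= t <= due j] (iota (release j) (wid j)).
  apply: uniq_perm; rewrite ?filter_uniq ?iota_uniq // => t.
  by rewrite mem_filter !mem_iota /width; lia.
by rewrite (perm_size P) size_iota.
Qed.

Lemma window_sub j k : (window j \subset window k) = sb j k.
Proof.
have [/andP[r1 rd] dT _ _ _] := vI j.
apply/subsetP/idP => [H|/andP[rk dk] t]; last by rewrite !inE; lia.
have rT : release j < (horizon I).+1 by lia.
have dT' : due j < (horizon I).+1 by lia.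
have := H (Ordinal rT); have := H (Ordinal dT'); rewrite !inE /= /sub.
by rewrite !leqnn rd => /(_ isT) ? /(_ isT) ?; lia.
Qed.

Lemma laminar_jobs (lamI : laminar I) j k : [|| sb j k, sb k j | dj j k].
Proof.
have := lamI j k; rewrite !window_sub => /or3P[->|->|dis]; rewrite ?orbT //.
have [/andP[r1 rd] dT _ _ _] := vI j; have [/andP[r1' rd'] dT' _ _ _] := vI k.
apply/orP; right; apply/orP; right; rewrite /disj; apply: contraTT dis => no.
have tT : maxn (release j) (release k) < (horizon I).+1 by lia.
apply/pred0Pn; exists (Ordinal tT); rewrite !inE /=; lia.
Qed.

Lemma capacity_gt0 : 0 < D.
Proof. by rewrite prodn_gt0 // => k; rewrite /req_den absz_gt0 denq_neq0. Qed.

Lemma scaled_reqE j : ((sz j)%:R = req j * D%:R :> rat)%R.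
Proof.
have [_ _ _ /andP[r_gt0 _] _] := vI j.
rewrite /scaled_req /capacity (big_rem j) ?mem_enum //= eqxx mul1n.
rewrite [in RHS](big_rem j) ?mem_enum //=.
rewrite (_ : \prod_(k <- rem j (enum (job I))) (if k == j then 1 else req_den k) =
   \prod_(k <- rem j (enum (job I))) req_den k); last first.
  apply: eq_big_seq => k; rewrite mem_rem_uniq ?enum_uniq // inE => /andP[/negbTE -> _] //.
rewrite !natrM mulrA; congr (_ * _)%R; rewrite /req_num /req_den.
rewrite -[LHS]/(`|numq (req j)|%:~R)%R -[X in (_ * X)%R]/(`|denq (req j)|%:~R)%R.
rewrite normr_denq ger0_norm ?numq_ge0 ?ltW //.
by rewrite -{2}(divq_num_den (req j)) divfK // intr_eq0 denq_neq0.
Qed.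

Lemma scaled_req_le j : sz j <= D.
Proof.
have [_ _ _ /andP[_ r_le1] _] := vI j.
by rewrite -(ler_nat rat) scaled_reqE ler_piMl.
Qed.

Lemma scaled_req_gt0 j : 0 < sz j.
Proof.
have [_ _ _ /andP[r_gt0 _] _] := vI j.
by rewrite -(ltr_nat rat) scaled_reqE mulr_gt0 ?ltr0n ?capacity_gt0.
Qed.

Lemma job_area_gt0 j : 0 < job_area j.
Proof. by case: (vI j) => _ _ l_gt0 _ _; rewrite muln_gt0 l_gt0 scaled_req_gt0. Qed.

Lemma less_denseE j k : less_dense j k =
  (weight j / (job_area j)%:R <= weight k / (job_area k)%:R)%R.
Proof.
have wE (i : job I) : weight i = ((weight_num i)%:R / (weight_den i)%:R)%R.
  have [_ _ _ _ w_ge0] := vI i.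
  rewrite -[LHS]divq_num_den /weight_num /weight_den.
  rewrite -[X in (_ = X / _)%R]/(`|numq (weight i)|%:~R)%R -[X in (_ = _ / X)%R]/(`|denq (weight i)|%:~R)%R.
  by rewrite normr_denq ger0_norm ?numq_ge0.
have den_gt0 (i : job I) : (0 < (weight_den i)%:R :> rat)%R.
  by rewrite ltr0n /weight_den absz_gt0 denq_neq0.
have area_gt0 (i : job I) : (0 < (job_area i)%:R :> rat)%R by rewrite ltr0n job_area_gt0.
rewrite !wE -!mulrA -!invfM ler_pdivrMr ?mulr_gt0 // mulrAC ler_pdivlMr ?mulr_gt0 //.
by rewrite /less_dense -!natrM ler_nat !mulnA.
Qed.

End ScaledInstance.

Section PlanCorrect.
Variable I : instance.
Hypothesis vI : valid I.
Hypothesis lamI : laminar I.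
Implicit Types j k : job I.

Local Notation m := (hosts I).
Local Notation D := (capacity I).
Local Notation sz := (@scaled_req I).
Local Notation wid := (width (@release I) (@due I)).
Local Notation sb := (sub (@release I) (@due I)).
Local Notation dj := (disj (@release I) (@due I)).
Local Notation inwin := (inwin (@release I) (@due I)).
Local Notation order := (isort (@wider I) (greedy I)).
Local Notation us := (unit_runs (plan I).2).

Lemma width_gt0 j : 0 < wid j.
Proof. by have := rel_due vI j; rewrite /width; lia. Qed.

Lemma uniq_greedy : uniq (greedy I).
Proof.
apply: subseq_uniq (select_subseq _ _ _ _ _ _ _ _) _.
by rewrite (perm_uniq (perm_isort _ _)) enum_uniq.
Qed.

Lemma uniq_order : uniq order.
Proof. by rewrite (perm_uniq (perm_isort _ _)) uniq_greedy. Qed.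

Lemma room_le p i : good m D p -> room m D p i <= D.
Proof. by case: p => [[h g] l]; rewrite /good /room; do ![case: ifP => //]; lia. Qed.

Lemma plan_spec : 0 < m -> (forall j, len j <= wid j) ->
  [/\ {in us, forall u, [/\ u.1.1 \in order, u.1.2 < m & inwin u.1.1 u.2]},
      {in order, forall j, uniq (times_of j us) /\ size (times_of j us) = len j}
    & forall i t, i < m -> host_load sz us i t <= D].
Proof.
move=> m_gt0 len_le.
have [j0 _|no_job] := pickP (fun j : job I => true); last first.
  have E : order = [::] by case: (order) => // j s; have := no_job j.
  by rewrite /plan E; split=> // i t im; rewrite /host_load big_nil.
pose F j : rat := ((len j)%:R / (wid j)%:R)%R.
have [i0 _ i0_max] := @arg_maxP _ _ _ j0 predT F isT.
have ratio : {in order, forall j, len j * wid i0 <= len i0 * wid j}.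
  move=> j _; have : (F j <= F i0)%R := i0_max j isT.
  rewrite /F ler_pdivrMr ?ltr0n ?width_gt0 //.
  by rewrite mulrAC ler_pdivlMr ?ltr0n ?width_gt0 // -!natrM ler_nat.
have vO : {in order, forall j, valid_job (@release I) (@due I) (@len I) sz D (horizon I) j}.
  move=> j _; have [/andP[r1 rd] dT l_gt0 _ _] := vI j.
  by rewrite /valid_job r1 rd dT l_gt0 scaled_req_le.
have wO : {in order, forall j,
    within (@release I) (@due I) (@len I) m D (load (@release I) (@due I) (@len I) sz order j) j j /\
    within (@release I) (@due I) (@len I) m D (load (@release I) (@due I) (@len I) sz order j) j i0}.
  move=> j _; rewrite /load (perm_big _ (perm_isort (@wider I) (greedy I))).
  by split; apply: select_within => //; rewrite mem_enum.
have pO : pairwise (fun j k => sb k j || dj k j) order.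
  have tot : total (@wider I) by move=> j k; apply: leq_total.
  have tr : transitive (@wider I) by move=> k j l; rewrite /wider => ? ?; apply: leq_trans; eassumption.
  apply: sub_pairwise (isort_pairwise (greedy I) tot tr) => j k.
  have := laminar_jobs vI lamI k j; have := rel_due vI j; have := rel_due vI k.
  by rewrite /wider /width /sub /disj; lia.
have IS := schedule_inv m_gt0 (capacity_gt0 I) uniq_order vO pO
  (fun k l _ _ => laminar_jobs vI lamI k l) (width_gt0 i0) ratio wO.
split; [exact: inv_runs IS | exact: inv_times IS | move=> i t im].
have [/mapP[c cC tE]|tC] := boolP (t \in map fst (cells (plan I).1)).
  rewrite tE; apply: leq_trans (inv_load IS cC im) _.
  by apply: room_le; apply: inv_good IS _ cC.
rewrite /host_load big1_seq // => u /andP[/andP[_ /eqP ut] uus].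
have [_ _ /andP[u1 u2]] := inv_runs IS uus.
case/negP: tC; apply: (inv_cover IS); rewrite -ut.
have [/andP[r1 _] dT _ _ _] := vI u.1.1.
by rewrite (leq_trans r1 u1) (leq_trans u2 dT).
Qed.

Variable h0 : host I.

Definition to_piece (q : run (job I)) : piece I :=
  let: (j, i, a, b) := q in (j, insubd h0 i, a, b).

Definition pieces : seq (piece I) := map to_piece (plan I).2.

Lemma plan_run_ok : all (@run_ok (job I) m (horizon I)) (plan I).2.
Proof.
have := schedule_bounds (@release I) (@due I) (@len I) sz m D (horizon I) order.
by rewrite -/(plan I); case: (plan I) => segs ps [].
Qed.

Lemma enc_pieces : map (@enc_piece I) pieces = map (@enc_run I) (plan I).2.
Proof.
rewrite -map_comp; apply/eq_in_map => -[[[j i] a] b] /(allP plan_run_ok) /and3P[im _ _].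
by rewrite /= val_insubd im.
Qed.

Lemma mem_schedule i t j :
  (j \in schedule_of pieces i t) = ((j, val i, val t) \in us).
Proof.
rewrite inE has_map; apply/hasP/flatten_mapP => -[[[[j' i'] a] b] qP].
  have /and3P[im _ _] := allP plan_run_ok _ qP.
  move=> /and3P[/eqP jE /eqP iE tab]; exists (j', i', a, b) => //=.
  apply/mapP; exists (val t); first by rewrite mem_iota /=; lia.
  by rewrite -jE -iE val_insubd im.
move=> /mapP[t']; rewrite mem_iota => tab [jE iE tE]; exists (j', i', a, b) => //=.
have /and3P[im _ _] := allP plan_run_ok _ qP.
rewrite jE eqxx -val_eqE val_insubd im /= -iE eqxx /=; move: tab; rewrite -tE /=; lia.
Qed.

Lemma plan_feasible : (forall j, len j <= wid j) ->
  feasible_schedule [set j in order] (schedule_of pieces).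
Proof.
move=> len_le; have m_gt0 : 0 < m by apply: leq_ltn_trans (ltn_ord h0).
have [runsP timesP loadP] := plan_spec m_gt0 len_le.
have inT j t : inwin j t -> t < (horizon I).+1.
  by have [_ dT _ _ _] := vI j; rewrite /inwin; lia.
split.
- move=> i t; apply/subsetP => j; rewrite mem_schedule inE => /runsP[].
  by [].
- by move=> i t j; rewrite mem_schedule => /runsP[_ _ tw]; rewrite inE.
- move=> i t; rewrite -(ler_pM2r (_ : 0 < D%:R)%R) ?ltr0n ?capacity_gt0 // mul1r.
  rewrite mulr_suml (eq_bigr (fun j => (sz j)%:R)%R); last by move=> j _; rewrite scaled_reqE.
  rewrite -natr_sum ler_nat; apply: leq_trans (loadP i t (ltn_ord i)).
  rewrite /host_load.
  have E (u : unit_run (job I)) : sz u.1.1 = \sum_(j | j == u.1.1) sz j.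
    by rewrite big_pred1_eq.
  under [X in _ <= X]eq_bigr do rewrite E.
  rewrite (exchange_big_dep predT) //= big_mkcond /=; apply: leq_sum => j _.
  case: ifP => //; rewrite mem_schedule => jus.
  by rewrite (big_rem _ jus) /= !eqxx /= leq_addr.
- move=> i i' t j; rewrite !mem_schedule => H1 H2; apply/val_inj.
  have [jO _ _] := runsP _ H1.
  have [ut _] := timesP j jO.
  have inF x : (j, x, val t) \in us -> (j, x, val t) \in [seq u <- us | u.1.1 == j].
    by move=> H; rewrite mem_filter eqxx.
  by have [] := uniq_map_inj ut (inF _ H1) (inF _ H2) erefl.
move=> j; rewrite inE => jO; have [ut szt] := timesP j jO.
have times_lt t : t \in times_of j us -> t < (horizon I).+1.
  move=> /mapP[u]; rewrite mem_filter => /andP[_ /runsP[_ _ tw]] ->.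
  exact: inT tw.
pose s : seq (slot I) := map inord (times_of j us).
have s_uniq : uniq s.
  rewrite map_inj_in_uniq // => x y /times_lt xT /times_lt yT /(congr1 val).
  by rewrite /= !inordK.
rewrite -szt -(size_map (inord : nat -> slot I)) -/s -(card_uniqP s_uniq).
apply/subset_leq_card/subsetP => t /mapP[t' t's tE].
have t'T := times_lt _ t's; move/mapP: t's => [[[j' i] t2]].
rewrite mem_filter /= => /andP[/eqP -> uus] t2E.
have [_ im tw] := runsP _ uus; rewrite /= in im tw.
rewrite !inE tE inordK // t2E; apply/andP; split=> //.
apply/existsP; exists (Ordinal im); rewrite mem_schedule /= inordK // -?t2E //.
Qed.

End PlanCorrect.

Section GreedyProfit.
Variables (R : realType) (I : instance) (lambda : R).
Hypothesis vI : valid I.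
Hypothesis lamI : laminar I.
Implicit Types j k : job I.
Local Open Scope ring_scope.

Local Notation m := (hosts I).
Local Notation D := (capacity I).
Local Notation sz := (@scaled_req I).
Local Notation wid := (width (@release I) (@due I)).
Local Notation sb := (sub (@release I) (@due I)).

Lemma feasible_area (O : {set job I}) k : feasibly_scheduled O ->
  (\sum_(j <- enum (job I) | (j \in O) && sb j k) area (@len I) sz j <= D * m * wid k)%N.
Proof.
move=> [sch [subO inw fit _ enough]].
have load_le i t : (\sum_(j in sch i t) sz j <= D)%N.
  rewrite -(ler_nat rat) natr_sum (eq_bigr (fun j => req j * D%:R)); last first.
    by move=> j _; rewrite scaled_reqE.
  by rewrite -mulr_suml ler_piMl.
have area_le j : j \in O -> sb j k ->
    (area (@len I) sz j <= \sum_(t in window k) \sum_(i < m) (j \in sch i t) * sz j)%N.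
  move=> jO jk; rewrite /area; apply: leq_trans (leq_mul (enough j jO) (leqnn _)) _.
  rewrite -sum1_card big_distrl /= (bigID (fun t => t \in window k)) /=.
  rewrite [X in (_ + X)%N]big_pred0 ?addn0; last first.
    move=> t; rewrite inE; apply/negP => /andP[/andP[tj _]] /negP[].
    by move: tj; rewrite -window_sub // in jk; apply: (subsetP jk).
  rewrite big_mkcond [leqRHS]big_mkcond /=; apply: leq_sum => t _.
  case: ifP => // /andP[]; rewrite inE => /andP[_ /existsP[i ji]] ->.
  by rewrite (bigD1 i) //= ji leq_addr.
apply: (@leq_trans (\sum_(j | (j \in O) && sb j k)
    \sum_(t in window k) \sum_(i < m) (j \in sch i t) * sz j)%N).
  rewrite big_enum_cond; apply: leq_sum => j /andP[_ /andP[jO jk]].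
  exact: area_le.
rewrite exchange_big /=.
apply: (@leq_trans (\sum_(t in window k) \sum_(i < m) D)%N); last first.
  by rewrite !sum_nat_const card_ord card_window // mulnC [(m * _)%N]mulnC.
apply: leq_sum => t _; rewrite exchange_big /=; apply: leq_sum => i _.
apply: leq_trans (load_le i t); rewrite big_mkcond [leqRHS]big_mkcond /=.
by apply: leq_sum => j _; case: ifP => // _; case: (j \in sch i t); rewrite ?mul1n.
Qed.

Lemma greedy_profit c : (0 < m)%N ->
  2 * c * m%:R = m%:R - lambda * (m%:R + 2) -> 0 <= c <= 1 ->
  (forall j, (len j)%:R <= lambda * (wid j)%:R) ->
  c * ratr (opt I) <= ratr (profit [set j in isort (@wider I) (greedy I)]).
Proof.
move=> m_gt0 cE c01 lenP.
have w_ge0 j : 0 <= weight j by case: (vI j).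
have profitE (s : seq (job I)) : uniq s ->
    ratr (profit [set j in s]) = \sum_(j <- s) ratr (weight j) :> R.
  move=> us; rewrite /profit rmorph_sum big_uniq //=.
  by apply: eq_bigl => j; rewrite inE.
rewrite profitE ?uniq_order // (perm_big _ (perm_isort _ _)) /=.
rewrite /opt; apply: (big_ind (fun x => c * ratr x <= _)).
- by rewrite rmorph0 mulr0 sumr_ge0 // => j _; rewrite ler0q.
- by move=> x y Hx Hy; rewrite /Num.max; case: ifP.
move=> O /asboolP feasO.
have := @select_profit _ (@release I) (@due I) (@len I) sz m D R lambda c (enum (job I))
  m_gt0 (capacity_gt0 I) cE c01.
move=> /(_ _ _ _ _ (mem O) _ (fun j => ratr (weight j)) (isort (@less_dense I) (enum (job I)))).
rewrite -/(greedy I) (perm_big _ (perm_isort _ _)) /= big_enum_cond /=.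
rewrite /profit rmorph_sum /=; apply.
- by move=> j _; case/andP: (rel_due vI j).
- by move=> j _.
- by move=> j _; apply: scaled_req_le.
- by move=> j k _ _; apply: laminar_jobs.
- by move=> k _; rewrite ler_nat; apply: feasible_area.
- exact: perm_isort.
- by rewrite (perm_uniq (perm_isort _ _)) enum_uniq.
- by move=> j; rewrite ler0q.
- by move=> j _; apply: job_area_gt0.
have tot : total (@less_dense I) by move=> j k; rewrite !less_denseE // le_total.
have tr : transitive (@less_dense I) by move=> j k l; rewrite !less_denseE //; apply: le_trans.
apply: pairwise_sorted; apply: sub_pairwise (isort_pairwise _ tot tr) => j k.
rewrite less_denseE // ler_pdivrMr ?ltr0n ?job_area_gt0 // mulrAC.
rewrite ler_pdivlMr ?ltr0n ?job_area_gt0 // -(ler_rat R) !rmorphM /= !ratr_nat.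
by [].
Qed.

End GreedyProfit.

Local Open Scope ring_scope.

Theorem theorem2 (R : realType) (m : nat) (lambda : R)
  (hm : (1 <= m)%N)
  (hlambda : 0 < lambda < 1 - 2%:R / (m + 2)%:R) :
  exists c : cmd,
    polytime_solves enc_instance
      (fun I : instance =>
         [/\ hosts I = m, valid I, laminar I
           & forall j : job I,
               (len j)%:R <= lambda * #|window j|%:R])
      (fun (I : instance) (y : data) =>
         exists (s : seq (job I)) (ps : seq (piece I)),
           [/\ y = enc_solution s ps,
               feasible_schedule [set j in s] (schedule_of ps)
             & (2%:R^-1 - lambda * (2%:R^-1 + m%:R^-1)) * ratr (opt I)
                 <= ratr (profit [set j in s])])
      c.
Proof.
have [l_gt0 l_lt] := andP hlambda.
apply: (PT_polytime (PT_sub _ PT_solution)) => [I [] //|I [mE vI lamI lenP]].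
have m_gt0 : (0 < hosts I)%N by rewrite mE.
have lenP' j : (len j)%:R <= lambda * (width (@release I) (@due I) j)%:R.
  by rewrite -card_window.
have m0 : 0 < m%:R :> R by rewrite ltr0n.
have l_lt1 : lambda * (m%:R + 2) < m%:R.
  move: l_lt; rewrite natrD -(ltr_pM2r (_ : 0 < m%:R + 2%:R)) ?addr_gt0 //.
  by rewrite mulrBl mul1r divfK ?gt_eqF ?addr_gt0 // addrK.
have l_le1 : lambda <= 1.
  rewrite -(ler_pM2r m0) mul1r; apply: ltW; apply: le_lt_trans l_lt1.
  by rewrite ler_wpM2l ?(ltW l_gt0) // lerDl.
have len_le j : (len j <= width (@release I) (@due I) j)%N.
  by rewrite -(ler_nat R) (le_trans (lenP' j)) // ler_piMl.
exists (isort (@wider I) (greedy I)), (pieces (Ordinal m_gt0)); split.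
- by rewrite /enc_solution enc_pieces -map_comp.
- exact: plan_feasible.
set c := _ - _ * _; have cE : 2 * c * m%:R = m%:R - lambda * (m%:R + 2).
  by rewrite /c; field; rewrite gt_eqF.
apply: (@greedy_profit _ _ lambda) => //; first by rewrite mE.
apply/andP; split.
  by rewrite -(pmulr_lge0 _ m0) -(pmulr_rge0 _ (ltr0Sn R 1)) mulrA cE subr_ge0 ltW.
by rewrite /c; have : 0 <= lambda * (2%:R^-1 + m%:R^-1) by [rewrite mulr_ge0 ?addr_ge0 ?invr_ge0 // ltW]; lra.
Qed.
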